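(* If $w\in S_n$ is a vexillary permutation, then $\mathcal{G}_w=G_{\lambda(w),f(w)}$, where $\mathcal{G}_w$ is the Grothendieck polynomial of $w$ and $G_{\lambda(w),f(w)}$ is the flagged Grothendieck polynomial of the partition $\lambda(w)$ and flagging $f(w)$ associated to $w$.
   Context: $x=(x_1,x_2,\dots)$ are variables, $\beta$ is a parameter. For $h\in\mathbb{Z}[\beta][[x]]$, let $s_i(h)$ be obtained by exchanging $x_i$ and $x_{i+1}$, and $$\pi_i(h)=\frac{(1+\beta x_{i+1})h-(1+\beta x_i)s_i(h)}{x_i-x_{i+1}}.$$ Grothendieck polynomials: let $S_n$ be the symmetric group on $\{1,\dots,n\}$, $s_i$ the transposition of $i$ and $i+1$, $\ell$ the length. For the longest element $w_0\in S_n$, $\mathcal{G}_{w_0}=\prod_{i=1}^{n-1}x_i^{n-i}$. If $w\ne w_0$, choose $i$ with $\ell(ws_i)=\ell(w)+1$ and set $\mathcal{G}_w=\pi_i(\mathcal{G}_{ws_i})$; this is independent of the choice of $i$. Partition and flagging of a vexillary permutation: $w\in S_n$ is vexillary if there are no $a<b<c<d$ with $w(b)<w(a)<w(d)<w(c)$. Put $r_w(p,q)=\#\{i\le p: w(i)\le q\}$, the diagram $$D(w)=\{(p,q)\in\{1,\dots,n\}^2: w(p)>q \text{ and } w^{-1}(q)>p\},$$ and the essential set $\mathcal{E}ss(w)=\{(p,q)\in D(w): (p+1,q)\notin D(w),\ (p,q+1)\notin D(w)\}$. For vexillary $w$, $\lambda(w)$ is the partition such that for every $k\in\mathbb{Z}$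 the number of boxes of the form $(i,i+k)$ in the Young diagram $\{(i,j):1\le j\le \lambda(w)_i\}$ of $\lambda(w)$ equals the number of boxes of the form $(i,i+k)$ in $D(w)$. Let $r$ be the length (number of positive parts) of $\lambda(w)$. Choose a subset $\{(p_i,q_i): i=1,\dots,r\}$ of $\{1,\dots,n\}^2$ containing $\mathcal{E}ss(w)$ with $$p_1\le\cdots\le p_r,\qquad q_1\ge\cdots\ge q_r,\qquad p_i-r_w(p_i,q_i)=i\ \ (i=1,\dots,r)$$ (such a subset exists), and set $f(w)=(p_1,\dots,p_r)$. The set $FSVT(\lambda(w),f(w))$ defined below does not depend on the choice. Flagged Grothendieck polynomials: for a partition $\lambda=(\lambda_1\ge\cdots\ge\lambda_r>0)$ and a flagging $f$ of $\lambda$ (a weakly increasing sequence $(f_1,\dots,f_r)$ of positive integers), $FSVT(\lambda,f)$ is the set of fillings $T$ of the boxes of the Young diagram of $\lambda$ (English notation) such that box $(i,j)$ contains a non-empty subset of $\{1,\dots,f_i\}$, the maximum at $(i,j)$ is at most the minimum at $(i,j+1)$ whenever $j+1\le\lambda_i$, and strictly less than the minimum at $(i+1,j)$ whenever $j\le\lambda_{i+1}$. Then $$G_{\lambda,f}(x)=\sum_{T\in FSVT(\lambda,f)}\beta^{|T|-|\lambda|}\prod_{k\in T}x_k,$$ where $|T|$ is the total number of entries of $T$, $|\lambda|$ the number of boxes of $\lambda$, and the product is over all entries of $T$ (with multiplicity). For the empty partition $G_{\lambda,f}=1$. *)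

(* Defs.v *)
From HB Require Import structures.
From mathcomp Require Import all_boot all_order all_algebra all_fingroup.
From mathcomp Require Import mpoly.

Set Implicit Arguments.
Unset Strict Implicit.
Unset Printing Implicit Defensive.

Import GRing.Theory.
Local Open Scope ring_scope.

(* Conventions.
   - Indices are 0-based: x_k is 'X_(k-1), and row, column and box numbers are
     all lower by one than in the usual 1-based numbering.
   - The coefficient ring Z[beta] is {poly int}, with beta = 'X.
   - For w in S_n the computations take place in Z[beta][x_1, ..., x_n], which
     contains both sides of the identity and is stable under the operators
     pi_1, ..., pi_{n-1} of Z[beta][[x]]. *)

Notation Zbeta := {poly int}.
Definition beta {n} : {mpoly Zbeta[n]} := ('X : Zbeta)%:MP.

Section Grothendieck.
Variable n : nat.
Implicit Types (i : 'I_n.-1) (w : 'S_n) (h : {mpoly Zbeta[n]}).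

Lemma ordR_subproof i : (i.+1 < n)%N.
Proof. by case: n i => [|m] [i]. Qed.

(* The positions exchanged by the adjacent transposition number i. *)
Definition ordL i : 'I_n := widen_ord (leq_pred n) i.
Definition ordR i : 'I_n := Ordinal (ordR_subproof i).
Definition stransp i : 'S_n := tperm (ordL i) (ordR i).

Definition pi_num i h : {mpoly Zbeta[n]} :=
  (1 + beta * 'X_(ordR i)) * h
  - (1 + beta * 'X_(ordL i)) * msym (stransp i) h.

Lemma msymXk (s : 'S_n) (k : 'I_n) :
  msym s ('X_k : {mpoly Zbeta[n]}) = 'X_(s k).
Proof.
rewrite msymX; congr 'X_[_]; apply/mnmP=> j; rewrite !mnmE.
by rewrite -(inj_eq (@perm_inj _ s)) permKV.
Qed.

Lemma msym_beta (s : 'S_n) : msym s beta = beta.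
Proof. by rewrite /beta -alg_mpolyC msymZ msym1. Qed.

Lemma dvd_sub_msym i h :
  exists g : {mpoly Zbeta[n]}, ('X_(ordL i) - 'X_(ordR i)) * g = h - msym (stransp i) h.
Proof.
pose d : {mpoly Zbeta[n]} := 'X_(ordL i) - 'X_(ordR i).
pose s := stransp i.
pose P h := exists g : {mpoly Zbeta[n]}, d * g = h - msym s h.
have PD a b : P a -> P b -> P (a + b).
  move=> [u Hu] [v Hv]; exists (u + v).
  by rewrite mulrDr Hu Hv msymD opprD addrACA.
have PM a b : P a -> P b -> P (a * b).
  move=> [u Hu] [v Hv]; exists (a * v + u * msym s b).
  rewrite mulrDr mulrCA Hv mulrA Hu msymM mulrBr mulrBl.
  by rewrite addrA subrK.
have P1 : P 1 by exists 0; rewrite msym1 subrr mulr0.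
have PX k : P 'X_k.
  rewrite /P msymXk.
  rewrite /s /stransp; case: tpermP => [->|->|_ _].
  - by exists 1; rewrite mulr1.
  - by exists (-1); rewrite mulrN1 opprB.
  - by exists 0; rewrite mulr0 subrr.
suff PXm m : P 'X_[m].
  apply: (@mpolyind _ _ P) => [|c m p _ _ Pp].
    by exists 0; rewrite msym0 subrr mulr0.
  apply: (PD (c *: 'X_[m]) p _ Pp); have [g Hg] := PXm m.
  by exists (c *: g); rewrite -scalerAr Hg scalerBr msymZ.
rewrite mpolyXE_id; elim/big_ind: _ => [|a b|k _]; [exact: P1|exact: PM|].
elim: (m k) => [|e IH]; first by rewrite expr0; exact: P1.
by rewrite exprS; exact: PM (PX k) IH.
Qed.

Lemma pi_exists i h :
  exists g : {mpoly Zbeta[n]}, ('X_(ordL i) - 'X_(ordR i)) * g == pi_num i h.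
Proof.
have [g Hg] := dvd_sub_msym i ((1 + beta * 'X_(ordR i)) * h).
exists g; apply/eqP; rewrite Hg /pi_num; congr (_ - _).
by rewrite msymM msymD msym1 msymM msymXk tpermR msym_beta.
Qed.

(* The quotient of pi_num i h by x_i - x_{i+1}; it exists by pi_exists, and it
   is unique because {mpoly Zbeta[n]} is an integral domain. *)
Definition pi_op i h : {mpoly Zbeta[n]} := xchoose (pi_exists i h).

Lemma pi_opE i h : ('X_(ordL i) - 'X_(ordR i)) * pi_op i h = pi_num i h.
Proof. exact/eqP/(xchooseP (pi_exists i h)). Qed.

Definition len w : nat :=
  #|[set ab : 'I_n * 'I_n | (ab.1 < ab.2)%N && (w ab.2 < w ab.1)%N]|.

Definition w0 : 'S_n := perm (@rev_ord_inj n).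

Definition groth_top : {mpoly Zbeta[n]} :=
  \prod_(i < n.-1) 'X_(ordL i) ^+ (n - i.+1).

(* Products of permutations in MathComp are read from left to right, so the
   permutation a |-> w (s_i a), usually denoted w s_i, is (stransp i * w)%g. *)
Fixpoint groth_rec (fuel : nat) w : {mpoly Zbeta[n]} :=
  if w == w0 then groth_top else
  if fuel is fuel'.+1 then
    if [pick i | len (stransp i * w)%g == (len w).+1] is Some i
    then pi_op i (groth_rec fuel' (stransp i * w)%g)
    else 0
  else 0.

(* The recursion stops after len w0 - len w <= len w0 steps, and an index i is
   always found when w <> w0, so the default values 0 are never reached. *)
Definition groth w : {mpoly Zbeta[n]} := groth_rec (len w0) w.

Definition vexillary w : Prop :=
  ~ exists a b c d : 'I_n,
      [/\ (a < b)%N, (b < c)%N, (c < d)%N &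
          [/\ (w b < w a)%N, (w a < w d)%N & (w d < w c)%N]].

Definition rk w (p q : 'I_n) : nat :=
  #|[set i : 'I_n | (i <= p)%N && (w i <= q)%N]|.

Definition diagram w : {set 'I_n * 'I_n} :=
  [set b : 'I_n * 'I_n | (b.2 < w b.1)%N && (b.1 < (w^-1)%g b.2)%N].

Definition ess w : {set 'I_n * 'I_n} :=
  [set b in diagram w |
    [forall c in diagram w,
       ~~ ((c.1 == b.1.+1 :> nat) && (c.2 == b.2))
       && ~~ ((c.1 == b.1) && (c.2 == b.2.+1 :> nat))]].

End Grothendieck.

Definition is_partition (la : seq nat) : bool := sorted geq la && (0%N \notin la).

(* The boxes of the Young diagram of la, as pairs (row, column). *)
Definition box (la : seq nat) : finType :=
  {i : 'I_(size la) & 'I_(nth 0%N la i)}.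
Definition brow la (b : box la) : 'I_(size la) := tag b.
Definition bcol la (b : box la) : nat := tagged b.

(* la is the partition lambda(w): the two diagrams have as many boxes as each
   other on every diagonal. *)
Definition is_shape n (w : 'S_n) (la : seq nat) : Prop :=
  is_partition la /\
  forall k : int,
    #|[set b : box la | (bcol b)%:Z - (brow b)%:Z == k]| =
    #|[set b in diagram w | (b.2 : nat)%:Z - (b.1 : nat)%:Z == k]|.

(* {(p_i, q_i)} is an admissible subset for w.  The last equation is
   p_i - r_w(p_i, q_i) = i for 1-based p_i and i, without subtraction. *)
Definition flagging_set n (w : 'S_n) r (p q : 'I_r -> 'I_n) : Prop :=
  [/\ forall e, e \in ess w -> exists i, e = (p i, q i),
      forall i j : 'I_r, (i <= j)%N -> (p i <= p j)%N,
      forall i j : 'I_r, (i <= j)%N -> (q j <= q i)%N &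
      forall i : 'I_r, (p i).+1 = (rk w (p i) (q i) + i.+1)%N].

(* The value k : 'I_n of an entry stands for the 1-based entry k + 1, so
   (k < f i)%N says that this entry is in {1, ..., f_i}.  The entries of the
   tableaux are at most n, which is no restriction when all f_i <= n.  As the
   entries of T are non-empty sets, the comparisons of maxima with minima are
   comparisons of all their elements. *)
Definition FSVT n (la : seq nat) (f : 'I_(size la) -> nat) :
    {set {ffun box la -> {set 'I_n}}} :=
  [set T : {ffun box la -> {set 'I_n}} |
    [&& [forall b, T b != set0],
        [forall b, forall k in T b, (k < f (brow b))%N],
        [forall b, forall c,
           ((brow c == brow b) && (bcol c == (bcol b).+1)) ==>
           [forall k in T b, forall l in T c, (k <= l)%N]] &
        [forall b, forall c,
           ((brow c == (brow b).+1 :> nat) && (bcol c == bcol b)) ==>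
           [forall k in T b, forall l in T c, (k < l)%N]]]].

Definition flagged_groth n (la : seq nat) (f : 'I_(size la) -> nat) :
    {mpoly Zbeta[n]} :=
  \sum_(T in FSVT n f)
    beta ^+ (\sum_(b : box la) #|T b| - sumn la)
    * \prod_(b : box la) \prod_(k in T b) 'X_k.

(* Main.v *)
Require Import Defs.
From mathcomp Require Import all_boot all_order all_algebra all_fingroup.
From mathcomp Require Import mpoly.
From mathcomp Require Import ring zify.

(* For a cell (p, q) let NE be the number of dots of w in the first p rows and
   beyond column q, and SW the number of dots below row p in the first q columns.
   A cell from which no step increases NE or SW is an essential one, so the union
   of the NE x SW rectangles over all cells is a Young diagram with one corner for
   each essential cell; it is lambda(w), and the flag of a corner is the row of its
   essential cell. The other flags are irrelevant because tableaux increase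
   strictly down the columns.

   If w is vexillary and not the longest element, let i be the last ascent of its
   Lehmer code or, when the code has none, the first ascent of w. Then w s_i is
   vexillary, its shape has exactly one more box, in a row k, and k is the only row
   with flag i (all rows above have smaller flags, all rows below larger ones).
   So it suffices to know the tableau sum of the longest element, where there is one
   tableau, and that pi_i removes this box and raises the flag of row k by one.

   For the latter, a tableau is built letter by letter as a chain of shapes. With
   the shapes before letter i and after letter i+1 fixed, the sum over the shape in
   between is a product over the rows, because the length of each row varies
   independently of the others. Every factor of a row below k is symmetric in x_i and
   x_(i+1) up to powers which cancel between neighbouring rows, so everything reduces
   to the value of pi_i on the factor of row k. *)

Set Implicit Arguments.
Unset Strict Implicit.
Unset Printing Implicit Defensive.

Import GRing.Theory.

(** * Isobaric divided differences *)

(** Both sides of the identity involve choices. [groth] climbs along arbitrary ascents, so the use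
    of a particular ascent rests on the commutation and braid relations of the operators. A flagging
    set fixes the flags only at the corners of the shape, and $\lambda(w)$ is known only by the
    lengths of its diagonals. The induction on length therefore runs over all flags with the
    properties in [flag_data] and carries the diagonal counts along; the partition is recovered from
    them at the end. The choice of the ascent serves to locate the new box. Let $x$ be the largest
    value below $w(i+1)$ that occurs from position $i$ on. The cell of row $i$ and column $x$
    becomes essential after the swap. An essential cell whose rectangle contained the new box would
    have to lie above row $i$, because the code is bounded after position $i+1$, and below it,
    because the patterns excluded by vexillarity push the columns of the higher essential cells
    beyond $x$. *)

Section DividedDifferenceIdentities.
Local Open Scope ring_scope.

(** [h], [hi], [hj], [hij] stand for the images of one element under two commuting transpositions;
    treated as independent, they turn the relation into a rational identity. *)
Lemma commuting_ddiff (K : fieldType) (c x y z t h hi hj hij : K) :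
  x - y != 0 -> z - t != 0 ->
  ((1 + c * y) * (((1 + c * t) * h - (1 + c * z) * hj) / (z - t))
   - (1 + c * x) * (((1 + c * t) * hi - (1 + c * z) * hij) / (z - t))) / (x - y)
  = ((1 + c * t) * (((1 + c * y) * h - (1 + c * x) * hi) / (x - y))
   - (1 + c * z) * (((1 + c * y) * hj - (1 + c * x) * hij) / (x - y))) / (z - t)
  :> K.
Proof. by move=> m1 m2; field; rewrite m1 m2. Qed.

(** The letters from [h] to [hw] are the six images of one element under the group generated by two
    neighbouring adjacent transpositions. *)
Lemma braided_ddiff (K : fieldType) (c x y z h hs ht hst hts hw : K) :
  x - y != 0 -> y - z != 0 -> x - z != 0 ->
  ((1 + c * y) *
   (((1 + c * z) * (((1 + c * y) * h - (1 + c * x) * hs) / (x - y))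
     - (1 + c * y) * (((1 + c * z) * ht - (1 + c * x) * hst) / (x - z)))
    / (y - z))
   - (1 + c * x) *
   (((1 + c * z) * (((1 + c * x) * hs - (1 + c * y) * h) / (y - x))
     - (1 + c * x) * (((1 + c * z) * hts - (1 + c * y) * hw) / (y - z)))
    / (x - z))) / (x - y)
  = ((1 + c * z) *
   (((1 + c * y) * (((1 + c * z) * h - (1 + c * y) * ht) / (y - z))
     - (1 + c * x) * (((1 + c * z) * hs - (1 + c * x) * hts) / (x - z)))
    / (x - y))
   - (1 + c * y) *
   (((1 + c * z) * (((1 + c * y) * ht - (1 + c * z) * h) / (z - y))
     - (1 + c * x) * (((1 + c * y) * hst - (1 + c * x) * hw) / (x - y)))
    / (x - z))) / (y - z).
Proof.
move=> m1 m2 m3; have m4 : y - x != 0 by rewrite -opprB oppr_eq0.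
have m5 : z - y != 0 by rewrite -opprB oppr_eq0.
by field; rewrite m1 m2 m3 m4 m5.
Qed.

End DividedDifferenceIdentities.

Section PiOp.
Local Open Scope ring_scope.
Local Open Scope ring_scope.
Variables (n : nat) (R : idomainType) (X : 'I_n -> R) (b : R).
Variables (act : 'S_n -> {rmorphism R -> R}) (pi : 'I_n.-1 -> R -> R).
Hypothesis Xneq : forall a c : 'I_n, a != c -> X a - X c != 0.
Hypothesis actX : forall s k, act s (X k) = X (s k).
Hypothesis actb : forall s, act s b = b.
Hypothesis act1 : forall h, act 1%g h = h.
Hypothesis actM : forall s t h, act (s * t)%g h = act t (act s h).
Hypothesis piE : forall i h, (X (ordL i) - X (ordR i)) * pi i h =
  (1 + b * X (ordR i)) * h - (1 + b * X (ordL i)) * act (stransp i) h.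
Implicit Types (i j : 'I_n.-1) (h g : R).

Lemma ordLR_neq i : ordL i != ordR i.
Proof. by rewrite -val_eqE /= neq_ltn ltnSn. Qed.

Lemma pi_unique i h g :
  (X (ordL i) - X (ordR i)) * g =
    (1 + b * X (ordR i)) * h - (1 + b * X (ordL i)) * act (stransp i) h ->
  pi i h = g.
Proof.
move=> E; apply: (mulfI (Xneq (ordLR_neq i))).
by rewrite piE E.
Qed.

Lemma piD i h g : pi i (h + g) = pi i h + pi i g.
Proof. by apply: pi_unique; rewrite mulrDr !piE rmorphD; ring. Qed.

Lemma pi0 i : pi i 0 = 0.
Proof. by apply: pi_unique; rewrite rmorph0 !mulr0 subr0. Qed.

Lemma pi_sum i (I : Type) (r : seq I) (P : pred I) (F : I -> R) :
  pi i (\sum_(k <- r | P k) F k) = \sum_(k <- r | P k) pi i (F k).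
Proof. exact: (big_morph _ (piD i) (pi0 i)). Qed.

Lemma piMr i h g : act (stransp i) g = g -> pi i (h * g) = pi i h * g.
Proof.
move=> sg; apply: pi_unique.
by rewrite mulrA piE rmorphM /= sg; ring.
Qed.

Local Notation F := {fraction R}.
Let phi (s : 'S_n) h : F := tofrac (act s h).
Let Y (a : 'I_n) : F := tofrac (X a).
Let c : F := tofrac b.

Lemma Y_neq (a e : 'I_n) : a != e -> Y a - Y e != 0.
Proof. by move=> /Xneq ae; rewrite subr_eq0 tofrac_eq -subr_eq0. Qed.

(** Iterating the operators requires the images of $\pi_i h$ under permutations; in the fraction
    field these are divided differences in the permuted variables. *)
Lemma phi_pi (s : 'S_n) i h :
  phi s (pi i h) =
    ((1 + c * Y (s (ordR i))) * phi s h
     - (1 + c * Y (s (ordL i))) * phi (stransp i * s)%g h)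
    / (Y (s (ordL i)) - Y (s (ordR i))).
Proof.
have nz : Y (s (ordL i)) - Y (s (ordR i)) != 0.
  by apply: Y_neq; rewrite (inj_eq perm_inj) ordLR_neq.
apply: (mulIf nz); rewrite divfK // mulrC /phi /Y /c.
have /(congr1 (act s)) := piE i h.
rewrite rmorphM rmorphB /= !actX => /(congr1 (@tofrac _)).
rewrite tofracM tofracB => ->.
rewrite rmorphB !rmorphM !rmorphD !rmorphM rmorph1 /= !actX !actb actM.
by rewrite !(tofracB, tofracN, tofracM, tofracD, tofrac1).
Qed.

Lemma phi1_inj : injective (phi 1%g).
Proof. by move=> x y; rewrite /phi !act1 => /eqP; rewrite tofrac_eq => /eqP. Qed.

Lemma pi_comm i j h : (i.+1 < j)%N -> pi i (pi j h) = pi j (pi i h).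
Proof.
move=> ij; apply: phi1_inj; rewrite !phi_pi !mulg1 !perm1.
have [n1 n2] : ordL i != ordL j /\ ordL i != ordR j by rewrite -!val_eqE /=; lia.
have [n3 n4] : ordR i != ordL j /\ ordR i != ordR j by rewrite -!val_eqE /=; lia.
have [n5 n6] : ordL j != ordL i /\ ordR j != ordL i by rewrite -!val_eqE /=; lia.
have [n7 n8] : ordL j != ordR i /\ ordR j != ordR i by rewrite -!val_eqE /=; lia.
have -> : (stransp j * stransp i = stransp i * stransp j)%g.
  by rewrite [RHS]conjgC {2}/stransp tpermJ /stransp !tpermD.
rewrite /stransp !tpermD //.
have := Y_neq (ordLR_neq i); have := Y_neq (ordLR_neq j) => m1 m2.
exact: commuting_ddiff.
Qed.

Lemma pi_braid i j h : i.+1 = j :> nat ->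
  pi i (pi j (pi i h)) = pi j (pi i (pi j h)).
Proof.
move=> ij; apply: phi1_inj; rewrite !phi_pi !mulg1 !perm1.
set s := stransp i; set t := stransp j.
have e1 : ordL j = ordR i by apply: val_inj; rewrite /= -ij.
have n1 : ordL i != ordR i by exact: ordLR_neq.
have n2 : ordR i != ordR j by rewrite -val_eqE /= -ij; lia.
have n3 : ordL i != ordR j by rewrite -val_eqE /= -ij; lia.
have n1' := n1; have n2' := n2; have n3' := n3.
rewrite eq_sym in n1'; rewrite eq_sym in n2'; rewrite eq_sym in n3'.
have sE : s = tperm (ordL i) (ordR i) by [].
have tE : t = tperm (ordR i) (ordR j) by rewrite /t /stransp e1.
have sL : s (ordL i) = ordR i by rewrite sE tpermL.
have sM : s (ordR i) = ordL i by rewrite sE tpermR.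
have sR : s (ordR j) = ordR j by rewrite sE tpermD.
have tL : t (ordL i) = ordL i by rewrite tE tpermD.
have tM : t (ordR i) = ordR j by rewrite tE tpermL.
have tR : t (ordR j) = ordR i by rewrite tE tpermR.
have ss : (s * s = 1)%g by rewrite sE tperm2.
have tt : (t * t = 1)%g by rewrite tE tperm2.
have sts : (s * (t * s) = t * (s * t))%g.
  have <- : (t ^ s = s * (t * s))%g by rewrite conjgE {1}sE tpermV.
  have <- : (s ^ t = t * (s * t))%g by rewrite conjgE {1}tE tpermV -tE.
  by rewrite {1}tE {2}sE !tpermJ sM sR tL tM.
rewrite e1 ?permM ?sL ?sM ?sR ?tL ?tM ?tR ?sL ?sM ?sR ?tL ?tM ?tR.
rewrite ?sts ?mulgA ?ss ?tt ?mul1g.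
have := Y_neq n1; have := Y_neq n2; have := Y_neq n3 => m1 m2 m3.
exact: braided_ddiff.
Qed.
End PiOp.

(** * Set-valued tableaux, letter by letter *)

Section Counting.
Variable n : nat.

Lemma card_ord_lt k : k <= n -> #|[set c : 'I_n | c < k]| = k.
Proof.
move=> kn; rewrite -sum1_card (eq_bigl (fun c : 'I_n => c < k)); last first.
  by move=> c; rewrite inE.
by rewrite -(big_ord_widen _ (fun=> 1)) // sum_nat_const card_ord muln1.
Qed.

(** Turns a set of columns closed to the left into a row length. *)
Lemma card_initial_segment (P : pred 'I_n) :
  (forall c d : 'I_n, d = c.+1 :> nat -> P d -> P c) ->
  forall c, P c = (c < #|[set d | P d]|).
Proof.
move=> Pdown; have down k (c d : 'I_n) : (d = c + k :> nat) -> P d -> P c.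
  elim: k c d => [|k IH] c d E Pd; first by rewrite (_ : c = d) //; apply: val_inj; rewrite /= E addn0.
  have ck : c + k < n by rewrite -addnS -E ltnW // ltnS -E.
  by apply: (IH c (Ordinal ck)) => //; apply: (Pdown _ d) => //; rewrite E addnS.
move=> c; apply/idP/idP => [Pc|].
  apply: leq_trans (_ : #|[set d : 'I_n | d < c.+1]| <= _).
    by rewrite card_ord_lt.
  apply/subset_leq_card/subsetP=> d; rewrite !inE ltnS => dc.
  by apply: (down (c - d) d c) => //; rewrite subnKC.
apply: contraLR => nPc; rewrite -leqNgt -[X in _ <= X]card_ord_lt ?(ltnW (ltn_ord c)) //.
apply/subset_leq_card/subsetP=> d; rewrite !inE => Pd.
rewrite ltnNge; apply: contra nPc => cd.
by apply: (down (d - c) c d) => //; rewrite subnKC.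
Qed.
End Counting.

Section Tableaux.
Local Open Scope ring_scope.
Variables (n : nat) (R : comNzRingType) (X : 'I_n -> R) (b : R).
Local Notation cell := ('I_n * 'I_n)%type.
Local Notation filling := {ffun cell -> {set 'I_n}}.
Implicit Types (T : filling) (nu f : nat -> nat) (mu : {ffun 'I_n -> 'I_n.+1}).

(** The truncated predecessor gives the empty set weight 1, so products may run over the whole
    grid. *)
Definition entry_weight (S : {set 'I_n}) : R := b ^+ #|S|.-1 * \prod_(k in S) X k.

Definition tableau m nu f T : bool :=
  [&& [forall c : cell, (T c != set0) == (c.2 < nu c.1)%N],
      [forall c : cell, forall k in T c, (k < m)%N && (k < f c.1)%N],
      [forall c : cell, forall d : cell, ((d.1 == c.1) && (d.2 == c.2.+1 :> nat)) ==>
        [forall k in T c, forall l in T d, (k <= l)%N]] &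
      [forall c : cell, forall d : cell, ((d.1 == c.1.+1 :> nat) && (d.2 == c.2)) ==>
        [forall k in T c, forall l in T d, (k < l)%N]]].

Lemma tableauP m nu f T :
  reflect [/\ forall c : cell, (T c != set0) = (c.2 < nu c.1)%N,
              forall (c : cell) (k : 'I_n), k \in T c -> (k < m)%N /\ (k < f c.1)%N,
              forall (c d : cell) (k l : 'I_n), d.1 = c.1 -> d.2 = c.2.+1 :> nat ->
                k \in T c -> l \in T d -> (k <= l)%N &
              forall (c d : cell) (k l : 'I_n), d.1 = c.1.+1 :> nat -> d.2 = c.2 ->
                k \in T c -> l \in T d -> (k < l)%N]
          (tableau m nu f T).
Proof.
apply: (iffP and4P) => -[h1 h2 h3 h4]; split.
- by move=> c; have /forallP/(_ c)/eqP := h1.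
- move=> c k kc; apply/andP.
  by have /forallP/(_ c)/forall_inP := h2; apply.
- move=> c d k l e1 e2 kc ld; have /forallP/(_ c)/forallP/(_ d) := h3.
  by rewrite e1 e2 !eqxx /= => /forall_inP /(_ _ kc) /forall_inP; apply.
- move=> c d k l e1 e2 kc ld; have /forallP/(_ c)/forallP/(_ d) := h4.
  by rewrite e1 e2 !eqxx /= => /forall_inP /(_ _ kc) /forall_inP; apply.
- by apply/forallP => c; rewrite h1.
- by apply/forallP => c; apply/forall_inP=> k kc; apply/andP/h2.
- apply/forallP => c; apply/forallP => d; apply/implyP => /andP[/eqP e1 /eqP e2].
  by apply/forall_inP => k kc; apply/forall_inP => l ld; apply: (h3 c d).
- apply/forallP => c; apply/forallP => d; apply/implyP => /andP[/eqP e1 /eqP e2].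
  by apply/forall_inP => k kc; apply/forall_inP => l ld; apply: (h4 c d).
Qed.

(* The shape, with row lengths [nu], lies in the [n] x [n] grid; boxes outside it are
   filled with the empty set, and the letters are below [m]. *)
Definition tab_sum m nu f : R :=
  \sum_(T | tableau m nu f T) \prod_c entry_weight (T c).

Definition row_len mu : nat -> nat :=
  fun j => if insub j is Some o then mu o : nat else 0%N.

Lemma row_lenE mu (j : 'I_n) : row_len mu j = mu j.
Proof. by rewrite /row_len valK. Qed.

(* [g] tells whether the letter [x] is allowed in the row. *)
Definition row_weight (g : bool) (x : R) (a v v' : nat) : R :=
  if g then if (v' <= a <= v)%N then x ^+ (v - a) * (1 + b * x) ^+ (v' < a)%N else 0
  else (a == v)%:R.

(** The share of column [q] in a row of length [a] before the letter and [v] after it, above a row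
    of length [v']. The letter may enter only a box with no older box to its right and nothing
    below; it costs a factor [b] if the box was already occupied. *)
Definition box_factor (g : bool) (x : R) (a v v' q : nat) : R :=
  if (q < v)%N then (q < a)%:R + [&& g, (a <= q.+1)%N & (v' <= q)%N]%:R * (x * b ^+ (q < a)%N)
  else (~~ (q < a)%N)%:R.

(** If the letter is allowed, each new box gives [x], the last old box gives 1 + [b] [x] when
    nothing lies below it, and every other column gives 1. *)
Lemma prod_box_factor g x a v v' :
  (a <= n)%N -> (v <= n)%N -> (v' <= v)%N ->
  \prod_(q < n) box_factor g x a v v' q = row_weight g x a v v'.
Proof.
move=> an vn v'v; have [va|av] := ltnP v a.
  have vn' : (v < n)%N by apply: leq_trans va an.
  rewrite (bigD1 (Ordinal vn')) //= /box_factor ltnn va /= mul0r /row_weight.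
  by rewrite (leqNgt a v) va andbF gtn_eqF //; case: g.
rewrite -(big_mkord xpredT (box_factor g x a v v')).
rewrite (big_cat_nat (leq0n v) vn) /= (big_cat_nat (leq0n a) av) /=.
rewrite [X in _ * X]big_nat_cond [X in _ * X]big1 ?mulr1; last first.
  move=> q /andP[/andP[q1 q2] _]; rewrite /box_factor ltnNge q1 /= ltnNge.
  by rewrite (leq_trans av q1).
have -> : \prod_(a <= q < v) box_factor g x a v v' q =
          if g && (v' <= a)%N || (a == v) then x ^+ (v - a) else 0.
  have [<-|avn] := eqVneq a v; first by rewrite big_geq // orbT subnn.
  have avl : (a < v)%N by rewrite ltn_neqAle avn.
  have [/andP[gt v'a]|ng] := boolP (g && (v' <= a)%N).
    rewrite /= -prodr_const_nat big_nat_cond [RHS]big_nat_cond.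
    apply: eq_bigr => q /andP[/andP[q1 q2] _]; rewrite /box_factor q2 gt /=.
    rewrite (leq_trans q1) // (leq_trans v'a q1) ltnNge q1 /= expr0 mulr1.
    by rewrite add0r mul1r.
  rewrite /= big_ltn // /box_factor avl ltnn leqnSn /= (negbTE ng).
  by rewrite add0r mul0r mul0r.
have -> : \prod_(0 <= q < a) box_factor g x a v v' q =
          (1 + b * x) ^+ (g && (v' < a)%N).
  case: a {an} av => [|a] av; first by rewrite big_geq // andbF.
  rewrite big_nat_recr //= big_nat_cond big1 ?mul1r; last first.
    move=> q /andP[/andP[_ qa] _]; rewrite /box_factor.
    by rewrite (ltn_trans qa av) !ltnS [(a <= q)%N]leqNgt qa (ltnW qa) /= andbF mul0r addr0.
  rewrite /box_factor av ltnS leqnn ltnS /=.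
  by case: (g && _) => /=; rewrite ?expr1 ?expr0 ?mul1r ?mul0r ?addr0 // mulrC.
rewrite /row_weight av andbT; case: g => /=; last first.
  by rewrite mul1r; case: eqP => // ->; rewrite subnn.
have [v'a|av'] := leqP v' a; rewrite /= 1?mulrC //.
have -> : (a == v) = false by apply/negbTE; rewrite neq_ltn (leq_trans av' v'v).
by rewrite mul0r.
Qed.

Lemma entry_weightU1 (m : 'I_n) (S : {set 'I_n}) : m \notin S ->
  entry_weight (m |: S) = entry_weight S * (X m * b ^+ (S != set0)).
Proof.
move=> mS; rewrite /entry_weight cardsU1 mS add1n /= big_setU1 //=.
have -> : b ^+ #|S| = b ^+ #|S|.-1 * b ^+ (S != set0).
  rewrite -exprD -card_gt0; congr (_ ^+ _).
  by case: #|S| => //= k; rewrite addn1.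
by move: (b ^+ #|S|.-1) (b ^+ _) (\prod_(k in S) _) => u v w; ring.
Qed.

(** Only [S0] and [m |: S0] can occur in the sum. *)
Lemma sum_entry_weight (m : 'I_n) (S0 : {set 'I_n}) (inv C : bool) : m \notin S0 ->
  \sum_(S : {set 'I_n} | [&& S :\ m == S0, (S != set0) == inv & (m \in S) ==> C])
     entry_weight S =
  entry_weight S0 *
   (if inv then (S0 != set0)%:R + C%:R * (X m * b ^+ (S0 != set0))
    else (~~ (S0 != set0))%:R).
Proof.
move=> mS; rewrite (bigID (fun S : {set 'I_n} => m \in S)) /= addrC.
have -> : \sum_(S : {set 'I_n} | [&& S :\ m == S0, (S != set0) == inv & (m \in S) ==> C]
             && (m \notin S)) entry_weight S = ((S0 != set0) == inv)%:R * entry_weight S0.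
  case: (boolP ((S0 != set0) == inv)) => e; last first.
    rewrite mul0r big_pred0 // => S; apply/negP => /andP[/and3P[/eqP e0 ein _] mnS].
    move: e; rewrite -e0 (_ : S :\ m = S) ?ein //.
    by apply/setDidPl; rewrite disjoint_sym disjoints1.
  rewrite mul1r (big_pred1 S0) // => S; apply/idP/eqP => [|->].
    case/andP => /and3P[/eqP <- _ _] mnS.
    by apply/esym/setDidPl; rewrite disjoint_sym disjoints1.
  rewrite (negbTE mS) e /= !andbT; apply/eqP.
  by apply/setDidPl; rewrite disjoint_sym disjoints1.
have -> : \sum_(S : {set 'I_n} | [&& S :\ m == S0, (S != set0) == inv & (m \in S) ==> C]
             && (m \in S)) entry_weight S = (inv && C)%:R * entry_weight (m |: S0).
  case: (boolP (inv && C)) => e; last first.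
    rewrite mul0r big_pred0 // => S; apply/negP => /andP[/and3P[_ ein]] /[swap] mS' .
    rewrite mS' /= => Ct; move: e; rewrite Ct andbT -(eqP ein) negbK => /eqP S00.
    by rewrite S00 inE in mS'.
  case/andP: e => -> ->; rewrite mul1r (big_pred1 (m |: S0)) // => S.
  apply/idP/eqP => [/andP[/and3P[/eqP <- _ _] mS']|->]; first by rewrite setD1K.
  rewrite setU1K // eqxx setU11 /= !andbT eqb_id.
  by apply/set0Pn; exists m; rewrite setU11.
rewrite entry_weightU1 //; case: inv; case: (S0 != set0); case: C => /=; ring.
Qed.

Definition strip (m : 'I_n) T : filling := [ffun c => T c :\ m].

Definition shape_of T : {ffun 'I_n -> 'I_n.+1} :=
  [ffun j => inord #|[set q : 'I_n | T (j, q) != set0]|].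

Lemma shape_ofE T (j : 'I_n) :
  shape_of T j = #|[set q : 'I_n | T (j, q) != set0]| :> nat.
Proof.
rewrite ffunE inordK // ltnS -[X in (_ <= X)%N]card_ord.
exact: max_card.
Qed.

Lemma tableau_shape m mu f T : tableau m (row_len mu) f T -> shape_of T = mu.
Proof.
case/tableauP => h _ _ _; apply/ffunP => j; apply: val_inj; rewrite /= shape_ofE.
have mun : (mu j <= n)%N by rewrite -ltnS.
rewrite -(card_ord_lt mun).
by apply: eq_card => q; rewrite !inE h /= row_lenE.
Qed.

(** Rows increase weakly, so a box to the left of one with a letter below [m] has such a letter too:
    the surviving boxes are left-justified. *)
Lemma tableau_strip (m : 'I_n) nu f T : tableau m.+1 nu f T ->
  tableau m (row_len (shape_of (strip m T))) f (strip m T).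
Proof.
case/tableauP => h1 h2 h3 h4; apply/tableauP; split.
- move=> [j q]; rewrite row_lenE shape_ofE.
  pose P (q' : 'I_n) := strip m T (j, q') != set0.
  apply: (@card_initial_segment n P) => c d dc /set0Pn[k].
  rewrite ffunE in_setD1 => /andP[km kT]; apply/set0Pn.
  have kltm : (k < m)%N.
    by have [+ _] := h2 _ _ kT; rewrite ltnS leq_eqVlt (inj_eq val_inj) (negbTE km).
  have : T (j, d) != set0 by apply/set0Pn; exists k.
  rewrite h1 /= dc => /ltnW; rewrite -(h1 (j, c)) => /set0Pn[l lT].
  exists l; rewrite ffunE in_setD1 lT andbT -val_eqE neq_ltn.
  by rewrite (leq_ltn_trans (h3 (j, c) (j, d) l k _ _ lT kT) kltm).
- move=> c k; rewrite ffunE in_setD1 => /andP[km kT].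
  have [+ ->] := h2 _ _ kT; split => //.
  by rewrite ltn_neqAle km.
- by move=> c d k l e1 e2; rewrite !ffunE !in_setD1 => /andP[_ kT] /andP[_ lT]; exact: h3 e1 e2 kT lT.
- by move=> c d k l e1 e2; rewrite !ffunE !in_setD1 => /andP[_ kT] /andP[_ lT]; exact: h4 e1 e2 kT lT.
Qed.

(* Given the shape [mu] of the letters below [m], whether [m] may be added to the
   box [c] depends on that box only. *)
Lemma tableau_add_letter (m : 'I_n) nu f mu T' T :
  nu n = 0%N -> tableau m (row_len mu) f T' ->
  (tableau m.+1 nu f T && (strip m T == T')) =
  [forall c : cell, [&& T c :\ m == T' c, (T c != set0) == (c.2 < nu c.1)%N &
    (m \in T c) ==> [&& (m < f c.1)%N, (mu c.1 <= c.2.+1)%N & (nu c.1.+1 <= c.2)%N]]].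
Proof.
move=> nun /tableauP[t1 t2 t3 t4]; apply/idP/forallP.
  case/andP=> /tableauP[h1 h2 h3 h4] /eqP sT c.
  have -> : T c :\ m = T' c by rewrite -sT ffunE.
  rewrite h1 !eqxx /=; apply/implyP => mT; case: c mT => j q /= mT.
  have [_ /= -> /=] := h2 _ _ mT; apply/andP; split; rewrite leqNgt; apply/negP => lt.
    have q1 : (q.+1 < n)%N by apply: leq_trans lt _; rewrite -ltnS.
    have := t1 (j, Ordinal q1); rewrite /= row_lenE lt => /set0Pn[l lT'].
    have [lm _] := t2 _ _ lT'.
    have lT : l \in T (j, Ordinal q1).
      by move: lT'; rewrite -sT ffunE in_setD1 => /andP[].
    by have := h3 (j, q) (j, Ordinal q1) m l erefl erefl mT lT; rewrite leqNgt lm.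
  have j1 : (j.+1 < n)%N.
    rewrite ltn_neqAle ltn_ord andbT; apply/eqP => e.
    by rewrite e nun in lt.
  have := h1 (Ordinal j1, q); rewrite /= lt => /set0Pn[l lT].
  have := h4 (j, q) (Ordinal j1, q) m l erefl erefl mT lT.
  by have [+ _] := h2 _ _ lT; rewrite ltnS leqNgt => /negbTE ->.
move=> H; have h0 c : T c :\ m = T' c by have /and3P[/eqP] := H c.
have h1 c : (T c != set0) = (c.2 < nu c.1)%N by have /and3P[_ /eqP] := H c.
have hm c : m \in T c ->
    [&& (m < f c.1)%N, (mu c.1 <= c.2.+1)%N & (nu c.1.+1 <= c.2)%N].
  by move=> mT; have /and3P[_ _] := H c; rewrite mT.
have T'E c k : k \in T c -> k = m \/ k \in T' c.
  move=> kT; have [->|km] := eqVneq k m; [by left|right].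
  by rewrite -h0 in_setD1 km.
apply/andP; split; last by apply/eqP/ffunP => c; rewrite ffunE h0.
apply/tableauP; split => //.
- move=> c k /[dup] kT /T'E[km|]; last by case/t2 => /ltnW.
  by subst k; have /and3P[-> _ _] := hm _ kT.
- move=> c d k l e1 e2 /[dup] kT /T'E[km|kT'] /[dup] lT /T'E[lm|lT'].
  + by rewrite km lm.
  + subst k; have /and3P[_ muc _] := hm _ kT.
    have : T' d != set0 by apply/set0Pn; exists l.
    by rewrite t1 e1 e2 row_lenE ltnNge muc.
  + by subst l; have [/ltnW] := t2 _ _ kT'.
  + exact: (t3 c d).
- move=> c d k l e1 e2 /[dup] kT /T'E[km|kT'] /[dup] lT /T'E[lm|lT'].
  + subst k; have /and3P[_ _ nuc] := hm _ kT.
    have : T d != set0 by apply/set0Pn; exists l.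
    by rewrite h1 e1 e2 ltnNge nuc.
  + subst k; have /and3P[_ _ nuc] := hm _ kT.
    have : T d != set0 by apply/set0Pn; exists l.
    by rewrite h1 e1 e2 ltnNge nuc.
  + by subst l; have [] := t2 _ _ kT'.
  + exact: (t4 c d).
Qed.

(** For a fixed tableau without the letter [m], the letter enters each box independently by
    [tableau_add_letter]; distributivity then gives a product over the boxes, grouped by rows. *)
Lemma tab_sum_rec (m : 'I_n) nu f :
  (forall j, nu j.+1 <= nu j)%N -> (nu 0 <= n)%N -> nu n = 0%N ->
  tab_sum m.+1 nu f =
  \sum_mu tab_sum m (row_len mu) f *
     \prod_(j < n) row_weight (m < f j)%N (X m) (mu j) (nu j) (nu j.+1).
Proof.
move=> nuS nu0 nun; have nule j : (nu j <= n)%N.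
  by elim: j => // j; apply: leq_trans.
rewrite /tab_sum (partition_big (fun T => shape_of (strip m T)) xpredT) //.
apply: eq_bigr => mu _.
rewrite (partition_big (strip m) (tableau m (row_len mu) f)); last first.
  by move=> T /andP[/tableau_strip + /eqP <-].
rewrite mulr_suml; apply: eq_bigr => T' T'tab.
pose Q (c : cell) (S : {set 'I_n}) := [&& S :\ m == T' c, (S != set0) == (c.2 < nu c.1)%N &
    (m \in S) ==> [&& (m < f c.1)%N, (mu c.1 <= c.2.+1)%N & (nu c.1.+1 <= c.2)%N]].
rewrite (eq_bigl (fun T => T \in family Q)); last first.
  move=> T; have -> : (T \in family Q) = tableau m.+1 nu f T && (strip m T == T').
    by rewrite (tableau_add_letter T nun T'tab); apply/familyP/forallP.
  rewrite -andbA.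
  by case: (strip m T =P T') => [->|_]; rewrite ?andbF // (tableau_shape T'tab) eqxx.
transitivity (\prod_(c : cell) \sum_(S | Q c S) entry_weight S).
  by rewrite bigA_distr_big_dep.
rewrite (eq_bigr (fun j : 'I_n => \prod_(q < n)
    box_factor (m < f j)%N (X m) (mu j) (nu j) (nu j.+1) q)); last first.
  by move=> j _; rewrite prod_box_factor // -ltnS.
rewrite pair_bigA -big_split /=; apply: eq_bigr => -[j q] _.
have mT' : m \notin T' (j, q).
  by apply/negP => mT; case/tableauP: T'tab => _ /(_ _ _ mT) []; rewrite ltnn.
rewrite sum_entry_weight //=; congr (_ * _); rewrite /box_factor.
have [-> _ _ _] := tableauP _ _ _ _ T'tab; rewrite /= row_lenE.
by case: ifP.
Qed.
End Tableaux.

(** * Two consecutive letters *)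

Section TwoLetters.
Local Open Scope ring_scope.
Variables (R : idomainType) (b x y : R) (s : {rmorphism R -> R}).
Hypothesis xy : x - y != 0.
Hypothesis (sx : s x = y) (sy : s y = x) (sb : s b = b).

(** The complete homogeneous polynomial of degree [m] - 1 in [x] and [y], and 0 for [m] = 0, so that
    [hsumE] holds for all [m]. *)
Definition hsum m : R := \sum_(t < m) x ^+ t * y ^+ (m.-1 - t).

Lemma hsumE m : (x - y) * hsum m = x ^+ m - y ^+ m.
Proof.
rewrite -[LHS]opprK -mulNr opprB -[RHS]opprB subrXX; congr (- (_ * _)).
by apply: eq_bigr => t _; rewrite mulrC.
Qed.

Lemma hsum_sym m : s (hsum m) = hsum m.
Proof.
apply: (mulfI xy); have H := congr1 s (hsumE m).
rewrite rmorphM !rmorphB !rmorphXn /= sx sy in H; rewrite hsumE.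
by rewrite -[LHS]opprK -mulNr opprB H opprB.
Qed.

Lemma hsumSl m : hsum m.+1 = y ^+ m + x * hsum m.
Proof.
rewrite /hsum big_ord_recl /= subn0 mul1r; congr (_ + _).
rewrite mulr_sumr; apply: eq_bigr => t _.
by rewrite exprS mulrA -subn1 -subnDA add1n subnS -subSS; congr (_ * y ^+ _); lia.
Qed.

Lemma hsumSr m : hsum m.+1 = x ^+ m + y * hsum m.
Proof.
rewrite /hsum big_ord_recr /= subnn mulr1 addrC; congr (_ + _).
rewrite mulr_sumr; apply: eq_bigr => t _.
by rewrite mulrCA -exprS; congr (_ * y ^+ _); have := ltn_ord t; lia.
Qed.

Lemma hsum_weight_r m :
  \sum_(t < m.+1) x ^+ t * y ^+ (m - t) * (1 + b * y) ^+ (0 < t)%N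
  = hsum m.+1 + b * (x * y) * hsum m.
Proof.
rewrite big_ord_recl /= subn0 mul1r expr0 mulr1 hsumSl -addrA; congr (_ + _).
rewrite [X in X = _](eq_bigr (fun t : 'I_m => x * (1 + b * y) * (x ^+ t * y ^+ (m.-1 - t)))); last first.
  move=> t _; rewrite /= /bump /= add1n exprS expr1.
  have -> : (m - t.+1 = m.-1 - t)%N by lia.
  ring.
by rewrite -mulr_sumr -/(hsum m); ring.
Qed.

Lemma hsum_weight_l m :
  \sum_(t < m.+1) x ^+ t * y ^+ (m - t) * (1 + b * x) ^+ (t < m)%N
  = hsum m.+1 + b * (x * y) * hsum m.
Proof.
rewrite big_ord_recr /= subnn ltnn mulr1 expr0 mulr1 addrC hsumSr -addrA; congr (_ + _).
rewrite [X in X = _](eq_bigr (fun t : 'I_m => y * (1 + b * x) * (x ^+ t * y ^+ (m.-1 - t)))); last first.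
  move=> t _; rewrite ltn_ord expr1.
  have -> : (m - t = (m.-1 - t).+1)%N by have := ltn_ord t; lia.
  by rewrite exprS; ring.
by rewrite -mulr_sumr -/(hsum m); ring.
Qed.

(** If [e1] fails, the factor 1 + [b] [x] is missing at the right end of the interval; if [e2]
    fails, 1 + [b] [y] is missing at the left end. A missing end factor restores the symmetry, and a
    factor present everywhere comes out of the sum. *)
Lemma sum_strip_sym (e1 e2 : bool) m : exists2 g, s g = g &
  \sum_(t < m.+1) x ^+ t * y ^+ (m - t) * (1 + b * x) ^+ (e1 || (t < m))%N
                  * (1 + b * y) ^+ (e2 || (0 < t))%N
  = g * (1 + b * x) ^+ e1 * (1 + b * y) ^+ e2.
Proof.
have sK : s (hsum m.+1 + b * (x * y) * hsum m) = hsum m.+1 + b * (x * y) * hsum m.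
  by rewrite rmorphD !rmorphM /= !hsum_sym sx sy sb [y * x]mulrC.
case: e1; case: e2 => /=.
- exists (hsum m.+1); first exact: hsum_sym.
  by rewrite /hsum !mulr_suml; apply: eq_bigr => t _.
- exists (hsum m.+1 + b * (x * y) * hsum m) => //.
  rewrite expr0 mulr1 -hsum_weight_r !mulr_suml; apply: eq_bigr => t _.
  by rewrite mulrAC.
- exists (hsum m.+1 + b * (x * y) * hsum m) => //.
  by rewrite expr0 mulr1 -hsum_weight_l !mulr_suml; apply: eq_bigr => t _.
- case: m {sK} => [|m].
    by exists 1; rewrite ?rmorph1 // big_ord1 !expr0 !mulr1.
  (* The two end terms are exchanged by [s]; the inner terms carry both factors. *)
  exists (y ^+ m.+1 * (1 + b * x) + x ^+ m.+1 * (1 + b * y)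
          + (1 + b * x) * (1 + b * y) * (x * y) * hsum m).
    rewrite !rmorphD !rmorphM !rmorphD !rmorphM !rmorphXn rmorph1 /= hsum_sym sx sy sb.
    ring.
  rewrite big_ord_recl big_ord_recr /=.
  rewrite [X in _ + (X + _)](eq_bigr (fun t : 'I_m =>
      (1 + b * x) * (1 + b * y) * (x * y) * (x ^+ t * y ^+ (m.-1 - t)))); last first.
    move=> t _; rewrite /bump /= add1n ltnS ltn_ord subSS.
    have -> : (m - t = (m.-1 - t).+1)%N by have := ltn_ord t; lia.
    by rewrite !exprS; ring.
  rewrite -mulr_sumr -/(hsum m) /bump add1n ltnn subnn subn0 /=.
  by rewrite !expr0 !expr1; ring.
Qed.

(** [row_weight] is split into a factor for the length of the row and one for the length of the next
    row. In a sum over shapes each row length then occurs in factors of its own. *)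
Definition own_weight (z : R) (a v : nat) : R := if (a <= v)%N then z ^+ (v - a) else 0.
Definition next_weight (z : R) (a v' : nat) : R :=
  if (v' <= a)%N then (1 + b * z) ^+ (v' < a)%N else 0.

Lemma row_weightE g z a v v' :
  row_weight b g z a v v' =
  (if g then own_weight z a v else (a == v)%:R) * (if g then next_weight z a v' else 1).
Proof.
rewrite /row_weight /own_weight /next_weight; case: g; rewrite ?mulr1 //.
by case: (v' <= a)%N; case: (a <= v)%N => /=; rewrite ?mulr0 ?mul0r.
Qed.

Lemma sum_interval N lo hi (G : nat -> R) (P : pred nat) :
  (hi <= N)%N -> (forall v, P v = (lo <= v <= hi)%N) ->
  \sum_(v < N.+1 | P v) G v =
  if (lo <= hi)%N then \sum_(t < (hi - lo).+1) G (lo + t)%N else 0.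
Proof.
move=> hiN PE; case: leqP => [lh|hl]; last first.
  rewrite big_pred0 // => v; rewrite PE; apply/negP => /andP[h1 h2].
  by have := leq_trans hl (leq_trans h1 h2); rewrite ltnn.
rewrite -(big_mkord xpredT (fun t => G (lo + t)%N)) -subSn //.
rewrite (eq_bigr (fun t => G (t + lo)%N)); last by move=> t _; rewrite addnC.
rewrite -(big_addn 0 hi.+1 lo xpredT G) (@big_nat_widen _ _ _ lo hi.+1 N.+1) //.
rewrite (big_nat_widenl lo 0) // -(big_mkord P G); apply: eq_bigl => v.
by rewrite PE ltnS andbC.
Qed.

(** [v] is the length of a row in the middle shape. [a] and [a'] are the inner lengths of the row
    above and of the row itself, [c] and [c'] the outer lengths of the row itself and of the row
    below. *)
Definition box_sum N a a' c c' : R :=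
  \sum_(v < N.+1) next_weight x a v * own_weight x a' v * row_weight b true y v c c'.

(** The terms live on the interval from the maximum of [a'] and [c'] to the minimum of [a] and [c].
    The powers common to all of them are split off, and [sum_strip_sym] treats the rest. *)
Lemma box_sumE N a a' c c' : (c <= N)%N -> exists2 g, s g = g &
  box_sum N a a' c c' = g * x ^+ (c' - a') * y ^+ (c - a)
     * (1 + b * x) ^+ (c < a)%N * (1 + b * y) ^+ (c' < a')%N.
Proof.
move=> cN; pose lo := maxn a' c'; pose hi := minn a c.
pose P v := (lo <= v <= hi)%N.
have -> : box_sum N a a' c c' = \sum_(v < N.+1 | P v)
   ((1 + b * x) ^+ (v < a)%N * x ^+ (v - a') * (y ^+ (c - v) * (1 + b * y) ^+ (c' < v)%N)).
  rewrite [RHS]big_mkcond; apply: eq_bigr => v _.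
  rewrite /next_weight /own_weight /row_weight /P /lo /hi geq_max leq_min.
  by case: (v <= a)%N; case: (a' <= v)%N; case: (c' <= v)%N; case: (v <= c)%N;
    rewrite /= ?mulr0 ?mul0r.
have hiN : (hi <= N)%N by apply: leq_trans cN; exact: geq_minr.
rewrite (sum_interval (lo := lo) (hi := hi) (fun v : nat => (1 + b * x) ^+ (v < a)%N
  * x ^+ (v - a') * (y ^+ (c - v) * (1 + b * y) ^+ (c' < v)%N))) //.
have [lh|_] := leqP lo hi; last by exists 0; rewrite ?rmorph0 // !mul0r.
have [g sg E] := sum_strip_sym (c < a)%N (c' < a')%N (hi - lo).
exists g => //; transitivity (x ^+ (c' - a') * y ^+ (c - a) *
   (g * (1 + b * x) ^+ (c < a)%N * (1 + b * y) ^+ (c' < a')%N)); last by ring.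
rewrite -E mulr_sumr; apply: eq_bigr => t _; have := ltn_ord t; rewrite ltnS => th.
have -> : (lo + t - a' = (c' - a') + t)%N by rewrite /lo; lia.
have -> : (c - (lo + t) = (c - a) + (hi - lo - t))%N by rewrite /hi in th lh *; lia.
have -> : (lo + t < a)%N = (c < a)%N || (t < hi - lo)%N by rewrite /hi in th lh *; lia.
have -> : (c' < lo + t)%N = (c' < a')%N || (0 < t)%N by rewrite /lo; lia.
by rewrite !exprD; ring.
Qed.

Definition free_box_sum N a' c c' : R :=
  \sum_(v < N.+1) own_weight x a' v * row_weight b true y v c c'.

(** The only genuine divided difference. On the right is the numerator of $\pi_i$ for a row of
    length [L] + 1 that admits only the letter of [x], times what [tail_sumE] leaves over from the
    rows below. On the left the row has lost a box and admits both letters. *)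
Lemma free_box_sumE N a L c : (L < N)%N -> (c <= L)%N ->
  (x - y) * (free_box_sum N a L c * y ^+ (c - a) * (1 + b * x) ^+ (c < a)%N) =
  (1 + b * y) * (own_weight x a L.+1 * y ^+ (c - a) * (1 + b * x) ^+ (c < a)%N)
  - (1 + b * x) * (own_weight y a L.+1 * x ^+ (c - a) * (1 + b * y) ^+ (c < a)%N).
Proof.
move=> LN cL; pose lo := maxn a c; pose P v := (lo <= v <= L)%N.
have -> : free_box_sum N a L c = \sum_(v < N.+1 | P v)
   (x ^+ (v - a) * (y ^+ (L - v) * (1 + b * y) ^+ (c < v)%N)).
  rewrite [RHS]big_mkcond; apply: eq_bigr => v _.
  rewrite /own_weight /row_weight /P /lo geq_max.
  by case: (a <= v)%N; case: (c <= v)%N; case: (v <= L)%N;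
    rewrite /= ?mulr0 ?mul0r.
rewrite (sum_interval (lo := lo)
  (fun v : nat => x ^+ (v - a) * (y ^+ (L - v) * (1 + b * y) ^+ (c < v)%N))
  (ltnW LN)) //.
rewrite /own_weight; have [ca|ac] := ltnP c a.
  have loa : lo = a by rewrite /lo (maxn_idPl (ltnW ca)).
  have -> : (c - a = 0)%N by lia.
  (* For [a] > [L] the sum is empty; on the right the terms cancel if [a] = [L] + 1 and vanish
     otherwise. *)
  rewrite loa; have [aL|La] := leqP a L; last first.
    case: (leqP a L.+1) => aL /=; last by rewrite !(mul0r, mulr0) subrr.
    by have -> : (L.+1 - a = 0)%N by [lia]; rewrite !expr0 !expr1; ring.
  have -> : (a <= L.+1)%N by lia.
  rewrite (eq_bigr (fun t : 'I_(L - a).+1 => (1 + b * y) * (x ^+ t * y ^+ ((L - a).+1.-1 - t)))).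
    rewrite -mulr_sumr -/(hsum (L - a).+1) !expr0 !expr1 !mulr1.
    transitivity ((x - y) * hsum (L - a).+1 * ((1 + b * y) * (1 + b * x))); first by ring.
    by rewrite hsumE subSn //; ring.
  move=> t _; have -> : (c < a + t)%N by lia.
  by rewrite addKn subnDA /= expr1; ring.
have loc : lo = c by rewrite /lo (maxn_idPr ac).
rewrite loc cL; have -> : (a <= L.+1)%N by lia.
rewrite (eq_bigr (fun t : 'I_(L - c).+1 => x ^+ (c - a) *
    (x ^+ t * y ^+ (L - c - t) * (1 + b * y) ^+ (0 < t)%N))).
  rewrite -mulr_sumr hsum_weight_r !expr0 !mulr1.
  transitivity (((x - y) * hsum (L - c).+1 + b * (x * y) * ((x - y) * hsum (L - c)))
    * (x ^+ (c - a) * y ^+ (c - a))); first by ring.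
  rewrite !hsumE -subSn //.
  have -> : (L.+1 - a = (L - c).+1 + (c - a))%N by lia.
  by rewrite subSn // !exprD !exprS; ring.
move=> t _; have -> : (c + t - a = (c - a) + t)%N by lia.
have -> : (c < c + t)%N = (0 < t)%N by lia.
by rewrite exprD subnDA; ring.
Qed.

(* The weight of the rows below row [K] is, up to a symmetric factor, what the
   interaction of the rows [K] and [K.+1] leaves over. *)
Lemma tail_sumE N n mu rho K : (K < n)%N -> (forall j, rho j <= N)%N -> rho n = 0%N ->
  exists2 g, s g = g &
  (\prod_(K.+1 <= j < n) box_sum N (mu j.-1) (mu j) (rho j) (rho j.+1))
     * next_weight x (mu n.-1) 0
  = g * y ^+ (rho K.+1 - mu K) * (1 + b * x) ^+ (rho K.+1 < mu K)%N.
Proof.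
move=> Kn rhoN rhon.
have [d dE] : exists d, n = (K + d).+1 by exists (n - K.+1)%N; lia.
elim: d K dE Kn => [|d IH] K dE Kn.
  rewrite addn0 in dE; rewrite big_geq -?dE // mul1r dE /= -dE rhon sub0n.
  by exists 1; rewrite ?rmorph1 // !mul1r.
have K1n : (K.+1 < n)%N by lia.
have [|g sg E] := IH K.+1 _ K1n; first by lia.
have [h sh F] := box_sumE (mu K) (mu K.+1) (rho K.+2) (rhoN K.+1).
rewrite big_ltn; last by lia.
rewrite -mulrA E F /=.
(* What row [K.+1] leaves over towards the row below and what the rows further down leave over
   combine to powers of $xy$ and $(1+bx)(1+by)$. *)
exists (g * h * (x * y) ^+ (rho K.+2 - mu K.+1) * ((1 + b * x) * (1 + b * y)) ^+ (rho K.+2 < mu K.+1)%N).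
  by rewrite !rmorphM !rmorphXn !rmorphM !rmorphD !rmorphM rmorph1 /= sg sh sx sy sb; congr (_ * _ ^+ _ * _ ^+ _); rewrite mulrC.
by rewrite !exprMn; ring.
Qed.
End TwoLetters.

(** * The divided difference of a tableau sum *)

Lemma antitone_leq (rho : nat -> nat) :
  (forall j, rho j.+1 <= rho j) -> forall j k, k <= j -> rho j <= rho k.
Proof.
move=> rhoS; elim=> [|j IH] k; first by rewrite leqn0 => /eqP->.
by rewrite leq_eqVlt => /predU1P[->//|/IH]; apply: leq_trans.
Qed.

Section TableauSumCongruence.
Local Open Scope ring_scope.
Variables (n : nat) (R : comNzRingType) (X : 'I_n -> R) (b : R).
Implicit Types (nu f : nat -> nat).

Lemma eq_tab_sum m nu nu' f f' :
  (forall j, (j < n)%N -> nu j = nu' j) ->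
  (forall j k, (k < m)%N -> (k < f j)%N = (k < f' j)%N) ->
  tab_sum X b m nu f = tab_sum X b m nu' f'.
Proof.
move=> nuE fE; apply: eq_bigl => T; apply/tableauP/tableauP => -[h1 h2 h3 h4]; split=> //.
- by move=> c; rewrite h1 nuE.
- by move=> c k /h2[km]; rewrite fE.
- by move=> c; rewrite h1 nuE.
- by move=> c k /h2[km]; rewrite -fE.
Qed.

Lemma tab_sum_fixed (s : {rmorphism R -> R}) m nu f :
  s b = b -> (forall k : 'I_n, (k < m)%N -> s (X k) = X k) ->
  s (tab_sum X b m nu f) = tab_sum X b m nu f.
Proof.
move=> sb sX; rewrite rmorph_sum; apply: eq_bigr => T /tableauP[_ h2 _ _].
rewrite rmorph_prod; apply: eq_bigr => c _; rewrite rmorphM rmorphXn /= sb.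
rewrite rmorph_prod; congr (_ * _); apply: eq_bigr => k kT.
by rewrite sX //; have [] := h2 _ _ kT.
Qed.

Lemma row_weight_fixed (s : {rmorphism R -> R}) g x a v v' :
  s b = b -> s x = x -> s (row_weight b g x a v v') = row_weight b g x a v v'.
Proof.
move=> sb sx; rewrite /row_weight; case: g; last by rewrite rmorph_nat.
case: ifP; rewrite ?rmorph0 // => _.
by rewrite rmorphM !rmorphXn rmorphD rmorphM rmorph1 /= sb sx.
Qed.

(** The sums run over arbitrary functions [nu]. A nonzero weight forces [nu] to interlace with
    [rho], so [tab_sum_rec] can be applied again to every term that counts. *)
Lemma prod_row_weight_neq0 m (x : R) f (nu : {ffun 'I_n -> 'I_n.+1}) (rho : nat -> nat) :
  (forall j, rho j.+1 <= rho j)%N ->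
  \prod_(j < n) row_weight b (m < f j)%N x (nu j) (rho j) (rho j.+1) != 0 ->
  forall j, (row_len nu j <= rho j)%N /\ (row_len nu j.+1 <= row_len nu j)%N.
Proof.
move=> rhoS nz; have H (j : 'I_n) : (rho j.+1 <= nu j <= rho j)%N.
  apply: contraR nz => h; apply/eqP; rewrite (bigD1 j) //= /row_weight (negbTE h).
  case: ifP => _; first by rewrite mul0r.
  case: eqP => [e|_]; last by rewrite mul0r.
  by rewrite e leqnn rhoS in h.
have H1 j : (row_len nu j <= rho j)%N.
  rewrite /row_len; case: insubP => // u _ <-.
  by have /andP[] := H u.
move=> j; split => //; have [jn|jn] := ltnP j n; last first.
  by rewrite /row_len insubN // -leqNgt ltnW.
apply: leq_trans (H1 _) _; have /andP[] := H (Ordinal jn).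
by rewrite (row_lenE nu (Ordinal jn)).
Qed.
End TableauSumCongruence.

Section Step.
Local Open Scope ring_scope.
Variables (n : nat) (R : idomainType) (X : 'I_n -> R) (b : R).
Variables (act : 'S_n -> {rmorphism R -> R}) (pi : 'I_n.-1 -> R -> R).
Hypothesis Xneq : forall a c : 'I_n, a != c -> X a - X c != 0.
Hypothesis actX : forall s k, act s (X k) = X (s k).
Hypothesis actb : forall s, act s b = b.
Hypothesis piE : forall i h, (X (ordL i) - X (ordR i)) * pi i h =
  (1 + b * X (ordR i)) * h - (1 + b * X (ordL i)) * act (stransp i) h.
Variable i : 'I_n.-1.
Let x := X (ordL i).
Let y := X (ordR i).
Let s := act (stransp i).

Lemma n_gt1 : (1 < n)%N.
Proof. by case: i => k; case: n => [|[]]. Qed.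

Lemma act_ordL : s x = y. Proof. by rewrite /s /x actX tpermL. Qed.
Lemma act_ordR : s y = x. Proof. by rewrite /s /y actX tpermR. Qed.

Lemma act_other (k : 'I_n) : k != i :> nat -> k != i.+1 :> nat -> s (X k) = X k.
Proof.
by move=> k1 k2; rewrite /s actX tpermD // -val_eqE /= eq_sym.
Qed.

(** Each [next_weight] is moved to the row below, on whose length it depends, so that row [j] of the
    middle shape occurs in this factor only. *)
Definition two_row (f rho mu : nat -> nat) j : R :=
  \sum_(v < n.+1)
    (if j is j'.+1 then if (i < f j')%N then next_weight b x (mu j') v else 1 else 1)
    * (if (i < f j)%N then own_weight x (mu j) v else (mu j == v)%:R)
    * row_weight b (i.+1 < f j)%N y v (rho j) (rho j.+1).

Lemma tab_sum_two_letters (f rho : nat -> nat) :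
  (forall j, rho j.+1 <= rho j)%N -> (rho 0 <= n)%N -> rho n = 0%N ->
  tab_sum X b i.+2 rho f = \sum_(mu : {ffun 'I_n -> 'I_n.+1})
    tab_sum X b i (row_len mu) f *
    (\prod_(0 <= j < n) two_row f rho (row_len mu) j *
     (if (i < f n.-1)%N then next_weight b x (row_len mu n.-1) 0 else 1)).
Proof.
move=> rhoS rho0 rhon; rewrite (tab_sum_rec X b (ordR i)) //.
pose P (nu : {ffun 'I_n -> 'I_n.+1}) :=
  \prod_(j < n) row_weight b (i.+1 < f j)%N y (nu j) (rho j) (rho j.+1).
pose Q (mu nu : {ffun 'I_n -> 'I_n.+1}) :=
  \prod_(j < n) row_weight b (i < f j)%N x (mu j) (nu j) (row_len nu j.+1).
transitivity (\sum_nu \sum_mu tab_sum X b i (row_len mu) f * Q mu nu * P nu).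
  apply: eq_bigr => nu _; rewrite -mulr_suml -/(P nu).
  have [->|nz] := eqVneq (P nu) 0; first by rewrite !mulr0.
  have H := prod_row_weight_neq0 rhoS nz.
  congr (_ * _); rewrite (tab_sum_rec X b (ordL i)) //.
  - by apply: eq_bigr => mu _; congr (_ * _); apply: eq_bigr => j _; rewrite row_lenE.
  - by move=> j; have [] := H j.
  - by have [h _] := H 0%N; apply: leq_trans h rho0.
  - by rewrite /row_len insubN // ltnn.
rewrite exchange_big; apply: eq_bigr => mu _ /=.
under eq_bigr do rewrite -mulrA.
rewrite -mulr_sumr; congr (_ * _).
rewrite big_mkord bigA_distr_bigA mulr_suml /=; apply: eq_bigr => nu _.
pose prv j v : R :=
  if j is j'.+1 then if (i < f j')%N then next_weight b x (row_len mu j') v else 1 else 1.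
have -> : Q mu nu = (\prod_(j < n) (if (i < f j)%N then own_weight x (row_len mu j) (nu j) else (row_len mu j == nu j)%:R))
   * (\prod_(j < n) prv j (nu j) * (if (i < f n.-1)%N then next_weight b x (row_len mu n.-1) 0 else 1)).
  rewrite /Q (eq_bigr _ (fun j _ => row_weightE _ _ _ _ _ _)) big_split /=; congr (_ * _).
    by apply: eq_bigr => j _; rewrite row_lenE.
  pose G j : R := if (i < f j)%N then next_weight b x (row_len mu j) (row_len nu j.+1) else 1.
  rewrite (eq_bigr (fun j : 'I_n => G j)); last by move=> j _; rewrite /G row_lenE.
  rewrite [X in _ = X * _](eq_bigr (fun j : 'I_n => prv j (row_len nu j))); last first.
    by move=> j _; rewrite row_lenE.
  rewrite -(big_mkord xpredT G) -(big_mkord xpredT (fun j => prv j (row_len nu j))).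
  have nE : n.-1.+1 = n by have := n_gt1; lia.
  have nun : row_len nu n = 0%N by rewrite /row_len insubN // ltnn.
  have -> : (if (i < f n.-1)%N then next_weight b x (row_len mu n.-1) 0 else 1) = G n.-1.
    by rewrite /G nE nun.
  (* The shift by one row leaves over the factor of the last row, below which the length is 0. *)
  rewrite -[X in index_iota 0 X]nE big_nat_recr //= [in RHS]big_nat_recl //= mul1r.
  by [].
rewrite 2!big_split /= -/(P nu).
move: (P nu) => Pn; ring.
Qed.

Lemma two_row_frozen f rho mu j : (j < n)%N -> (rho j <= n)%N ->
  (f j <= i)%N -> (f j.-1 <= i)%N -> two_row f rho mu j = (mu j == rho j)%:R.
Proof.
move=> jn rhon fj fj1; rewrite /two_row /row_weight ltnNge fj /= ltnNge (leqW fj) /=.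
have rhon' : (rho j < n.+1)%N by [].
rewrite (bigD1 (Ordinal rhon')) //= eqxx mulr1 big1 ?addr0; last first.
  by move=> v; rewrite -val_eqE /= => /negbTE ->; rewrite mulr0.
by case: j fj1 {jn fj rhon rhon'} => [|j] /= fj1; rewrite ?ltnNge ?fj1 mul1r.
Qed.

Lemma two_row_one f rho mu j : (rho j <= n)%N ->
  (i < f j <= i.+1)%N -> ((0 < j)%N -> f j.-1 <= i)%N ->
  two_row f rho mu j = own_weight x (mu j) (rho j).
Proof.
move=> rhon /andP[fj fj'] fj1; rewrite /two_row /row_weight fj [(i.+1 < _)%N]ltnNge fj' /=.
have rhon' : (rho j < n.+1)%N by [].
rewrite (bigD1 (Ordinal rhon')) //= eqxx mulr1 big1 ?addr0; last first.
  by move=> v; rewrite -val_eqE /= => /negbTE ->; rewrite mulr0.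
by case: j fj1 {fj fj' rhon rhon'} => [|j] /= fj1; rewrite ?ltnNge ?fj1 ?mul1r.
Qed.

Lemma two_row_first f rho mu j : (i.+1 < f j)%N -> ((0 < j)%N -> f j.-1 <= i)%N ->
  two_row f rho mu j = free_box_sum b x y n (mu j) (rho j) (rho j.+1).
Proof.
move=> fj fj1; apply: eq_bigr => v _; rewrite fj (ltnW fj).
by case: j fj1 {fj} => [|j] /= fj1; rewrite ?ltnNge ?fj1 ?mul1r.
Qed.

Lemma two_row_next f rho mu j : (0 < j)%N -> (i.+1 < f j)%N -> (i < f j.-1)%N ->
  two_row f rho mu j = box_sum b x y n (mu j.-1) (mu j) (rho j) (rho j.+1).
Proof.
case: j => // j _ /= fj fj1; apply: eq_bigr => v _.
by rewrite fj1 fj (ltnW fj).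
Qed.

Section RemoveBox.
Variables (k : nat) (f : nat -> nat).
Hypothesis f_above : forall j, (j < k)%N -> (f j <= i)%N.
Hypothesis f_below : forall j, (k < j)%N -> (i.+1 < f j)%N.

Definition flag_at c j := if j == k then c else f j.
Definition remove_box (rho : nat -> nat) j := (rho j - (j == k))%N.

(** Rows above [k] admit neither letter and rows below admit both, so [c] is felt in row [k]
    alone. *)
Lemma prod_two_row c rho mu : (k < n)%N -> (forall j, rho j <= n)%N -> (i < c)%N ->
  \prod_(0 <= j < n) two_row (flag_at c) rho mu j *
     (if (i < flag_at c n.-1)%N then next_weight b x (mu n.-1) 0 else 1) =
  \prod_(0 <= j < k) (mu j == rho j)%:R * two_row (flag_at c) rho mu k *
   (\prod_(k.+1 <= j < n) box_sum b x y n (mu j.-1) (mu j) (rho j) (rho j.+1)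
    * next_weight b x (mu n.-1) 0).
Proof.
move=> kn rhon ic; have -> : (i < flag_at c n.-1)%N.
  rewrite /flag_at; case: eqP => // /eqP nk; apply/ltnW/f_below.
  by rewrite ltn_neqAle eq_sym nk /= -ltnS prednK // (leq_ltn_trans _ kn).
rewrite mulrA; congr (_ * _).
rewrite (big_cat_nat (leq0n k) (ltnW kn)) /= (big_ltn kn) mulrA; congr (_ * _ * _).
  rewrite big_nat_cond [RHS]big_nat_cond; apply: eq_bigr => j /andP[/andP[_ jk] _].
  apply: two_row_frozen => //; first exact: ltn_trans jk kn.
    by rewrite /flag_at ltn_eqF // f_above.
  have jk1 : (j.-1 < k)%N by apply: leq_ltn_trans jk; exact: leq_pred.
  by rewrite /flag_at ltn_eqF // f_above.
rewrite big_nat_cond [RHS]big_nat_cond; apply: eq_bigr => j /andP[/andP[kj _] _].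
have j0 : (0 < j)%N by apply: leq_ltn_trans kj.
apply: two_row_next => //; rewrite /flag_at; first by rewrite gtn_eqF // f_below.
by case: eqP => // /eqP jk; apply/ltnW/f_below; rewrite ltn_neqAle eq_sym jk -ltnS prednK.
Qed.

Lemma pi_remove_box_base rho :
  (forall j, rho j.+1 <= rho j)%N -> (rho 0 <= n)%N -> rho n = 0%N ->
  (rho k.+1 < rho k)%N ->
  pi i (tab_sum X b i.+2 rho (flag_at i.+1)) =
  tab_sum X b i.+2 (remove_box rho) (flag_at i.+2).
Proof.
move=> rhoS rho0 rhon rhok.
have rhole j : (rho j <= n)%N by elim: j => // j; apply: leq_trans.
have kn : (k < n)%N.
  rewrite ltnNge; apply/negP => /(antitone_leq rhoS).
  by rewrite rhon leqNgt (leq_ltn_trans _ rhok).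
have f_prev c : ((0 < k)%N -> flag_at c k.-1 <= i)%N.
  by move=> k0; rewrite /flag_at ltn_eqF ?f_above // prednK.
have rho2E j : j != k -> remove_box rho j = rho j.
  by move=> /negbTE jk; rewrite /remove_box jk subn0.
rewrite !tab_sum_two_letters //; first 1 last.
- move=> j; rewrite /remove_box; have := rhoS j.
  by case: (eqVneq j k) => [->|_]; case: (j.+1 =P k) => /=; lia.
- by apply: leq_trans rho0; exact: leq_subr.
- by rewrite rho2E // gtn_eqF.
rewrite (pi_sum Xneq piE); apply: eq_bigr => mu _.
have -> : tab_sum X b i (row_len mu) (flag_at i.+2) = tab_sum X b i (row_len mu) (flag_at i.+1).
  apply: eq_tab_sum => // j q qi; rewrite /flag_at; case: ifP => // _.
  by rewrite !ltnS (ltnW qi) (leqW (ltnW qi)).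
move: (row_len mu) => m.
rewrite !prod_two_row //; last first.
  by move=> j; apply: leq_trans (rhole j); exact: leq_subr.
rewrite two_row_one //; last 2 first.
- by rewrite /flag_at eqxx ltnSn /=.
- exact: f_prev.
rewrite two_row_first; last 2 first.
- by rewrite /flag_at eqxx ltnSn.
- exact: f_prev.
have -> : \prod_(0 <= j < k) (m j == remove_box rho j)%:R = \prod_(0 <= j < k) (m j == rho j)%:R :> R.
  rewrite big_nat_cond [RHS]big_nat_cond; apply: eq_bigr => j /andP[/andP[_ jk] _].
  by rewrite rho2E // ltn_eqF.
have -> : \prod_(k.+1 <= j < n) box_sum b x y n (m j.-1) (m j) (remove_box rho j) (remove_box rho j.+1)
  = \prod_(k.+1 <= j < n) box_sum b x y n (m j.-1) (m j) (rho j) (rho j.+1).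
  rewrite big_nat_cond [RHS]big_nat_cond; apply: eq_bigr => j /andP[/andP[jk _] _].
  by rewrite !rho2E // ?gtn_eqF // ltnW.
have xyn : x - y != 0 by apply: Xneq; exact: ordLR_neq.
have [g sg E] := tail_sumE xyn act_ordL act_ordR (actb _) m kn rhole rhon.
rewrite E [remove_box rho k.+1]rho2E; last by rewrite gtn_eqF.
rewrite /remove_box eqxx subn1.
set C := \prod_(0 <= j < k) _; set A := tab_sum _ _ _ _ _.
(* [F] joins row [k] with the remainder of the rows below; all other factors are fixed by [s] and
   pass through $\pi_i$. *)
pose F := own_weight x (m k) (rho k) * y ^+ (rho k.+1 - m k) * (1 + b * x) ^+ (rho k.+1 < m k)%N.
have sG : s (A * C * g) = A * C * g.
  rewrite !rmorphM /= sg; congr (_ * _ * _).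
    apply: tab_sum_fixed; first exact: actb.
    by move=> q qi; apply: act_other; rewrite ltn_eqF // ltnW.
  by rewrite /C rmorph_prod; apply: eq_bigr => j _; rewrite rmorph_nat.
have -> : A * (C * own_weight x (m k) (rho k) * (g * y ^+ (rho k.+1 - m k) * (1 + b * x) ^+ (rho k.+1 < m k)%N))
  = F * (A * C * g) by rewrite /F; ring.
rewrite (piMr Xneq piE _ sG).
have -> : pi i F = free_box_sum b x y n (m k) (rho k).-1 (rho k.+1)
   * y ^+ (rho k.+1 - m k) * (1 + b * x) ^+ (rho k.+1 < m k)%N.
  apply: (pi_unique Xneq piE); rewrite -/x -/y (free_box_sumE b xyn); last 2 first.
  - by case: (rho k) (rhole k) rhok.
  - by case: (rho k) rhok.
  rewrite prednK; last exact: leq_ltn_trans rhok.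
  congr (_ - _ * _); rewrite -/s /F !rmorphM !rmorphXn !rmorphD !rmorphM rmorph1 /=.
  rewrite act_ordL act_ordR actb; congr (_ * _ * _).
  rewrite /own_weight; case: ifP; rewrite ?rmorph0 // rmorphXn /=.
  by rewrite act_ordL.
by ring.
Qed.

(** A later letter has a weight fixed by [s] and cannot enter row [k], whose flag is too small. The
    row thus has the same length before and after that letter, and the box can be removed from the
    inner shape. *)
Lemma pi_remove_box m rho : (i.+2 <= m <= n)%N ->
  (forall j, rho j.+1 <= rho j)%N -> (rho 0 <= n)%N -> rho n = 0%N ->
  (rho k.+1 < rho k)%N ->
  pi i (tab_sum X b m rho (flag_at i.+1)) =
  tab_sum X b m (remove_box rho) (flag_at i.+2).
Proof.
case/andP; elim: m rho => // m IH rho; rewrite leq_eqVlt => /predU1P[<- _|im mn].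
  exact: pi_remove_box_base.
move=> rhoS rho0 rhon rhok; rewrite ltnS in im.
have rhole j : (rho j <= n)%N by elim: j => // j; apply: leq_trans.
have kn : (k < n)%N.
  rewrite ltnNge; apply/negP => /(antitone_leq rhoS).
  by rewrite rhon leqNgt (leq_ltn_trans _ rhok).
have rho2E j : j != k -> remove_box rho j = rho j.
  by move=> /negbTE jk; rewrite /remove_box jk subn0.
pose ko := Ordinal kn; pose mo := Ordinal mn.
rewrite !(tab_sum_rec X b mo) //; first 1 last.
- move=> j; rewrite /remove_box; have := rhoS j.
  by case: (eqVneq j k) => [->|_]; case: (j.+1 =P k) => /=; lia.
- by apply: leq_trans rho0; exact: leq_subr.
- by rewrite rho2E // gtn_eqF.
(* Reindexing needs a bijection on all functions. Exchanging these two values in row [k] is one, and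
   on the terms of nonzero weight it removes the box. *)
pose t : {perm 'I_n.+1} := tperm (inord (rho k)) (inord (rho k).-1).
pose h (mu : {ffun 'I_n -> 'I_n.+1}) : {ffun 'I_n -> 'I_n.+1} :=
  [ffun j => if j == ko then t (mu j) else mu j].
have hK : involutive h.
  by move=> mu; apply/ffunP => j; rewrite !ffunE; case: eqP => // _; rewrite tpermK.
have moE : mo = m :> nat by [].
rewrite moE [RHS](reindex_inj (inv_inj hK)) (pi_sum Xneq piE); apply: eq_bigr => mu _ /=.
have PE : \prod_(j < n) row_weight b (m < flag_at i.+2 j)%N (X mo) (h mu j)
      (remove_box rho j) (remove_box rho j.+1)
  = \prod_(j < n) row_weight b (m < flag_at i.+1 j)%N (X mo) (mu j) (rho j) (rho j.+1).
  apply: eq_bigr => j _; rewrite ffunE -val_eqE /=; have [jk|kj|jk] := ltngtP j k.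
  - rewrite /flag_at ltn_eqF // /row_weight.
    have -> : (m < f j)%N = false.
      by apply/negbTE; rewrite -leqNgt; apply: leq_trans (f_above jk) _; apply: ltnW; apply: ltnW.
    by rewrite rho2E // ltn_eqF.
  - by rewrite /flag_at gtn_eqF // !rho2E // ?gtn_eqF // ltnW.
  - rewrite /flag_at jk eqxx /row_weight ltnNge im /= ltnNge (ltnW im) /=.
    rewrite /remove_box eqxx subn1.
    have -> : (t (mu j) == (rho k).-1 :> nat) = (t (mu j) == inord (rho k).-1).
      by rewrite -val_eqE /= inordK // ltnS (leq_trans (leq_pred _)).
    have -> : (mu j == rho k :> nat) = (mu j == inord (rho k)).
      by rewrite -val_eqE /= inordK // ltnS.
    by rewrite -(tpermL (inord (rho k)) (inord (rho k).-1)) (inj_eq perm_inj).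
rewrite PE (piMr Xneq piE); last first.
  rewrite rmorph_prod; apply: eq_bigr => j _; apply: row_weight_fixed; first exact: actb.
  by apply: act_other; rewrite /= gtn_eqF // ltnW.
have [->|nz] := eqVneq (\prod_(j < n) row_weight b (m < flag_at i.+1 j)%N (X mo) (mu j) (rho j) (rho j.+1)) 0.
  by rewrite !mulr0.
have H := prod_row_weight_neq0 rhoS nz.
have muk : mu ko = rho k :> nat.
  apply/eqP; apply: contraR nz => h'; apply/eqP; rewrite (bigD1 ko) //= /row_weight.
  by rewrite /flag_at eqxx ltnNge (ltnW im) /= (negbTE h') mul0r.
congr (_ * _); rewrite IH; last 1 first.
- by rewrite (row_lenE mu ko) muk; have [h' _] := H k.+1; apply: leq_ltn_trans h' rhok.
- apply: eq_tab_sum => // j jn; rewrite /remove_box.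
  rewrite (row_lenE mu (Ordinal jn)) (row_lenE (h mu) (Ordinal jn)) ffunE -val_eqE /=.
  case: eqP => [jk|_]; last by rewrite subn0.
  have -> : mu (Ordinal jn) = inord (rho k).
    apply: val_inj; rewrite /= inordK ?ltnS // -muk; congr (nat_of_ord (mu _)).
    exact: val_inj.
  by rewrite tpermL !inordK ?subn1 // ltnS ?(leq_trans (leq_pred _)).
- exact: im.
- exact: ltnW mn.
- by move=> j; have [] := H j.
- by have [h' _] := H 0%N; apply: leq_trans h' rho0.
- by rewrite /row_len insubN // ltnn.
Qed.
End RemoveBox.
End Step.

(** * Flags, staircases and fillings of Young diagrams *)

Section FlagChange.
Local Open Scope ring_scope.
Variables (n : nat) (R : comNzRingType) (X : 'I_n -> R) (b : R).

(* Inside a block of equal rows, strictness down the columns makes the flag of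
   the last row bound the other rows. *)
Lemma tableau_flag_change m (nu f g : nat -> nat) (T : {ffun 'I_n * 'I_n -> {set 'I_n}}) :
  nu n = 0%N ->
  (forall j, (0 < nu j)%N -> f j = g j \/ (nu j.+1 = nu j /\ (g j.+1 <= (g j).+1)%N)) ->
  tableau m nu f T -> tableau m nu g T.
Proof.
move=> nun H /tableauP[h1 h2 h3 h4]; apply/tableauP; split=> // c k kT.
split; first by have [] := h2 _ _ kT.
suff G d : forall (c : 'I_n * 'I_n) k, (n - c.1)%N = d -> k \in T c -> (k < g c.1)%N.
  exact: G kT.
elim: d => [|d IH] {c k kT} -[j q] k /= nd kT.
  by have := ltn_ord j; rewrite -subn_gt0 nd.
have nuj : (q < nu j)%N by rewrite -(h1 (j, q)); apply/set0Pn; exists k.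
have [<-|[nuE gS]] := H j (leq_ltn_trans (leq0n _) nuj).
  by have [] := h2 _ _ kT.
have j1 : (j.+1 < n)%N.
  rewrite ltn_neqAle ltn_ord andbT; apply/eqP => e.
  by rewrite -nuE e nun in nuj.
have := h1 (Ordinal j1, q); rewrite /= nuE nuj => /set0Pn[l lT].
have kl := h4 (j, q) (Ordinal j1, q) k l erefl erefl kT lT.
have lg := IH (Ordinal j1, q) l _ lT.
rewrite -ltnS; apply: leq_trans gS; apply: leq_ltn_trans kl _; apply: lg.
by rewrite /=; lia.
Qed.

Lemma tab_sum_flag_change m (nu f g : nat -> nat) : nu n = 0%N ->
  (forall j, (0 < nu j)%N -> f j = g j \/
    [/\ nu j.+1 = nu j, (f j.+1 <= (f j).+1)%N & (g j.+1 <= (g j).+1)%N]) ->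
  tab_sum X b m nu f = tab_sum X b m nu g.
Proof.
move=> nun H; apply: eq_bigl => T; apply/idP/idP; apply: tableau_flag_change => // j nuj.
  by have [->|[]] := H j nuj; [left|right].
by have [->|[]] := H j nuj; [left|right].
Qed.

(** Strictness down the columns makes the entries of row [j] at least [j], and the flag makes them
    at most [j]: there is a single tableau. *)
Lemma tab_sum_staircase (f : nat -> nat) :
  (forall j, (j.+1 < n)%N -> f j = j.+1) ->
  tab_sum X b n (fun j => n - j.+1)%N f = \prod_(i < n.-1) X (ordL i) ^+ (n - i.+1).
Proof.
move=> fE; pose nu j := (n - j.+1)%N.
pose T0 : {ffun 'I_n * 'I_n -> {set 'I_n}} :=
  [ffun c : 'I_n * 'I_n => if (c.2 < nu c.1)%N then [set c.1] else set0].
have TE T : tableau n nu f T = (T == T0).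
  apply/tableauP/eqP => [[h1 h2 h3 h4]|->].
    have ge r : forall (c : 'I_n * 'I_n) k, c.1 = r :> nat -> k \in T c -> (r <= k)%N.
      elim: r => // r IH -[j q] k /= jr kT.
      have r1 : (r < n)%N by apply: ltn_trans (ltn_ord j); rewrite jr.
      have : (q < nu j)%N by rewrite -(h1 (j, q)); apply/set0Pn; exists k.
      move=> qj; have : (q < nu r)%N by apply: leq_trans qj _; rewrite /nu jr; lia.
      rewrite -(h1 (Ordinal r1, q)) => /set0Pn[l lT].
      apply: leq_ltn_trans (IH _ _ _ lT) _ => //.
      exact: (h4 (Ordinal r1, q) (j, q)).
    apply/ffunP => c; rewrite ffunE; case: ifP => cnu; last first.
      by apply/eqP; move: (h1 c); rewrite cnu => /negbFE.
    have E k : k \in T c -> k = c.1.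
      move=> kT; apply: val_inj; apply/eqP; rewrite eqn_leq /= (ge c.1 c) // andbT.
      have [_] := h2 _ _ kT; rewrite fE ?ltnS //.
      by rewrite -subn_gt0; exact: leq_ltn_trans cnu.
    apply/setP => k; rewrite inE; apply/idP/eqP => [/E//|->].
    by move: (h1 c); rewrite cnu => /set0Pn[l /[dup] /E ->].
  have T0E c k : (k \in T0 c) = (c.2 < nu c.1)%N && (k == c.1).
    by rewrite ffunE; case: ifP => _; rewrite inE.
  split.
  - move=> c; rewrite ffunE; case: ifP; rewrite ?eqxx // => _.
    by apply/set0Pn; exists c.1; rewrite inE.
  - move=> c k; rewrite T0E => /andP[cnu /eqP ->]; rewrite ltn_ord fE //.
    by rewrite -subn_gt0; exact: leq_ltn_trans cnu.
  - by move=> c d k l e1 _; rewrite !T0E => /andP[_ /eqP->] /andP[_ /eqP->]; rewrite e1.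
  - by move=> c d k l e1 _; rewrite !T0E => /andP[_ /eqP->] /andP[_ /eqP->]; rewrite e1.
rewrite /tab_sum (eq_bigl _ _ TE) big_pred1_eq.
transitivity (\prod_(j < n) X j ^+ nu j).
  transitivity (\prod_(j < n) \prod_(q < n) entry_weight X b (T0 (j, q))).
    by rewrite pair_bigA; apply: eq_bigr => -[].
  apply: eq_bigr => j _; rewrite (bigID (fun q : 'I_n => q < nu j)%N) /= [X in _ * X]big1 ?mulr1; last first.
    move=> q /negbTE qn; rewrite ffunE /= qn /entry_weight cards0 big_set0 expr0 mulr1 //.
  rewrite (eq_bigr (fun=> X j)); last first.
    by move=> q qn; rewrite ffunE /= qn /entry_weight cards1 big_set1 mul1r.
  rewrite prodr_const; congr (_ ^+ _); rewrite -[RHS](@card_ord_lt n) ?leq_subr //.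
  by apply: eq_card => q; rewrite inE.
rewrite /nu; case: n X {fE nu T0 TE} => [|n'] Y; first by rewrite !big_ord0.
rewrite big_ord_recr /= subnn expr0 mulr1; apply: eq_bigr => j _.
by congr (Y _ ^+ _); apply: val_inj.
Qed.
End FlagChange.

Lemma card_box la : #|box la| = sumn la.
Proof.
rewrite card_tagged; congr sumn.
rewrite (eq_map (fun i : 'I_(size la) => card_ord (nth 0 la i))).
rewrite -[RHS](mkseq_nth 0) /mkseq -val_enum_ord -map_comp.
by apply: eq_map.
Qed.

Section GridTableaux.
Local Open Scope ring_scope.
Variables (n : nat) (R : comNzRingType) (X : 'I_n -> R) (b : R) (la : seq nat).
Hypothesis la_rows : (size la <= n)%N.
Hypothesis la_cols : forall j, (nth 0%N la j <= n)%N.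

Definition cell_of (c : box la) : 'I_n * 'I_n :=
  (widen_ord la_rows (tag c), widen_ord (la_cols (tag c)) (tagged c)).

Lemma cell_of_inj : injective cell_of.
Proof.
case=> i j [i' j'] [/= e1 e2]; have ii' : i = i' by apply: val_inj.
subst i'; congr (existT _ _ _); exact: val_inj.
Qed.

Lemma cell_ofP (c : 'I_n * 'I_n) :
  reflect (exists d, c = cell_of d) (c.2 < nth 0%N la c.1)%N.
Proof.
apply: (iffP idP) => [cl|[d ->]]; last by case: d => i j /=.
have c1 : (c.1 < size la)%N.
  by rewrite ltnNge; apply/negP => h; rewrite nth_default in cl.
exists (existT _ (Ordinal c1) (Ordinal cl : 'I_(nth 0%N la (Ordinal c1)))).
by case: c {c1} cl (c1) => i j /= cl c1; congr (_, _); apply: val_inj.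
Qed.

Definition fill_boxes (T : {ffun 'I_n * 'I_n -> {set 'I_n}}) :
  {ffun box la -> {set 'I_n}} := [ffun d => T (cell_of d)].

Definition fill_cells (S : {ffun box la -> {set 'I_n}}) :
  {ffun 'I_n * 'I_n -> {set 'I_n}} :=
  [ffun c => if [pick d | cell_of d == c] is Some d then S d else set0].

Lemma fill_cellsE S d : fill_cells S (cell_of d) = S d.
Proof.
rewrite ffunE; case: pickP => [d' /eqP/cell_of_inj->//|/(_ d)].
by rewrite eqxx.
Qed.

Lemma fill_cells_out S (c : 'I_n * 'I_n) : ~~ (c.2 < nth 0%N la c.1)%N -> fill_cells S c = set0.
Proof.
move=> cl; rewrite ffunE; case: pickP => // d /eqP dc.
by case/negP: cl; apply/cell_ofP; exists d.
Qed.

Lemma fill_cellsK : cancel fill_cells fill_boxes.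
Proof. by move=> S; apply/ffunP=> d; rewrite ffunE fill_cellsE. Qed.

(** The second conjunct says that [T] is empty outside the shape; it has the form produced by
    [reindex_onto]. *)
Lemma FSVT_tableau (f : 'I_(size la) -> nat) (F : nat -> nat) T :
  (forall i : 'I_(size la), F i = f i) ->
  (fill_boxes T \in FSVT n f) && (fill_cells (fill_boxes T) == T)
  = tableau n (nth 0%N la) F T.
Proof.
move=> FE; apply/andP/tableauP => [[+ /eqP TT]|[h1 h2 h3 h4]].
  rewrite inE => /and4P[/forallP h1 /forallP h2 /forallP h3 /forallP h4].
  have inT (c : 'I_n * 'I_n) k : k \in T c -> exists d, c = cell_of d.
    move=> kT; apply/cell_ofP; apply/negPn/negP => cl.
    by move: kT; rewrite -TT fill_cells_out // inE.
  split.
  - move=> c; case: (boolP (c.2 < _)%N) => [/cell_ofP[d ->]|cl].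
      by have := h1 d; rewrite ffunE.
    by rewrite -TT fill_cells_out // eqxx.
  - move=> c k /[dup] kT /inT[d cd]; split => //; subst c.
    have /forall_inP/(_ k) := h2 d; rewrite ffunE => /(_ kT).
    by rewrite -FE.
  - move=> c c' k l e1 e2 /[dup] kT /inT[d cd] /[dup] lT /inT[d' cd']; subst c c'.
    have /forallP/(_ d')/implyP := h3 d; rewrite !ffunE => H.
    have /H/forall_inP/(_ _ kT)/forall_inP/(_ _ lT) // :
      ((brow d' == brow d) && (bcol d' == (bcol d).+1)).
    by apply/andP; split; apply/eqP => //; apply: val_inj; have /(congr1 val) := e1.
  - move=> c c' k l e1 e2 /[dup] kT /inT[d cd] /[dup] lT /inT[d' cd']; subst c c'.
    have /forallP/(_ d')/implyP := h4 d; rewrite !ffunE => H.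
    have /H/forall_inP/(_ _ kT)/forall_inP/(_ _ lT) // :
      ((brow d' == (brow d).+1 :> nat) && (bcol d' == bcol d)).
    by apply/andP; split; apply/eqP => //; have /(congr1 val) := e2.
split; last first.
  apply/eqP/ffunP => c; case: (boolP (c.2 < nth 0%N la c.1)%N) => cl.
    by have /cell_ofP[d ->] := cl; rewrite fill_cellsE ffunE.
  by rewrite fill_cells_out //; apply/esym/eqP/negPn; rewrite h1.
rewrite inE; apply/and4P; split.
- by apply/forallP => d; rewrite ffunE h1; apply/cell_ofP; exists d.
- apply/forallP => d; apply/forall_inP => k; rewrite ffunE => /h2[_].
  by rewrite -FE.
- apply/forallP => d; apply/forallP => d'; apply/implyP => /andP[/eqP e1 /eqP e2].
  apply/forall_inP => k; rewrite ffunE => kT; apply/forall_inP => l; rewrite ffunE => lT.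
  apply: (h3 _ _ _ _ _ _ kT lT) => //.
  by apply: val_inj; rewrite /= -/(brow d') e1.
- apply/forallP => d; apply/forallP => d'; apply/implyP => /andP[/eqP e1 /eqP e2].
  apply/forall_inP => k; rewrite ffunE => kT; apply/forall_inP => l; rewrite ffunE => lT.
  apply: (h4 _ _ _ _ _ _ kT lT) => //.
  by apply: val_inj; rewrite /= -/(bcol d') e2.
Qed.

Lemma sum_FSVT (f : 'I_(size la) -> nat) (F : nat -> nat) :
  (forall i : 'I_(size la), F i = f i) ->
  \sum_(T in FSVT n f) b ^+ (\sum_(c : box la) #|T c| - sumn la)
      * \prod_(c : box la) \prod_(k in T c) X k
  = tab_sum X b n (nth 0%N la) F.
Proof.
move=> FE; rewrite (reindex_onto fill_boxes fill_cells); last by move=> S _; exact: fill_cellsK.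
rewrite (eq_bigl _ _ (fun T => FSVT_tableau T FE)); apply: eq_bigr => T /tableauP[h1 _ _ _].
transitivity (\prod_(c : box la) entry_weight X b (T (cell_of c))).
  rewrite /entry_weight big_split prodrXr /=; congr (_ ^+ _ * _); last first.
    by apply: eq_bigr => c _; rewrite ffunE.
  (* The truncated subtraction may be distributed over the boxes because no entry is empty. *)
  rewrite -card_box -sum1_card -sumnB; last first.
    by move=> c _; rewrite ffunE card_gt0 h1; apply/cell_ofP; exists c.
  by apply: eq_bigr => c _; rewrite ffunE subn1.
rewrite [RHS](bigID (fun c => c \in [set cell_of d | d in setT])) /= big_imset /=; last first.
  by move=> c d _ _; exact: cell_of_inj.
rewrite [X in _ = _ * X]big1 ?mulr1; first by apply: eq_bigl => c; rewrite inE.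
move=> c /imsetP cn; have -> : T c = set0.
  apply/eqP/negPn; rewrite h1; apply/cell_ofP => -[d cd]; apply: cn.
  by exists d.
by rewrite /entry_weight cards0 big_set0 mulr1.
Qed.
End GridTableaux.

(** * Dots and essential cells of a permutation *)

Definition cross (u : nat -> nat) p q := \sum_(0 <= j < p) (q <= u j).

Section CrossCount.
Variables (u v : nat -> nat).
Hypothesis (uK : cancel u v) (vK : cancel v u).

Lemma crossSp p q : cross u p.+1 q = cross u p q + (q <= u p).
Proof. by rewrite /cross big_nat_recr. Qed.

Lemma cross0 q : cross u 0 q = 0. Proof. by rewrite /cross big_geq. Qed.

Lemma crossSq p q : cross u p q = cross u p q.+1 + (v q < p).
Proof.
elim: p => [|p IH]; first by rewrite !cross0.
have E : (q == u p) = (v q == p) by apply/eqP/eqP => [->|<-]; rewrite ?uK ?vK.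
rewrite !crossSp IH [q <= u p]leq_eqVlt [v q < p.+1]ltnS [v q <= p]leq_eqVlt E.
case: eqP => [vq|_] /=; last by lia.
by rewrite -vq vK !ltnn; lia.
Qed.

Lemma cross_le_p p p' q : p <= p' -> cross u p q <= cross u p' q.
Proof.
by move/subnKC <-; elim: (p' - p) => [|d IH]; rewrite ?addn0 // addnS crossSp; lia.
Qed.

Lemma cross_ge_q p q q' : q <= q' -> cross u p q' <= cross u p q.
Proof.
by move/subnKC <-; elim: (q' - q) => [|d IH]; rewrite ?addn0 // addnS; have := crossSq p (q + d); lia.
Qed.

Lemma cross_le p q : cross u p q <= p.
Proof. by elim: p => [|p IH]; rewrite ?cross0 ?crossSp //; case: (q <= _); lia. Qed.

Lemma cross_lt_p p p' q : p <= p' -> cross u p q < cross u p' q ->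
  exists2 j, p <= j < p' & q <= u j.
Proof.
move/subnKC <-; elim: (p' - p) => [|d IH]; first by rewrite addn0 ltnn.
rewrite addnS crossSp; case: (leqP q (u (p + d))) => h; first by exists (p + d) => //; lia.
by rewrite addn0 => /IH[j jp qj]; exists j => //; lia.
Qed.

Lemma cross_gt0 p q : 0 < cross u p q -> exists2 j, j < p & q <= u j.
Proof.
move=> h; have [||j jp qj] := @cross_lt_p 0 p q; rewrite ?cross0 //.
by exists j.
Qed.
End CrossCount.

(* For a permutation [u] of the naturals with inverse [v], [cross u p q] counts the
   positions below [p] with values at least [q], and [cross v q p] the values below
   [q] at positions at least [p]: the dots NE and SW of the cell [(p, q)]. *)
Section Permutation.
Variables (n : nat) (u v : nat -> nat).
Hypothesis (uK : cancel u v) (vK : cancel v u).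
Hypothesis (u_ge : forall j, n <= j -> u j = j).
Local Notation NE p q := (cross u p q).
Local Notation SW p q := (cross v q p).

Let v_ge j : n <= j -> v j = j.
Proof. by move=> /u_ge nj; rewrite -{1}nj uK. Qed.

Lemma perm_lt j : j < n -> u j < n.
Proof. by move=> jn; rewrite ltnNge; apply/negP => /[dup] /v_ge; rewrite uK; lia. Qed.

Lemma SWSp p q : SW p q = SW p.+1 q + (u p < q).
Proof. exact: (crossSq vK uK). Qed.

Lemma SW_lt p p' q : p <= p' -> SW p' q < SW p q -> exists2 j, p <= j < p' & u j < q.
Proof.
move/subnKC <-; elim: (p' - p) => [|d IH]; first by rewrite addn0 ltnn.
rewrite addnS; have := SWSp (p + d) q; case: (ltnP (u (p + d)) q) => h E h'.
  by exists (p + d) => //; lia.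
by have [|j jp uj] := IH; [lia|exists j => //; lia].
Qed.

(** The first [p] rows hold [p] dots and the first [q] columns hold [q]; leaving out the dots common
    to both gives NE and SW. *)
Lemma NE_SW p q : NE p q + q = SW p q + p.
Proof.
elim: p => [|p IH].
  rewrite cross0 addn0 add0n; elim: q => [|q IH]; first by rewrite cross0.
  by rewrite crossSp -IH addn1.
have := SWSp p q; rewrite crossSp; case: (leqP q (u p)) => _ /=; lia.
Qed.

Lemma cell_bound p q : 0 < NE p q -> 0 < SW p q -> [/\ p <= n, q <= n & SW p q + p <= n].
Proof.
move=> ne sw; have [j jp qj] := cross_gt0 ne; have [t tq pt] := cross_gt0 sw.
have pn : p < n.
  rewrite ltnNge; apply/negP => np; have vt : v t = t.
    by rewrite -{2}(vK t) u_ge //; lia.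
  have uj : v (u j) = u j by apply: v_ge; lia.
  by move: uj; rewrite uK; lia.
have NEn : NE p n = 0.
  apply/eqP; rewrite -leqn0 leqNgt; apply/negP => /cross_gt0[j' j'p].
  by rewrite leqNgt perm_lt //; lia.
have qn : q <= n.
  rewrite leqNgt; apply/negP => nq; have := perm_lt (ltn_trans jp pn).
  by lia.
split=> //; first exact: ltnW.
by have := NE_SW p n; have := cross_le_p v p qn; rewrite NEn; lia.
Qed.

Lemma NE_SW_bound p q : 0 < NE p q -> 0 < SW p q -> NE p q + SW p q <= n.
Proof. by move=> ne sw; have [_ _] := cell_bound ne sw; have := cross_le u p q; lia. Qed.

(** The coordinates are those of grid lines: ([p], [q]) is the 0-based cell ([p] - 1, [q] - 1). The
    inequalities place it in the diagram and its lower and right neighbours outside. *)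
Definition essential p q :=
  [&& 0 < p, 0 < q, q <= u p.-1, p <= v q.-1, u p < q & v q < p].

(** Each inequality that fails names a step which raises one count by one and keeps the other. The
    walk ends because NE + SW is bounded by [n]. *)
Lemma essential_exists p q : 0 < NE p q -> 0 < SW p q ->
  exists p' q', [/\ essential p' q', NE p q <= NE p' q' & SW p q <= SW p' q'].
Proof.
move: {2}(n - _).+1 (ltnSn (n - (NE p q + SW p q))) => d.
elim: d p q => // d IH p q dn ne sw.
have p0 : 0 < p by move: ne; case: (p) => //; rewrite cross0.
have q0 : 0 < q by move: sw; case: (q) => //; rewrite cross0.
have [pE qE] : p = p.-1.+1 /\ q = q.-1.+1 by lia.
have go p' q' : NE p q <= NE p' q' -> SW p q <= SW p' q' ->
    NE p q + SW p q < NE p' q' + SW p' q' ->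
    exists p' q', [/\ essential p' q', NE p q <= NE p' q' & SW p q <= SW p' q'].
  move=> h1 h2 h3; have ne' := leq_trans ne h1; have sw' := leq_trans sw h2.
  have bd := NE_SW_bound ne' sw'; have [|p2 [q2 [e k1 k2]]] := IH p' q' _ ne' sw'; first lia.
  by exists p2, q2; split => //; [exact: leq_trans h1 k1|exact: leq_trans h2 k2].
case: (leqP q (u p.-1)) => c1; last first.
  apply: (go p.-1 q); have := crossSp u p.-1 q; have := SWSp p.-1 q;
    rewrite -pE c1 leqNgt c1 /=; lia.
case: (leqP p (v q.-1)) => c2; last first.
  apply: (go p q.-1); have := crossSp v q.-1 p; have := crossSq uK vK p q.-1;
    rewrite -qE c2 leqNgt c2 /=; lia.
case: (ltnP (u p) q) => c3; last first.
  apply: (go p.+1 q); have := crossSp u p q; have := SWSp p q;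
    rewrite c3 ltnNge c3 /=; lia.
case: (ltnP (v q) p) => c4; last first.
  apply: (go p q.+1); have := crossSp v q p; have := crossSq uK vK p q;
    rewrite c4 ltnNge c4 /=; lia.
by exists p, q; split => //; rewrite /essential p0 q0 c1 c2 c3 c4.
Qed.
End Permutation.

(** * Adjacent transpositions, shapes and diagonal counts *)

Definition adj_swap i j := if j == i then i.+1 else if j == i.+1 then i else j.

Lemma adj_swapL i : adj_swap i i = i.+1.
Proof. by rewrite /adj_swap eqxx. Qed.

Lemma adj_swapR i : adj_swap i i.+1 = i.
Proof. by rewrite /adj_swap gtn_eqF // eqxx. Qed.

Lemma adj_swapD i j : j != i -> j != i.+1 -> adj_swap i j = j.
Proof. by rewrite /adj_swap => /negbTE-> /negbTE->. Qed.

Lemma adj_swapK i : involutive (adj_swap i).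
Proof. by move=> j; rewrite /adj_swap; do ![case: eqP => //]; lia. Qed.

Lemma adj_swap_lt i j k : j < k -> ~~ ((j == i) && (k == i.+1)) -> adj_swap i j < adj_swap i k.
Proof. by rewrite /adj_swap; do ![case: eqP => //=]; lia. Qed.

Lemma adj_swapC i j k : i.+1 < j ->
  adj_swap i (adj_swap j k) = adj_swap j (adj_swap i k).
Proof. by rewrite /adj_swap => ij; do ![case: eqP => //]; lia. Qed.

Lemma adj_swap_braid i k : adj_swap i (adj_swap i.+1 (adj_swap i k)) =
  adj_swap i.+1 (adj_swap i (adj_swap i.+1 k)).
Proof. by rewrite /adj_swap; do ![case: eqP => //]; lia. Qed.

Definition no2143 (u : nat -> nat) := forall a b c d,
  a < b -> b < c -> c < d -> u b < u a -> u a < u d -> u d < u c -> False.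

(** The Lehmer code, as the SW count of the cell at row [j] and column [u j]. *)
Definition code (u v : nat -> nat) j := cross v (u j) j.

(* The boxes of [lambda(w)] for vexillary [w]. *)
Definition in_shape (u v : nat -> nat) k c :=
  exists p q, k < cross u p q /\ c < cross v q p.

Record flag_data (u v la f : nat -> nat) : Prop := FlagData {
  flag_shape : forall k c, c < la k <-> in_shape u v k c;
  flag_mono : forall j, f j <= f j.+1;
  flag_corner : forall k, la k.+1 < la k ->
    exists p q, [/\ cross u p q = k.+1, cross v q p = la k & f k = p];
  flag_step : forall k, 0 < la k.+1 -> la k.+1 = la k -> f k.+1 <= (f k).+1 }.

(** The diagonal is given by the difference [t] - [s] of two naturals, which avoids integers. *)
Definition diagram_count n (u v : nat -> nat) s t :=
  \sum_(0 <= p < n) \sum_(0 <= q < n) [&& q < u p, p < v q & q + s == p + t].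

Definition shape_count n (la : nat -> nat) s t :=
  \sum_(0 <= p < n) \sum_(0 <= q < n) ((q < la p) && (q + s == p + t)).

Lemma sum_pair_indicator n k c : k < n -> c < n ->
  \sum_(0 <= p < n) \sum_(0 <= q < n) ((p == k) && (q == c)) = 1.
Proof.
move=> kn cn; rewrite (bigD1_seq k) ?mem_index_iota ?iota_uniq //= eqxx.
rewrite (bigD1_seq c) ?mem_index_iota ?iota_uniq //= eqxx.
rewrite big1 ?addn0; last by move=> q /negbTE ->.
by rewrite big1 ?addn0 // => p /negbTE ->; rewrite big1.
Qed.

(** Suppose row [k] of [la2] ends at column [c], before that of [la1]. On the diagonal of ([k], [c])
    all boxes of [la2] lie above row [k], hence in [la1], and [la1] has the box ([k], [c]) in
    addition. *)
Lemma shape_count_le N la1 la2 :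
  (forall j, la1 j.+1 <= la1 j) -> (forall j, la2 j.+1 <= la2 j) ->
  (forall j, 0 < la1 j -> j < N) -> (forall j, la1 j <= N) ->
  (forall s t, shape_count N la1 s t = shape_count N la2 s t) ->
  forall k, la1 k <= la2 k.
Proof.
move=> S1 S2 N1 N2 H k; rewrite leqNgt; apply/negP => lt; set c := la2 k in lt.
have kN : k < N by apply: N1; lia.
have cN : c < N by apply: leq_trans (N2 k).
have := H k c; have := sum_pair_indicator kN cN; rewrite /shape_count => E1.
suff : \sum_(0 <= p < N) \sum_(0 <= q < N) ((q < la2 p) && (q + k == p + c)
            + (p == k) && (q == c)) <=
       \sum_(0 <= p < N) \sum_(0 <= q < N) ((q < la1 p) && (q + k == p + c)).
  under eq_bigr do rewrite big_split /=.
  by rewrite big_split /= E1; lia.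
apply: leq_sum => p _; apply: leq_sum => q _.
case: (q + k =P p + c) => [E|nE]; last first.
  by rewrite !andbF; case: eqP => // e1; case: eqP => // e2; case: nE; lia.
rewrite !andbT; have [pk|kp] := ltnP p k.
  have qc : q < c by lia.
  have -> : (p == k) = false by lia.
  by have := antitone_leq S1 (ltnW pk); lia.
have -> : (q < la2 p) = false by have := antitone_leq S2 kp; lia.
by case: eqP => // e1; case: eqP => // e2; rewrite e1 e2 lt.
Qed.

Section ShapeTheory.
Variables (n : nat) (u v la : nat -> nat).
Hypothesis (uK : cancel u v) (vK : cancel v u).
Hypothesis (u_ge : forall j, n <= j -> u j = j).
Hypothesis shapeE : forall k c, c < la k <-> in_shape u v k c.

Lemma shape_antitone k : la k.+1 <= la k.
Proof.
case E : (la k.+1) => [//|c]; apply/shapeE.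
have /shapeE[p [q [h1 h2]]] : c < la k.+1 by rewrite E.
by exists p, q; split => //; exact: ltnW.
Qed.

Lemma shape_le j k : j <= k -> la k <= la j.
Proof. exact: (antitone_leq shape_antitone). Qed.

Lemma shape_bound k : 0 < la k -> k + la k < n.
Proof.
move=> lk; have /shapeE[p [q [h1 h2]]] : (la k).-1 < la k by rewrite prednK.
have := NE_SW_bound uK vK u_ge (leq_ltn_trans (leq0n _) h1) (leq_ltn_trans (leq0n _) h2).
by lia.
Qed.

Lemma shape_corner k : 0 < la k -> exists2 k', k <= k' & la k' = la k /\ la k'.+1 < la k'.
Proof.
move=> lk; have [d] : exists d, n - k <= d by exists (n - k).
elim: d k lk => [|d IH] k lk nd; first by have := shape_bound lk; lia.
have := shape_antitone k; rewrite leq_eqVlt => /predU1P[e|]; last by exists k.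
have [||k' kk' [e1 e2]] := IH k.+1; [by rewrite e|by have := shape_bound lk; lia|].
by exists k'; [exact: ltnW|split=> //; rewrite e1 e].
Qed.

(** If an inequality failed, the step it names would give a rectangle reaching beyond the corner. *)
Lemma corner_essential k p q : la k.+1 < la k ->
  cross u p q = k.+1 -> cross v q p = la k -> essential u v p q.
Proof.
move=> ck ne sw; have no1 p' q' : k.+1 < cross u p' q' -> la k.+1 < cross v q' p' -> False.
  by move=> h1 h2; have /shapeE : in_shape u v k.+1 (la k.+1); [exists p', q'|rewrite ltnn].
have no2 p' q' : k < cross u p' q' -> la k < cross v q' p' -> False.
  by move=> h1 h2; have /shapeE : in_shape u v k (la k); [exists p', q'|rewrite ltnn].
have p0 : 0 < p by move: ne; case: (p) => //; rewrite cross0.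
have q0 : 0 < q by move: sw ck; case: (q) => //; rewrite cross0 => <-.
have [pE qE] : p = p.-1.+1 /\ q = q.-1.+1 by lia.
rewrite /essential p0 q0 /=; apply/and4P; split.
- rewrite leqNgt; apply/negP => h; apply: (no2 p.-1 q).
    by have := crossSp u p.-1 q; rewrite -pE; lia.
  by have := SWSp uK vK p.-1 q; rewrite -pE h; lia.
- rewrite leqNgt; apply/negP => h; apply: (no1 p q.-1).
    by have := crossSq uK vK p q.-1; rewrite -qE h; lia.
  by have := crossSp v q.-1 p; rewrite -qE; lia.
- rewrite ltnNge; apply/negP => h; apply: (no1 p.+1 q).
    by rewrite crossSp h; lia.
  by have := SWSp uK vK p q; rewrite ltnNge h; lia.
- rewrite ltnNge; apply/negP => h; apply: (no2 p q.+1).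
    by have := crossSq uK vK p q; rewrite ltnNge h; lia.
  by rewrite crossSp h; lia.
Qed.
End ShapeTheory.

(** * Dots and code after an adjacent swap *)

Section AdjacentSwap.
Variables (u v u' v' : nat -> nat) (i : nat).
Hypothesis (uK : cancel u v) (vK : cancel v u).
Hypotheses (u'E : forall j : nat, u' j = u (adj_swap i j)) (v'E : forall t, v' t = adj_swap i (v t)).

Lemma u'K : cancel u' v'. Proof. by move=> j; rewrite ?u'E ?v'E uK adj_swapK. Qed.
Lemma v'K : cancel v' u'. Proof. by move=> j; rewrite ?u'E ?v'E adj_swapK vK. Qed.

Lemma NE_step_other (p : nat) q : p != i.+1 -> cross u' p q = cross u p q.
Proof.
have low k : k <= i -> cross u' k q = cross u k q.
  move=> ki; rewrite /cross big_nat [RHS]big_nat; apply: eq_bigr => j /andP[_ jk].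
  by rewrite ?u'E adj_swapD // ltn_eqF //; lia.
move=> pi; have [|ip] := leqP p i; first exact: low.
have /subnKC <- : i.+2 <= p by rewrite ltn_neqAle eq_sym pi.
elim: (_ - _) => [|d IH].
  rewrite addn0 !crossSp low // ?u'E adj_swapL adj_swapR; lia.
by rewrite addnS (crossSp u') (crossSp u) IH ?u'E adj_swapD // gtn_eqF //; lia.
Qed.

Lemma NE_step q : cross u' i.+1 q = cross u i q + (q <= u i.+1).
Proof. by rewrite crossSp NE_step_other ?ltn_eqF // ?u'E adj_swapL. Qed.

Lemma SW_step_other (p : nat) q : p != i.+1 -> cross v' q p = cross v q p.
Proof.
move=> pi; apply: eq_bigr => t _; rewrite ?v'E /adj_swap.
by move: pi; do ![case: eqP => //=] => *; congr nat_of_bool; apply/idP/idP; lia.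
Qed.

Lemma SW_step q : cross v q i = cross v' q i.+1 + (u i.+1 < q).
Proof.
have := SWSp u'K v'K i q; rewrite SW_step_other ?ltn_eqF //.
by rewrite ?u'E adj_swapL.
Qed.

(** The two code entries change places, and the one that moves to the front grows by one. *)
Lemma sum_code_step n : i.+1 < n -> u i < u i.+1 ->
  \sum_(0 <= j < n) code u' v' j = (\sum_(0 <= j < n) code u v j).+1.
Proof.
move=> i1n asc; have split_sum (G : nat -> nat) : \sum_(0 <= p < n) G p =
    \sum_(0 <= p < i) G p + (G i + G i.+1 + \sum_(i.+2 <= p < n) G p).
  rewrite (big_cat_nat (leq0n i) (ltnW (ltnW i1n))) /=; congr addn.
  by rewrite big_ltn ?(ltnW i1n) // big_ltn // addnA.
have other p : p != i -> p != i.+1 -> code u' v' p = code u v p.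
  by move=> pi pi1; rewrite /code u'E adj_swapD // SW_step_other.
rewrite !split_sum.
have -> : \sum_(0 <= p < i) code u' v' p = \sum_(0 <= p < i) code u v p.
  by rewrite big_nat [RHS]big_nat; apply: eq_bigr => p /andP[_ pi]; apply: other; lia.
have -> : \sum_(i.+2 <= p < n) code u' v' p = \sum_(i.+2 <= p < n) code u v p.
  by rewrite big_nat [RHS]big_nat; apply: eq_bigr => p /andP[pi _]; apply: other; lia.
have -> : code u' v' i = (code u v i.+1).+1.
  rewrite /code u'E adj_swapL SW_step_other ?ltn_eqF //.
  by rewrite (SWSp uK vK) asc addn1.
have -> : code u' v' i.+1 = code u v i.
  rewrite /code u'E adj_swapR; have := SW_step (u i).
  by rewrite [u i.+1 < _]ltnNge (ltnW asc) addn0.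
lia.
Qed.
End AdjacentSwap.

(** * The chosen ascent: patterns, shape, diagram and flags *)

Section AscentStep.
Variables (n : nat) (u v : nat -> nat).
Hypothesis (uK : cancel u v) (vK : cancel v u).
Hypothesis (u_ge : forall j, n <= j -> u j = j).
Hypothesis vex : no2143 u.
Local Notation NE p q := (cross u p q).
Local Notation SW p q := (cross v q p).
Let SWS := SWSp uK vK.

(* The ascents used in the induction; the last clause separates the case of an ascent of
   the code from that of a permutation decreasing up to position [i]. *)
Definition good_ascent i :=
  [/\ u i < u i.+1,
      forall j, i.+1 < j -> code u v j <= code u v i.+1,
      forall b c t, b < c -> c <= i -> t < u i.+1 -> i <= v t ->
        u c < u b -> u b < t -> False &
      (exists z, [/\ u i < z, z < u i.+1 & i.+1 < v z]) \/ (forall b, b < i -> u i < u b)].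

Lemma code_ge j : n <= j -> code u v j = 0.
Proof.
move=> nj; rewrite /code u_ge //; apply/eqP; rewrite -leqn0 leqNgt.
apply/negP => /cross_gt0[t tj jt]; have /u_ge : n <= v t by lia.
by rewrite vK; lia.
Qed.

Lemma good_ascent_exists i0 : i0.+1 < n -> u i0 < u i0.+1 ->
  exists2 i, i.+1 < n & good_ascent i.
Proof.
move=> i0n asc0; pose P j := (j.+1 < n) && (code u v j < code u v j.+1).
have [/existsP[j0 /= Pj0]|] := boolP [exists j : 'I_n, P j].
  have Pb j : P j -> j <= n by case/andP; lia.
  have exP : exists j, P j by exists j0.
  case: (ex_maxnP exP Pb) => i /andP[i1 ci] imax.
  exists i => //; have asc : u i < u i.+1.
    rewrite ltnNge; apply/negP => h; have : code u v i.+1 <= code u v i; last by lia.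
    have h1 := cross_le_p v i.+1 h; have := SWS i (u i).
    by rewrite /code; lia.
  have noninc d : code u v (i.+1 + d).+1 <= code u v (i.+1 + d).
    rewrite leqNgt; apply/negP => h; have [h1|h1] := ltnP (i.+1 + d).+1 n.
      by have := imax (i.+1 + d); rewrite /P h1 h; lia.
    by rewrite (code_ge h1) in h.
  have le_code j : i.+1 <= j -> code u v j <= code u v i.+1.
    move/subnKC <-; elim: (j - _) => [|d IH]; rewrite ?addn0 // addnS.
    exact: leq_trans (noninc d) IH.
  have [z [z1 z2 z3]] : exists z, [/\ u i < z, z < u i.+1 & i.+1 < v z].
    have h : SW i.+1 (u i).+1 < SW i.+1 (u i.+1).
      move: ci; rewrite /code; have := SWS i (u i); rewrite ltnn addn0.
      by have := crossSp v (u i) i.+1; rewrite uK ltnn; lia.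
    have [t /andP[t1 t2] t3] := cross_lt_p asc h.
    exists t; split=> //; rewrite ltn_neqAle t3 andbT.
    by apply/eqP => e; move: t2; rewrite e vK ltnn.
  split => //; [by move=> j ij; apply: le_code; exact: ltnW| |by left; exists z].
  move=> b c t bc ci' ti vt cb bt.
  (* If [t] is [u i] itself, then [z] takes its place as the last entry of the 2143 pattern. *)
  have [vti|vti] := eqVneq (v t) i.
    apply: (@vex b c i.+1 (v z)) => //; rewrite ?vK //.
    by apply: ltn_trans z1; rewrite -vti vK.
  apply: (@vex b c i.+1 (v t)) => //; rewrite ?vK //.
  rewrite ltn_neqAle; apply/andP; split; last by rewrite ltn_neqAle eq_sym vti.
  by apply/eqP => e; move: ti; rewrite e vK ltnn.
rewrite negb_exists => /forallP noP.
have noninc j : code u v j.+1 <= code u v j.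
  have [j1|/code_ge->//] := ltnP j.+1 n.
  by have := noP (Ordinal (ltnW j1)); rewrite /P /= j1 -leqNgt.
have exA : exists j, u j < u j.+1 by exists i0.
case: (ex_minnP exA) => i asc imin.
have i1 : i.+1 < n by have := imin _ asc0; lia.
have dec b c : b < c -> c <= i -> u c < u b.
  elim: c => // c IH; rewrite ltnS leq_eqVlt => bc ci.
  have cc : u c.+1 < u c.
    rewrite ltn_neqAle (inj_eq (can_inj uK)) gtn_eqF //= leqNgt.
    by apply/negP => /imin; rewrite leqNgt ci.
  by case/predU1P: bc => [->//|bc]; apply: ltn_trans cc (IH bc (ltnW ci)).
exists i => //; split=> //; last by right=> b bi; apply: dec.
  move=> j; move/ltnW/subnKC <-; elim: (j - _) => [|d IH]; rewrite ?addn0 // addnS.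
  exact: leq_trans (noninc _) IH.
move=> b c t bc ci ti vt cb bt.
have bi : b < i by apply: leq_trans bc ci.
have uib := dec b i bi (leqnn i).
have ut : u i < t by apply: ltn_trans uib bt.
(* The value [t] would make the code rise at [i]. *)
have h : SW i.+1 (u i).+1 < SW i.+1 (u i.+1).
  apply: leq_trans (_ : SW i.+1 t.+1 <= _); last exact: cross_le_p.
  rewrite (crossSp v t); have := cross_le_p v i.+1 ut.
  suff -> : i < v t by lia.
  by rewrite ltn_neqAle vt andbT; apply/eqP => e; move: ut; rewrite e vK ltnn.
have := noninc i; rewrite /code; have := SWS i (u i); rewrite ltnn addn0.
by have := crossSp v (u i) i.+1; rewrite uK ltnn; lia.
Qed.

Section GoodAscent.
Variables (i x : nat).
Hypothesis (asc : u i < u i.+1).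
Hypothesis code_max : forall j, i.+1 < j -> code u v j <= code u v i.+1.
Hypothesis no132 : forall b c t, b < c -> c <= i -> t < u i.+1 -> i <= v t ->
  u c < u b -> u b < t -> False.
Hypothesis code_alt :
  (exists z, [/\ u i < z, z < u i.+1 & i.+1 < v z]) \/ (forall b, b < i -> u i < u b).
Hypotheses (x_lt : x < u i.+1) (vx : i <= v x).
Hypothesis x_max : forall t, x < t -> t < u i.+1 -> v t < i.

Variables u' v' : nat -> nat.
Hypotheses (u'E : forall j : nat, u' j = u (adj_swap i j)) (v'E : forall t, v' t = adj_swap i (v t)).
Let NE_step_other := NE_step_other u'E.
Let NE_step := NE_step u'E.
Let SW_step_other := SW_step_other v'E.
Let SW_step := SW_step uK vK u'E v'E.
(** The cell ([i.+1], [x.+1]) becomes essential after the swap; the new box lies in row [a] and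
    column [l]. *)
Let l := SW i.+1 x.+1.
Let a := NE i.+1 x.+1.

(** A new pattern must use both swapped positions in neighbouring roles. As its first two entries
    they contradict [code_max], as its last two [no132], and as the middle ones the ascent at
    [i]. *)
Lemma no2143_step : no2143 u'.
Proof.
move=> p1 p2 p3 p4 p12 p23 p34; rewrite ?u'E => h1 h2 h3.
have [/andP[/eqP e1 /eqP e2]|n12] := boolP ((p1 == i) && (p2 == i.+1)).
  subst p1 p2; rewrite adj_swapL adj_swapR in h1 h2.
  have e3 : adj_swap i p3 = p3 by rewrite adj_swapD // gtn_eqF //; lia.
  have e4 : adj_swap i p4 = p4 by rewrite adj_swapD // gtn_eqF //; lia.
  rewrite e3 e4 in h2 h3.
  (* The code at [p3] counts [u p4] besides values below [u i.+1]. As it does not exceed the code at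
     [i.+1], some value below [u i.+1] occurs between these positions. *)
  have h : SW p3 (u i.+1) < SW i.+1 (u i.+1).
    apply: leq_trans (code_max p23); rewrite /code.
    apply: leq_trans (_ : SW p3 (u p4).+1 <= _); last exact: cross_le_p.
    have p34' := ltnW p34; rewrite crossSp uK p34'.
    by have := cross_le_p v p3 (ltnW h2); lia.
  have [j jp uj] := SW_lt uK vK (ltnW p23) h.
  apply: (@vex i.+1 j p3 p4) => //; last by lia.
  rewrite ltn_neqAle; apply/andP; split; last by lia.
  by apply/eqP => e; move: uj; rewrite -e ltnn.
have [/andP[/eqP e1 /eqP e2]|n34] := boolP ((p3 == i) && (p4 == i.+1)).
  subst p3 p4; rewrite adj_swapL adj_swapR in h2 h3.
  have e3 : adj_swap i p1 = p1 by rewrite adj_swapD // ltn_eqF //; lia.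
  have e4 : adj_swap i p2 = p2 by rewrite adj_swapD // ltn_eqF //; lia.
  rewrite e3 e4 in h1 h2.
  by apply: (no132 p12 (ltnW p23) asc _ h1 h2); rewrite uK.
have [/andP[/eqP e1 /eqP e2]|n23] := boolP ((p2 == i) && (p3 == i.+1)).
  subst p2 p3; rewrite adj_swapL in h1; rewrite adj_swapR in h3.
  by have := ltn_trans h1 (ltn_trans h2 h3); rewrite ltnNge (ltnW asc).
apply: (@vex (adj_swap i p1) (adj_swap i p2) (adj_swap i p3) (adj_swap i p4)) => //;
  exact: adj_swap_lt.
Qed.

Lemma ui_le_x : u i <= x.
Proof.
rewrite leqNgt; apply/negP => xu; have := x_max xu asc.
by rewrite uK ltnn.
Qed.

Lemma mid_le q : NE i.+1 q <= cross u' i.+1 q /\ SW i.+1 q <= cross v' q i.+1.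
Proof.
rewrite NE_step crossSp; have := SW_step q; have := SWS i q; have := asc.
case: (leqP q (u i)); case: (leqP q (u i.+1)); lia.
Qed.

Lemma SW_mid_pivot : SW i.+1 (u i.+1) = l.
Proof.
rewrite /l; apply/eqP; rewrite eqn_leq (cross_le_p v i.+1 x_lt) andbT leqNgt; apply/negP.
move=> /(cross_lt_p x_lt)[t /andP[xt tu] it].
by have := x_max xt tu; lia.
Qed.

Lemma code_pivot : code u v i.+1 = l. Proof. exact: SW_mid_pivot. Qed.

Lemma NE_above_pivot : NE i x.+1 = a.
Proof. by rewrite /a crossSp leqNgt ltnS ui_le_x addn0. Qed.

Lemma SW_above_pivot : SW i x.+1 = l.+1.
Proof. by rewrite SWS ltnS ui_le_x addn1. Qed.

Lemma NE_below_pivot : NE i.+2 x.+1 = a.+1.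
Proof. by rewrite crossSp x_lt addn1. Qed.

Lemma SW_below_pivot : SW i.+2 x.+1 = l.
Proof. by rewrite /l (SWS i.+1 x.+1) ltnS leqNgt x_lt addn0. Qed.

Lemma NE_step_pivot : cross u' i.+1 x.+1 = a.+1.
Proof. by rewrite NE_step NE_above_pivot x_lt addn1. Qed.

Lemma SW_step_pivot : cross v' x.+1 i.+1 = l.+1.
Proof. by have := SW_step x.+1; rewrite SW_above_pivot ltnS leqNgt x_lt addn0. Qed.

Lemma essential_neq p q : essential u v p q -> p != i.+1.
Proof. by case/and5P => _ _ + _ /andP[+ _]; case: eqP => // ->; rewrite /=; lia. Qed.

(** Otherwise the dot of column [q], the dot of row [p] and the value [x] form the pattern excluded
    by [no132]. *)
Lemma essential_above p q : essential u v p q -> p <= i -> x < q.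
Proof.
case/and5P => p0 q0 c1 c2 /andP[c3 c4] pi; rewrite ltnNge; apply/negP => qx.
have qx' : q < x.
  by rewrite ltn_neqAle qx andbT; apply/eqP => e; move: c4; rewrite e; lia.
by apply: (no132 c4 pi x_lt vx); rewrite vK.
Qed.

Lemma essential_below p q : essential u v p q -> a < NE p q -> i.+2 <= p.
Proof.
move=> e ap; have pi := essential_neq e.
rewrite ltn_neqAle eq_sym pi /= ltnNge; apply/negP => pi'.
have := cross_le_p u q pi'; have := cross_ge_q uK vK i (essential_above e pi').
by rewrite NE_above_pivot; lia.
Qed.

(** The SW count of an essential cell is at most the code at [p.-1], and from position [i.+1] on the
    code is at most [l]. *)
Lemma essential_above_SW p q : essential u v p q -> l < SW p q -> p <= i.
Proof.
move=> e lp; have pi := essential_neq e; case/and5P: e => p0 q0 c1 c2 /andP[c3 c4].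
rewrite leqNgt; apply/negP => ip; have ip' : i.+1 < p by rewrite ltn_neqAle eq_sym pi.
have : code u v p.-1 <= l.
  have [e|ne] := eqVneq p.-1 i.+1; first by rewrite e code_pivot.
  by rewrite -code_pivot; apply: code_max; rewrite ltn_neqAle eq_sym ne -ltnS prednK.
rewrite leqNgt /code => /negP; apply; apply: leq_trans lp _.
apply: leq_trans (cross_le_p v p c1) _; exact: (cross_ge_q vK uK _ (leq_pred p)).
Qed.

(** A column further right gives a 2143 pattern; one further left loses one of the [l] dots of the
    cell ([i.+1], [x.+1]). The dot of [x] is among these unless it lies in row [i], whence the
    correction. *)
Lemma essential_pivot p q : essential u v p q -> i.+2 <= p -> SW p q = l -> 0 < l ->
  q = x.+1 - (v x == i).
Proof.
move=> e ip sw l0; case/and5P: (e) => p0 q0 c1 c2 /andP[c3 c4].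
have qx : q <= x.+1.
  rewrite leqNgt; apply/negP => xq.
  have uq : u i.+1 < q.-1.
    rewrite ltn_neqAle; apply/andP; split.
      by apply/eqP => e1; move: c2; rewrite -e1 uK; lia.
    rewrite leqNgt; apply/negP => qu; have := x_max _ qu; lia.
  have h : SW p (u i.+1) < SW i.+1 (u i.+1).
    rewrite SW_mid_pivot -sw; apply: leq_trans (_ : SW p q.-1.+1 <= _); last by rewrite prednK.
    by rewrite crossSp c2; have := cross_le_p v p (ltnW uq); lia.
  have [j jp uj] := SW_lt uK vK (ltnW ip) h.
  apply: (@vex i.+1 j p.-1 (v q.-1)) => //; rewrite ?vK //; try lia.
  - rewrite ltn_neqAle; apply/andP; split; last by lia.
    by apply/eqP => e1; move: uj; rewrite -e1 ltnn.
  - rewrite ltn_neqAle; apply/andP; split; last by lia.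
    by apply/eqP => e1; move: uj; rewrite e1; lia.
have [vxi|vxi] := eqVneq (v x) i; last first.
  rewrite subn0; apply/eqP; rewrite eqn_leq qx /= ltnNge; apply/negP => qx'.
  have vx1 : i < v x by rewrite ltn_neqAle eq_sym vxi.
  have := cross_le_p v p qx'; have := cross_ge_q vK uK x (ltnW ip).
  by have := crossSp v x i.+1; rewrite -/l vx1 sw; lia.
have xE : x = u i by rewrite -vxi vK.
rewrite subn1 /=; apply/eqP; rewrite eqn_leq; apply/andP; split.
  rewrite leqNgt; apply/negP => xq; have {xq qx} qE : q = x.+1 by lia.
  by move: c2; rewrite qE /= vxi; lia.
(* Here [x] = [u i]. The first alternative contradicts the choice of [x]; in the second, the dot of
   column [q] lies below row [i] and is lost. *)
rewrite leqNgt; apply/negP => qx'; case: code_alt => [[z [z1 z2 z3]]|dec].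
  by have := x_max (t := z); rewrite xE => /(_ z1 z2); lia.
have vq : i < v q.
  rewrite ltnNge leq_eqVlt; apply/negP => /predU1P[e1|h].
    by move: qx'; rewrite xE -e1 vK ltnn.
  by have := dec _ h; rewrite vK -xE; lia.
have := cross_le_p v i.+1 qx'; have := cross_ge_q vK uK q (ltnW ip).
have := cross_le_p v i.+1 (leqnSn x); rewrite -/l sw crossSp vq.
by lia.
Qed.

Lemma between_pos t : u i < t -> t <= x -> i.+1 < v t.
Proof.
move=> ut tx; have ti : v t != i by apply/eqP => e; move: ut; rewrite -e vK ltnn.
have ti1 : v t != i.+1.
  by apply/eqP => e; move: (leq_ltn_trans tx x_lt); rewrite -e vK ltnn.
suff : i <= v t by lia.
rewrite leqNgt; apply/negP => vt.
have tx' : t < x by rewrite ltn_neqAle tx andbT; apply/eqP => e; move: vt; rewrite e; lia.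
by apply: (no132 vt (leqnn i) x_lt vx); rewrite vK.
Qed.

Lemma NE_between q : u i < q -> q <= x -> NE i q = a.
Proof.
move=> uq qx; rewrite -NE_above_pivot; apply/eqP; rewrite eqn_leq.
rewrite (cross_ge_q uK vK i (leqW qx)) andbT leqNgt; apply/negP => h.
have := NE_SW uK vK i q; have := NE_SW uK vK i x.+1 => h1 h2.
suff : SW i q + (x.+1 - q) <= SW i x.+1 by lia.
have H t (ut : u i < t) (tx : t <= x) : i <= v t by have := between_pos ut tx; lia.
have : forall d, q + d <= x.+1 -> SW i q + d <= SW i (q + d).
  elim=> [|d IH] qd; first by rewrite !addn0.
  rewrite !addnS crossSp H ?addn1 ?ltnS; [|lia|lia].
  by apply: IH; lia.
by move/(_ (x.+1 - q)); rewrite subnKC; [apply|]; lia.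
Qed.

(** Only the rectangles at [p] = [i.+1] change. If [q] lies between the swapped values, the new
    rectangle exceeds those of ([i], [q]) and ([i.+2], [q]) by one box, which lies in the rectangle
    of the pivot cell. *)
Lemma in_shape_step k c : in_shape u' v' k c <-> in_shape u v k c \/ (k <= a /\ c <= l).
Proof.
split; last first.
  case=> [[p [q [h1 h2]]]|[ka cl]]; last first.
    by exists i.+1, x.+1; rewrite NE_step_pivot SW_step_pivot !ltnS.
  have [e|pi] := eqVneq p i.+1; last by exists p, q; rewrite NE_step_other ?SW_step_other.
  rewrite e in h1 h2.
  have [m1 m2] := mid_le q.
  by exists i.+1, q; split; [exact: leq_trans h1 m1|exact: leq_trans h2 m2].
case=> p [q [+ +]]; have [->|pi] := eqVneq p i.+1; last first.
  by rewrite NE_step_other // SW_step_other // => h1 h2; left; exists p, q.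
rewrite NE_step => h1 h2; have E := SW_step q; have E' := SWS i q.
have E2 := crossSp u i q; have E3 := crossSp u i.+1 q; have E4 := SWS i.+1 q.
have [qu|uq] := leqP q (u i).
  left; exists i.+1, q; move: E E' E2 h1 h2; clear -qu asc; lia.
have [qu|uq'] := leqP q (u i.+1); last first.
  by left; exists i.+1, q; move: E E' E2 h1 h2; clear -uq uq' asc; lia.
have {}E' : SW i q = SW i.+1 q + 1 by rewrite E' uq.
have {}E3 : NE i.+2 q = NE i.+1 q + 1 by rewrite E3 qu.
move: E E2 E4 h1 h2; rewrite qu [u i.+1 < q]ltnNge qu [q <= u i]leqNgt uq /= => E E2 E4 h1 h2.
have [h3|h3] := ltnP k (NE i q); first by left; exists i, q; lia.
have [h4|h4] := ltnP c (SW i.+1 q); first by left; exists i.+2, q; lia.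
right; have [qx|xq] := leqP q x.
  have := NE_between uq qx; have := cross_le_p v i.+1 (leqW qx); rewrite -/l; lia.
have := cross_ge_q uK vK i xq; rewrite NE_above_pivot.
have := cross_le_p v i.+1 qu; rewrite SW_mid_pivot; lia.
Qed.

Lemma in_shape_row c : c < l -> in_shape u v a c.
Proof. by move=> cl; exists i.+2, x.+1; rewrite NE_below_pivot SW_below_pivot. Qed.

Lemma in_shape_prev_row : 0 < a -> in_shape u v a.-1 l.
Proof.
by move=> a0; exists i, x.+1; rewrite NE_above_pivot SW_above_pivot prednK.
Qed.

Lemma not_in_shape : ~ in_shape u v a l.
Proof.
case=> p [q [h1 h2]].
have [p' [q' [e k1 k2]]] := essential_exists uK vK u_ge (leq_ltn_trans (leq0n _) h1) (leq_ltn_trans (leq0n _) h2).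
have := essential_below e (leq_trans h1 k1); have := essential_above_SW e (leq_trans h2 k2).
by lia.
Qed.

Lemma diagram_step_row q :
  (q < u' i) && (i < v' q) = (q == u i) + ((q < u i.+1) && (i.+1 < v q)) :> nat.
Proof.
have Ei : (q == u i) = (v q == i) by apply/eqP/eqP => [->|<-]; rewrite ?uK ?vK.
have Ei1 : v q = i.+1 -> q = u i.+1 by move=> <-; rewrite vK.
rewrite ?u'E ?v'E adj_swapL Ei /adj_swap.
case: (v q =P i) => [e|ne] /=.
  by have -> : q = u i; [rewrite -e vK|rewrite asc ltnSn uK; lia].
by case: (v q =P i.+1) => [/Ei1 e|ne1] /=; lia.
Qed.

Lemma diagram_step_next_row q :
  (q < u' i.+1) && (i.+1 < v' q) = (q < u i) && (i < v q).
Proof.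
rewrite ?u'E ?v'E adj_swapR /adj_swap.
have Ei1 : v q = i.+1 -> q = u i.+1 by move=> <-; rewrite vK.
case: (v q =P i) => [e|ne] /=; first by lia.
by case: (v q =P i.+1) => [/Ei1 e|ne1] /=; have := asc; lia.
Qed.

Lemma diagram_rows q :
  (q < u i.+1) && (i.+1 < v q) = ((q < u i) && (i < v q)) + (u i < q <= x) :> nat.
Proof.
have Ei1 : v q = i.+1 -> q = u i.+1 by move=> <-; rewrite vK.
have Ei : v q = i -> q = u i by move=> <-; rewrite vK.
have := between_pos (t := q); have := x_max (t := q); have := asc.
case: (ltngtP q (u i)) => [qu|uq|->]; last by rewrite uK; lia.
  by have := ui_le_x; case: (v q =P i) => [/Ei|]; case: (v q =P i.+1) => [/Ei1|]; lia.
by case: (leqP q x) => qx h1 h2 h3; have := x_lt; lia.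
Qed.

(** Row [i.+1] exceeds row [i] by the columns after [u i] up to [x]. The swap moves these cells up
    one row and adds the cell ([i], [u i]). As ([i], [q]) and ([i.+1], [q.+1]) share a diagonal, the
    changes telescope to one cell on the diagonal of ([i], [x]). *)
Lemma diagram_count_step s t : i.+1 < n ->
  diagram_count n u' v' s t = diagram_count n u v s t + (x + s == i + t).
Proof.
move=> i1n; rewrite /diagram_count.
have split_rows (G : nat -> nat) : \sum_(0 <= p < n) G p =
    \sum_(0 <= p < i) G p + (G i + G i.+1 + \sum_(i.+2 <= p < n) G p).
  rewrite (big_cat_nat (leq0n i) (ltnW (ltnW i1n))) /=; congr addn.
  by rewrite big_ltn ?(ltnW i1n) // big_ltn // addnA.
rewrite (split_rows (fun p => \sum_(0 <= q < n) [&& q < u' p, p < v' q & q + s == p + t])).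
rewrite (split_rows (fun p => \sum_(0 <= q < n) [&& q < u p, p < v q & q + s == p + t])).
have other p : p != i -> p != i.+1 ->
   \sum_(0 <= q < n) [&& q < u' p, p < v' q & q + s == p + t] =
   \sum_(0 <= q < n) [&& q < u p, p < v q & q + s == p + t].
  move=> pi pi1; apply: eq_bigr => q _; rewrite ?u'E (adj_swapD pi pi1) ?v'E /adj_swap.
  congr nat_of_bool; congr andb; congr andb.
  by move: pi pi1; do ![case: eqP => //=] => *; apply/idP/idP; lia.
have -> : \sum_(0 <= p < i) \sum_(0 <= q < n) [&& q < u' p, p < v' q & q + s == p + t]
        = \sum_(0 <= p < i) \sum_(0 <= q < n) [&& q < u p, p < v q & q + s == p + t].
  by rewrite big_nat [RHS]big_nat; apply: eq_bigr => p /andP[_ pi]; apply: other; lia.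
have -> : \sum_(i.+2 <= p < n) \sum_(0 <= q < n) [&& q < u' p, p < v' q & q + s == p + t]
        = \sum_(i.+2 <= p < n) \sum_(0 <= q < n) [&& q < u p, p < v q & q + s == p + t].
  by rewrite big_nat [RHS]big_nat; apply: eq_bigr => p /andP[pi _]; apply: other; lia.
rewrite -[RHS]addnA; congr addn; rewrite [RHS]addnAC; congr addn.
pose D q := (q < u i) && (i < v q).
have -> : \sum_(0 <= q < n) [&& q < u' i, i < v' q & q + s == i + t] =
   \sum_(0 <= q < n) ((q == u i) && (q + s == i + t)) + (\sum_(0 <= q < n) (D q && (q + s == i + t))
   + \sum_(0 <= q < n) ((u i < q <= x) && (q + s == i + t))).
  rewrite -!big_split; apply: eq_bigr => q _ /=; rewrite andbA.
  have := diagram_step_row q; rewrite diagram_rows -/(D q).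
  by case: (_ && (i < v' q)); case: (D q); case: (u i < q <= x); case: (q == u i);
    case: (q + s == i + t).
have -> : \sum_(0 <= q < n) [&& q < u' i.+1, i.+1 < v' q & q + s == i.+1 + t] =
   \sum_(0 <= q < n) (D q && (q + s == i.+1 + t)).
  by apply: eq_bigr => q _; rewrite andbA diagram_step_next_row.
have -> : \sum_(0 <= q < n) [&& q < u i, i < v q & q + s == i + t] =
   \sum_(0 <= q < n) (D q && (q + s == i + t)).
  by apply: eq_bigr => q _; rewrite andbA.
have -> : \sum_(0 <= q < n) [&& q < u i.+1, i.+1 < v q & q + s == i.+1 + t] =
   \sum_(0 <= q < n) (D q && (q + s == i.+1 + t))
   + \sum_(0 <= q < n) ((u i < q <= x) && (q + s == i.+1 + t)).
  rewrite -big_split; apply: eq_bigr => q _ /=; rewrite andbA.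
  have := diagram_rows q; rewrite -/(D q).
  by case: (_ && (i.+1 < v q)); case: (D q); case: (u i < q <= x);
    case: (q + s == i.+1 + t).
have xn : x < n by apply: ltn_trans x_lt (perm_lt uK u_ge i1n).
have uix := ui_le_x.
have range (g : pred nat) : \sum_(0 <= q < n) ((u i < q <= x) && g q) = \sum_((u i).+1 <= q < x.+1) g q.
  rewrite (big_cat_nat (leq0n (u i).+1)) //=; last exact: leq_ltn_trans uix xn.
  rewrite (@big_cat_nat _ _ _ x.+1 (u i).+1 n) //= big1_seq ?add0n; last first.
    by move=> q; rewrite mem_index_iota => h; case: ltnP => //=; lia.
  rewrite [X in _ + X]big1_seq ?addn0; last first.
    move=> q; rewrite mem_index_iota => h; have -> : (q <= x) = false by lia.
    by rewrite andbF.
  by rewrite big_nat [RHS]big_nat; apply: eq_bigr => q; rewrite ltnS => ->.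
rewrite !range.
have -> : \sum_(0 <= q < n) ((q == u i) && (q + s == i + t)) = (u i + s == i + t).
  have uin : u i < n := leq_ltn_trans uix xn.
  rewrite (bigD1_seq (u i)) ?mem_index_iota ?iota_uniq //= eqxx big1 ?addn0 //.
  by move=> q /negbTE ->.
have tele d : (u i + s == i + t) + \sum_((u i).+1 <= q < (u i + d).+1) (q + s == i + t) =
   \sum_((u i).+1 <= q < (u i + d).+1) (q + s == i.+1 + t) + (u i + d + s == i + t).
  elim: d => [|d IH]; first by rewrite addn0 !big_geq //; lia.
  have E : ((u i + d).+1 + s == i.+1 + t) = (u i + d + s == i + t) by rewrite !addSn eqSS.
  have le : (u i).+1 <= (u i + d).+1 by rewrite ltnS leq_addr.
  by rewrite addnS (big_nat_recr _ _ _ le) /= (big_nat_recr _ _ _ le) /= E; lia.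
by have := tele (x - u i); rewrite subnKC //; lia.
Qed.

Section FlagStep.
Variables la f : nat -> nat.
Hypothesis F : flag_data u v la f.
Let shapeE := flag_shape F.
Let e : nat := v x == i.

(* The rows of length [l] from row [a] on have the flags forced by the essential cell
   at their last row, which lies in column [x.+1 - e]. *)
Definition block_flag j := if (a < j) && (la j == l) then i.+2 - e + (j - a) else f j.
Definition set_flag c j := if j == a then c else block_flag j.
Definition add_box j := la j + (j == a).

Lemma e_le1 : e <= 1. Proof. exact: leq_b1. Qed.

Lemma shape_pivot_row : la a = l.
Proof.
apply/eqP; rewrite eqn_leq; apply/andP; split.
  rewrite leqNgt; apply/negP => /shapeE; exact: not_in_shape.
by case E : l => [//|c]; apply/shapeE/in_shape_row; rewrite E.
Qed.

Lemma shape_prev_row : 0 < a -> l < la a.-1.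
Proof. by move=> a0; apply/shapeE/in_shape_prev_row. Qed.

Lemma flag_le j k : j <= k -> f j <= f k.
Proof.
by move/subnKC <-; elim: (k - j) => [|d IH]; rewrite ?addn0 // addnS (leq_trans IH) ?(flag_mono F).
Qed.

(** [essential_pivot] gives the column of the essential cell, and [NE_SW] then gives its row. *)
Lemma block_corner k : a <= k -> la k = l -> la k.+1 < la k -> f k = i.+2 - e + (k - a) /\ i.+2 <= f k.
Proof.
move=> ak lk ck; have [p [q [ne sw ->]]] := flag_corner F ck.
have es := corner_essential uK vK shapeE ck ne sw.
have ip : i.+2 <= p by apply: (essential_below es); rewrite ne.
have l0 : 0 < l by rewrite -lk; lia.
have qE := essential_pivot es ip (etrans sw lk) l0.
have := NE_SW uK vK p q; have := NE_SW uK vK i.+1 x.+1; have := e_le1.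
rewrite -/e in qE; rewrite -/a -/l ne sw lk; lia.
Qed.

Lemma flag_above j : j < a -> f j <= i.
Proof.
move=> ja; have a0 : 0 < a by lia.
have ck : la a.-1.+1 < la a.-1 by rewrite prednK // shape_pivot_row shape_prev_row.
have [p [q [ne sw fE]]] := flag_corner F ck.
have es := corner_essential uK vK shapeE ck ne sw.
apply: leq_trans (essential_above_SW es _); last by rewrite sw shape_prev_row.
by rewrite -fE; apply: flag_le; lia.
Qed.

(** The new box makes rows [a.-1] and [a] equally long; [flag_step] then requires this bound, as row
    [a] has flag [i.+1]. *)
Lemma flag_prev_row : 0 < a -> la a.-1 = l.+1 -> i <= f a.-1.
Proof.
move=> a0 lE.
have ck : la a.-1.+1 < la a.-1 by rewrite prednK // shape_pivot_row shape_prev_row.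
have [p [q [ne sw ->]]] := flag_corner F ck.
have es := corner_essential uK vK shapeE ck ne sw.
have pi : p <= i by apply: (essential_above_SW es); rewrite sw shape_prev_row.
have := essential_above es pi.
have := NE_SW uK vK p q; have := NE_SW uK vK i.+1 x.+1.
by rewrite -/a -/l ne sw lE; lia.
Qed.

Lemma block_flag_above j : j < a -> block_flag j <= i.
Proof. by move=> ja; rewrite /block_flag ltnNge (ltnW ja) flag_above. Qed.

Lemma block_flag_below j : a < j -> i.+2 <= block_flag j.
Proof.
move=> aj; rewrite /block_flag aj /=; case: eqP => lj; first by have := e_le1; lia.
have lel : la j <= l by rewrite -shape_pivot_row; apply: (shape_le shapeE); exact: ltnW.
have l0 : 0 < la a by rewrite shape_pivot_row; lia.
have [k ak [lk ck]] := shape_corner uK vK u_ge shapeE l0.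
have [_ fk] := block_corner ak (etrans lk shape_pivot_row) ck.
apply: leq_trans fk (flag_le _); rewrite leqNgt; apply/negP => jk.
have := shape_le shapeE (ltnW jk); rewrite lk shape_pivot_row; lia.
Qed.

Lemma block_flag_mono j : a < j -> block_flag j <= block_flag j.+1.
Proof.
move=> aj; rewrite /block_flag aj (ltn_trans aj) //=.
have lel k : a < k -> la k <= l.
  by move=> ak; rewrite -shape_pivot_row; apply: (shape_le shapeE); exact: ltnW.
have := lel _ aj; have := shape_antitone shapeE j => h1 h2.
case: eqP => e1; case: eqP => e2; [by lia| |by lia|exact: (flag_mono F)].
have ck : la j.+1 < la j by lia.
have [<- _] := block_corner (ltnW aj) e1 ck; exact: (flag_mono F).
Qed.

(** The two flaggings can differ only inside the block of rows of length [l], above its last row, so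
    [tab_sum_flag_change] applies. *)
Lemma flag_change_pivot j : 0 < la j -> f j = set_flag i.+2 j \/
  [/\ la j.+1 = la j, f j.+1 <= (f j).+1 & set_flag i.+2 j.+1 <= (set_flag i.+2 j).+1].
Proof.
move=> lj; have := shape_antitone shapeE j; rewrite leq_eqVlt => /predU1P[le|ck]; last first.
  left; rewrite /set_flag /block_flag; case: (j =P a) => [ja|ja].
    have lja : la j = l by rewrite ja shape_pivot_row.
    have aj : a <= j by rewrite ja.
    by have := block_corner aj lja ck; have := e_le1; lia.
  case: ifP => // /andP[aj /eqP lj'].
  by have [] := block_corner (ltnW aj) lj' ck.
have [ja|aj] := ltnP j a.
  by left; rewrite /set_flag /block_flag ltn_eqF // ltnNge (ltnW ja).
have [le'|nl] := eqVneq (la j) l; last first.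
  left; rewrite /set_flag /block_flag (negbTE nl) andbF.
  by case: eqP => // ja; move: nl; rewrite ja shape_pivot_row eqxx.
right; split => //; first by apply: (flag_step F); rewrite le.
rewrite /set_flag /block_flag gtn_eqF ?ltnS // le le' eqxx andbT aj /=.
have := e_le1; case: (j =P a) => ja; first by lia.
by have -> : a < j by [lia]; rewrite /=; lia.
Qed.

Lemma add_box_shape k c : c < add_box k <-> in_shape u' v' k c.
Proof.
split.
  rewrite /add_box => h; apply/in_shape_step; case: (ltnP c (la k)) => ck.
    by left; apply/shapeE.
  by right; move: h ck; case: (k =P a) => [->|_]; rewrite ?shape_pivot_row; lia.
case/in_shape_step => [/shapeE h|[ka cl]]; rewrite /add_box; first exact: ltn_addr.
move: ka; rewrite leq_eqVlt => /predU1P[->|ka].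
  by rewrite eqxx shape_pivot_row addn1.
have a0 : 0 < a by lia.
have kp : k <= a.-1 by lia.
by have := shape_le shapeE kp; have := shape_prev_row a0; lia.
Qed.

Lemma shape_count_step N s t : n <= N -> i.+1 < n ->
  shape_count N add_box s t = shape_count N la s t + (x + s == i + t).
Proof.
move=> nN i1n.
have aN : a < N by have := cross_le u i x.+1; rewrite NE_above_pivot; lia.
have lN : l < N.
  by have := cross_le v x.+1 i.+1; have := perm_lt uK u_ge i1n; rewrite -/l; lia.
have -> : (x + s == i + t) = (l + s == a + t).
  by have := NE_SW uK vK i.+1 x.+1; rewrite -/a -/l; lia.
rewrite /shape_count -[X in _ + X]mul1n -(sum_pair_indicator aN lN) big_distrl -big_split /=.
apply: eq_bigr => p _; rewrite big_distrl -big_split /=; apply: eq_bigr => q _.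
rewrite /add_box; case: (p =P a) => [->|_]; last by rewrite addn0 mul0n addn0.
rewrite shape_pivot_row addn1 ltnS leq_eqVlt.
case: (q =P l) => [->|_] /=; last by rewrite mul0n addn0.
by rewrite ltnn mul1n.
Qed.

Lemma flag_data_step : flag_data u' v' add_box (set_flag i.+1).
Proof.
split; first exact: add_box_shape.
- move=> j; rewrite /set_flag; case: (j =P a) => [->|/eqP ja].
    by rewrite gtn_eqF // ltnW // block_flag_below.
  case: (j.+1 =P a) => [ja'|/eqP ja'].
    by apply: leqW; apply: block_flag_above; rewrite -ja'.
  have [ja2|ja2] := ltnP j a; last by apply: block_flag_mono; rewrite ltn_neqAle eq_sym ja.
  have ja3 : j.+1 < a by rewrite ltn_neqAle ja'.
  have [h1 h2] : (a < j) = false /\ (a < j.+1) = false by lia.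
  by rewrite /block_flag h1 h2; exact: (flag_mono F).
- move=> k; rewrite /add_box /set_flag; case: (k =P a) => [->|/eqP ka] ck.
    exists i.+1, x.+1; split=> //; first exact: NE_step_pivot.
    by rewrite SW_step_pivot shape_pivot_row addn1.
  rewrite addn0 in ck *; have ck' : la k.+1 < la k by apply: leq_ltn_trans ck; exact: leq_addr.
  have [p [q [ne sw fE]]] := flag_corner F ck'.
  have pi := essential_neq (corner_essential uK vK shapeE ck' ne sw).
  exists p, q; rewrite NE_step_other // SW_step_other //; split => //.
  rewrite /block_flag; case: ifP => // /andP[ak /eqP lk].
  by have [<-] := block_corner (ltnW ak) lk ck'.
- move=> k; rewrite /add_box /set_flag; case: (k =P a) => [->|/eqP ka].
    rewrite gtn_eqF // addn0 shape_pivot_row addn1 => _ lE.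
    by have := shape_antitone shapeE a; rewrite shape_pivot_row; lia.
  rewrite addn0; case: (k.+1 =P a) => [ka'|/eqP ka'].
    rewrite ka' shape_pivot_row addn1 => _ lE.
    have a0 : 0 < a by rewrite -ka'.
    have kE : k = a.-1 by rewrite -ka'.
    have h1 : (a < k) = false by lia.
    rewrite /block_flag h1 /= ltnS kE; apply: flag_prev_row => //.
    by rewrite -kE.
  rewrite addn0 => l0 lE; have [ka2|ak] := ltnP k a.
    have ka3 : k.+1 < a by rewrite ltn_neqAle ka'.
    have [h1 h2] : (a < k) = false /\ (a < k.+1) = false by lia.
    by rewrite /block_flag h1 h2; exact: (flag_step F).
  have {}ak : a < k by rewrite ltn_neqAle eq_sym ka.
  rewrite /block_flag ak (ltn_trans ak) //= lE; case: eqP => lk; last exact: (flag_step F).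
  lia.
Qed.
End FlagStep.
End GoodAscent.

(** The last clause leads from the longer permutation back to [u], the direction of the
    induction. *)
Lemma ascent_step i0 : i0.+1 < n -> u i0 < u i0.+1 ->
  exists i, [/\ i.+1 < n, u i < u i.+1 &
  forall u' v' : nat -> nat, (forall j : nat, u' j = u (adj_swap i j)) ->
    (forall t, v' t = adj_swap i (v t)) ->
  no2143 u' /\ forall la f, flag_data u v la f -> exists (a : nat) (g : nat -> nat),
  [/\ flag_data u' v' (fun j => la j + (j == a)) (fun j => if j == a then i.+1 else g j),
      forall j, j < a -> g j <= i,
      forall j, a < j -> i.+1 < g j,
      forall j, 0 < la j -> f j = (if j == a then i.+2 else g j) \/
        [/\ la j.+1 = la j, f j.+1 <= (f j).+1 &
            (if j.+1 == a then i.+2 else g j.+1) <= (if j == a then i.+2 else g j).+1] &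
      forall N s t, n <= N ->
        diagram_count n u' v' s t = shape_count N (fun j => la j + (j == a)) s t ->
        diagram_count n u v s t = shape_count N la s t]].
Proof.
move=> i0n asc0; have [i i1n [asc cm no alt]] := good_ascent_exists i0n asc0.
have exP : exists t, (t < u i.+1) && (i <= v t) by exists (u i); rewrite asc uK leqnn.
have Pb t : (t < u i.+1) && (i <= v t) -> t <= u i.+1 by case/andP => /ltnW.
case: (ex_maxnP exP Pb) => x /andP[x_lt vx] xm.
have x_max t : x < t -> t < u i.+1 -> v t < i.
  by move=> xt tu; rewrite ltnNge; apply/negP => h; have := xm t; rewrite tu h; lia.
exists i; split=> // u' v' u'E v'E.
split; first exact: (no2143_step asc cm no x_lt vx u'E).
move=> la f F; exists (cross u i.+1 x.+1), (block_flag i x la f); split.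
- exact: (flag_data_step asc cm no alt x_lt vx x_max u'E v'E F).
- move=> j; exact: (block_flag_above asc cm no x_lt vx x_max F).
- move=> j; exact: (block_flag_below asc cm no alt x_lt vx x_max F).
- move=> j; exact: (flag_change_pivot asc cm no alt x_lt vx x_max F).
- move=> N s t nN.
  have := diagram_count_step asc no x_lt vx x_max u'E v'E s t i1n.
  have := shape_count_step asc cm no x_lt vx x_max F s t nN i1n.
  by rewrite /add_box => -> -> /addIn.
Qed.
End AscentStep.

(** * Grothendieck polynomials and ascents *)

Section PermNat.
Variable n : nat.
Implicit Types (w : 'S_n) (i : 'I_n.-1).

Definition perm_nat w (j : nat) : nat := if insub j is Some o then w o : nat else j.

Lemma perm_natE w (o : 'I_n) : perm_nat w o = w o.
Proof. by rewrite /perm_nat valK. Qed.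

Lemma perm_nat_ge w j : n <= j -> perm_nat w j = j.
Proof. by move=> nj; rewrite /perm_nat insubN // -leqNgt. Qed.

Lemma perm_natK w : cancel (perm_nat w) (perm_nat w^-1).
Proof.
move=> j; have [jn|nj] := ltnP j n; last by rewrite !perm_nat_ge.
by rewrite (perm_natE w (Ordinal jn)) perm_natE permK.
Qed.

Lemma perm_natVK w : cancel (perm_nat w^-1) (perm_nat w).
Proof. by move=> j; rewrite -{1}(invgK w) perm_natK. Qed.

Lemma stransp_adj_swap i (o : 'I_n) : stransp i o = adj_swap i o :> nat.
Proof.
rewrite /stransp /adj_swap; case: tpermP => [->|->|/eqP + /eqP]; rewrite /= ?eqxx //.
  by rewrite gtn_eqF.
by rewrite -!val_eqE /= => /negbTE -> /negbTE ->.
Qed.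

Lemma perm_nat_stransp i w j : perm_nat (stransp i * w) j = perm_nat w (adj_swap i j).
Proof.
have [jn|nj] := ltnP j n.
  by rewrite (perm_natE _ (Ordinal jn)) permM -perm_natE stransp_adj_swap.
have ni := ltn_ord i; rewrite perm_nat_ge // adj_swapD ?perm_nat_ge //; lia.
Qed.

Lemma perm_natV_stransp i w t :
  perm_nat (stransp i * w)^-1 t = adj_swap i (perm_nat w^-1 t).
Proof.
rewrite -{1}(perm_natVK w t) -{1}(adj_swapK i (perm_nat w^-1 t)).
by rewrite -perm_nat_stransp perm_natK.
Qed.

Lemma perm_nat_inj w w' : perm_nat w =1 perm_nat w' -> w = w'.
Proof. by move=> E; apply/permP => o; apply: val_inj; rewrite /= -!perm_natE E. Qed.

Lemma vexillary_no2143 w : vexillary w -> no2143 (perm_nat w).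
Proof.
move=> vx a b c d ab bc cd h1 h2 h3; have dn : d < n.
  rewrite ltnNge; apply/negP => nd; rewrite (perm_nat_ge w nd) in h2 h3.
  have : perm_nat w^-1 (perm_nat w c) = perm_nat w c by apply: perm_nat_ge; lia.
  by rewrite perm_natK => e; lia.
have [an [bn cn]] : a < n /\ b < n /\ c < n by lia.
apply: vx; exists (Ordinal an), (Ordinal bn), (Ordinal cn), (Ordinal dn).
by split=> //; split; rewrite -!perm_natE.
Qed.

Definition ascent w i := perm_nat w i < perm_nat w i.+1.

Lemma len_code w :
  len w = \sum_(0 <= j < n) code (perm_nat w) (perm_nat w^-1) j.
Proof.
rewrite /len -sum1_card big_mkcond big_mkord.
transitivity (\sum_(a < n) \sum_(b < n) ((a < b) && (w b < w a)) : nat).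
  rewrite pair_bigA /=; apply: eq_bigr => -[a b] _ /=.
  by rewrite inE /=; case: ifP.
apply: eq_bigr => a _; rewrite (reindex_inj (@perm_inj _ w^-1%g)) /=.
rewrite /code /cross perm_natE (big_mkord xpredT (fun t => (a <= perm_nat w^-1 t) : nat)).
rewrite (big_ord_widen n (fun t => (a <= perm_nat w^-1 t) : nat)) ?(ltnW (ltn_ord _)) //.
rewrite [RHS]big_mkcond; apply: eq_bigr => t _; rewrite permKV perm_natE.
case: ifP => tw; rewrite ?andbF // andbT ltn_neqAle; congr nat_of_bool.
case: eqP => // e; have : w a = t by rewrite (val_inj e : a = _) permKV.
by move=> wat; rewrite wat ltnn in tw.
Qed.

Lemma len_ascent w i : ascent w i -> len (stransp i * w) = (len w).+1.
Proof.
move=> asc; have ni := ltn_ord i; rewrite !len_code.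
apply: (sum_code_step (perm_natK w) (perm_natVK w) (perm_nat_stransp i w)
  (perm_natV_stransp i w)) => //; lia.
Qed.

Lemma stranspK i w : (stransp i * (stransp i * w) = w)%g.
Proof. by rewrite mulgA tperm2 mul1g. Qed.

Lemma ascent_stransp i w : ascent (stransp i * w)%g i = ~~ ascent w i.
Proof.
rewrite /ascent !perm_nat_stransp adj_swapL adj_swapR -leqNgt [RHS]leq_eqVlt.
by rewrite (inj_eq (can_inj (perm_natK w))) gtn_eqF.
Qed.

Lemma len_ascentE w i : (len (stransp i * w) == (len w).+1) = ascent w i.
Proof.
apply/eqP/idP => [E|/len_ascent//]; apply/negPn/negP; rewrite -ascent_stransp.
by move=> /len_ascent; rewrite stranspK E; lia.
Qed.

Lemma ascent_exists w : w != w0 n -> exists i, ascent w i.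
Proof.
move=> ww0; apply/existsP; apply: contraR ww0; rewrite negb_exists => /forallP noasc.
have desc j : j.+1 < n -> perm_nat w j.+1 < perm_nat w j.
  move=> j1; have jn : j < n.-1 by lia.
  have := noasc (Ordinal jn); rewrite /ascent /= -leqNgt leq_eqVlt => /predU1P[|//].
  by move/(can_inj (perm_natK w)) => /eqP; rewrite gtn_eqF.
apply/eqP/permP => o; apply: val_inj; rewrite permE /= -perm_natE.
have up d : d < n -> d <= perm_nat w (n - d.+1).
  elim: d => // d IH dn; have := IH (ltnW dn); have := desc (n - d.+2).
  by have -> : (n - d.+2).+1 = n - d.+1 by [lia]; lia.
have down j : j < n -> perm_nat w j + j < n.
  elim: j => [|j IH] jn; last by have := IH (ltnW jn); have := desc j jn; lia.
  by rewrite addn0 (perm_natE w (Ordinal jn)).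
have := down o (ltn_ord o); have := up (n - o.+1); have := ltn_ord o => on.
have -> : n - (n - o.+1).+1 = o by lia.
lia.
Qed.

Lemma not_ascent_w0 i : ~~ ascent (w0 n) i.
Proof.
have E := perm_natE (w0 n); have ni := ltn_ord i.
rewrite /ascent (E (ordL i)) (E (ordR i)) !permE /=; lia.
Qed.

Lemma len_ind (P : 'S_n -> Prop) :
  (forall w, (forall v, len w < len v -> P v) -> P w) -> forall w, P w.
Proof.
move=> H w; have len_max (v : 'S_n) : len v <= #|[set: 'I_n * 'I_n]|.
  by exact: subset_leq_card (subsetT _).
have [d] : exists d, #|[set: 'I_n * 'I_n]| - len w < d by exists (#|[set: 'I_n * 'I_n]| - len w).+1.
elim: d w => // d IH w wd; apply: H => v wv; apply: IH.
by have := len_max v; lia.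
Qed.

Lemma len_lt_w0 w : w != w0 n -> len w < len (w0 n).
Proof.
elim/len_ind: w => w IH ww0; have [i asc] := ascent_exists ww0.
rewrite -ltnS -(len_ascent asc) ltnS.
have [->//|] := eqVneq (stransp i * w)%g (w0 n).
by move/IH; rewrite len_ascent // => /(_ (ltnSn _))/ltnW.
Qed.

(** Each step raises the length by one, and only [w0] has maximal length. *)
Lemma groth_rec_fuel w k k' : len (w0 n) <= len w + k -> len (w0 n) <= len w + k' ->
  groth_rec k w = groth_rec k' w.
Proof.
have top v : len (w0 n) <= len v -> v = w0 n.
  by move=> h; apply/eqP; apply: contraLR h => /len_lt_w0; rewrite ltnNge.
have rec_w0 m : groth_rec m (w0 n) = groth_top n by case: m => [|m] /=; rewrite eqxx.
elim: k k' w => [|k IH] k' w h h'; first by rewrite addn0 in h; rewrite (top w h) !rec_w0.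
case: k' h' => [|k'] h'; first by rewrite addn0 in h'; rewrite (top w h') !rec_w0.
rewrite /=; case: (w == w0 n); first by [].
case: pickP => [i|_]; last by [].
rewrite len_ascentE => asc; congr (pi_op i _).
by apply: IH; rewrite len_ascent //; lia.
Qed.

Lemma groth_w0 : groth (w0 n) = groth_top n.
Proof. by rewrite /groth; case: (len _) => [|k] /=; rewrite eqxx. Qed.

Lemma groth_some_ascent w : w != w0 n ->
  exists2 i, ascent w i & groth w = pi_op i (groth (stransp i * w)%g).
Proof.
move=> ww0; have lt := len_lt_w0 ww0.
rewrite {2}/groth; have -> : groth w = groth_rec (len (w0 n)).+1 w.
  by apply: groth_rec_fuel; lia.
rewrite /= (negbTE ww0); case: pickP => [i|no].
  by rewrite len_ascentE => asc; exists i.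
by have [i] := ascent_exists ww0; rewrite -len_ascentE no.
Qed.

Local Open Scope ring_scope.

Definition mvar (k : 'I_n) : {mpoly Zbeta[n]} := 'X_k.
Definition mvar_act (s : 'S_n) : {rmorphism {mpoly Zbeta[n]} -> {mpoly Zbeta[n]}} := msym s.

Lemma mvar_neq (a c : 'I_n) : a != c -> mvar a - mvar c != 0.
Proof.
move=> ab; apply/eqP => /(congr1 (fun p => p@_(U_(a)%MM))).
rewrite mcoeffB !mcoeffXU eqxx mcoeff0 eq_sym (negbTE ab) subr0 => /eqP.
by rewrite oner_eq0.
Qed.

Lemma mvar_actX s k : mvar_act s (mvar k) = mvar (s k). Proof. exact: msymXk. Qed.
Lemma mvar_act_beta s : mvar_act s beta = beta. Proof. exact: msym_beta. Qed.
Lemma mvar_act1 h : mvar_act 1%g h = h. Proof. exact: msym1m. Qed.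
Lemma mvar_actM s t h : mvar_act (s * t)%g h = mvar_act t (mvar_act s h). Proof. exact: msymMm. Qed.

Lemma mvar_pi_opE i (h : {mpoly Zbeta[n]}) : (mvar (ordL i) - mvar (ordR i)) * pi_op i h =
  (1 + beta * mvar (ordR i)) * h - (1 + beta * mvar (ordL i)) * mvar_act (stransp i) h.
Proof. exact: pi_opE. Qed.

Lemma pi_op_comm (i j : 'I_n.-1) (h : {mpoly Zbeta[n]}) : (i.+1 < j)%N ->
  pi_op i (pi_op j h) = pi_op j (pi_op i h).
Proof. exact: (pi_comm mvar_neq mvar_actX mvar_act_beta mvar_act1 mvar_actM mvar_pi_opE). Qed.

Lemma pi_op_braid (i j : 'I_n.-1) (h : {mpoly Zbeta[n]}) : i.+1 = j :> nat ->
  pi_op i (pi_op j (pi_op i h)) = pi_op j (pi_op i (pi_op j h)).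
Proof. exact: (pi_braid mvar_neq mvar_actX mvar_act_beta mvar_act1 mvar_actM mvar_pi_opE). Qed.

(** Two ascents lead to a common permutation, in two steps if they are far apart and in three if
    they are neighbours. By induction both ways may be followed, and the relations between the
    operators identify the results. *)
Lemma groth_ascent w i : ascent w i -> groth w = pi_op i (groth (stransp i * w)%g).
Proof.
move: w i; suff : forall w i, ascent w i -> groth w = pi_op i (groth (stransp i * w)%g) by [].
refine (@len_ind (fun w => forall i, ascent w i ->
  groth w = pi_op i (groth (stransp i * w)%g)) _).
move=> w IH.
have IH1 (i j : 'I_n.-1) : ascent w i -> ascent (stransp i * w)%g j ->
    groth (stransp i * w)%g = pi_op j (groth (stransp j * (stransp i * w))%g).
  by move=> asci; apply: IH; rewrite len_ascent.
have IH2 (i j k : 'I_n.-1) : ascent w i -> ascent (stransp i * w)%g j ->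
    ascent (stransp j * (stransp i * w))%g k ->
    groth (stransp j * (stransp i * w))%g =
    pi_op k (groth (stransp k * (stransp j * (stransp i * w)))%g).
  by move=> asci ascj; apply: IH; rewrite !len_ascent.
have far (i j : 'I_n.-1) : (i.+1 < j)%N -> ascent w i -> ascent w j ->
    pi_op i (groth (stransp i * w)%g) = pi_op j (groth (stransp j * w)%g).
  move=> ij asci ascj.
  have ji : ascent (stransp i * w)%g j.
    by rewrite /ascent !perm_nat_stransp !adj_swapD //; lia.
  have ij' : ascent (stransp j * w)%g i.
    by rewrite /ascent !perm_nat_stransp !adj_swapD //; lia.
  have AB : (stransp j * (stransp i * w) = stransp i * (stransp j * w))%g.
    by apply: perm_nat_inj => k; rewrite !perm_nat_stransp adj_swapC.
  have mid := congr1 (fun v => pi_op j (pi_op i (groth v))) AB.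
  exact (etrans (congr1 (pi_op i) (IH1 i j asci ji)) (etrans (pi_op_comm _ ij)
    (etrans mid (esym (congr1 (pi_op j) (IH1 j i ascj ij')))))).
have near (i j : 'I_n.-1) : i.+1 = j :> nat -> ascent w i -> ascent w j ->
    pi_op i (groth (stransp i * w)%g) = pi_op j (groth (stransp j * w)%g).
  move=> ij asci ascj; have := asci; have := ascj; rewrite /ascent -ij => aj ai.
  have sw := (perm_nat_stransp, adj_swapL, adj_swapR).
  have s1 k : (k < i)%N || (i.+1 < k)%N -> adj_swap i k = k by move=> h; rewrite adj_swapD //; lia.
  have s2 k : (k <= i)%N || (i.+2 < k)%N -> adj_swap j k = k by move=> h; rewrite adj_swapD //; lia.
  have sL : adj_swap j i.+1 = i.+2 by rewrite ij adj_swapL.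
  have sR : adj_swap j i.+2 = i.+1 by rewrite ij adj_swapR.
  have a1 : ascent (stransp i * w)%g j.
    by rewrite /ascent -ij !sw s1 ?ltnSn ?orbT //; exact: ltn_trans aj.
  have a2 : ascent (stransp j * (stransp i * w))%g i.
    by rewrite /ascent !sw s2 ?leqnn // sL adj_swapL s1 ?ltnSn ?orbT.
  have b1 : ascent (stransp j * w)%g i.
    by rewrite /ascent !sw s2 ?leqnn // sL; exact: ltn_trans aj.
  have b2 : ascent (stransp i * (stransp j * w))%g j.
    by rewrite /ascent -ij !sw s1 ?ltnSn ?orbT // s2 ?leqnn // sR.
  have AB : (stransp i * (stransp j * (stransp i * w)) =
             stransp j * (stransp i * (stransp j * w)))%g.
    by apply: perm_nat_inj => k; rewrite !perm_nat_stransp -ij adj_swap_braid.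
  have E1 := etrans (IH1 i j asci a1) (congr1 (pi_op j) (IH2 i j i asci a1 a2)).
  have E2 := etrans (IH1 j i ascj b1) (congr1 (pi_op i) (IH2 j i j ascj b1 b2)).
  have mid := congr1 (fun v => pi_op j (pi_op i (pi_op j (groth v)))) AB.
  exact (etrans (congr1 (pi_op i) E1)
    (etrans (pi_op_braid _ ij) (etrans mid (esym (congr1 (pi_op j) E2))))).
move=> i asci; have ww0 : w != w0 n by apply: contraL asci => /eqP->; exact: not_ascent_w0.
have [j ascj ->] := groth_some_ascent ww0.
case: (ltngtP i j) => [ij|ji|/val_inj->//].
  by move: ij; rewrite leq_eqVlt => /predU1P[/near->|/far->].
by move: ji; rewrite leq_eqVlt => /predU1P[/near->|/far->].
Qed.
End PermNat.

(** * Vexillary permutations *)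

Lemma sum_nat_trunc n N (F : nat -> nat) : n <= N -> (forall p, n <= p -> F p = 0) ->
  \sum_(0 <= p < N) F p = \sum_(0 <= p < n) F p.
Proof.
move=> nN F0; rewrite (big_cat_nat (leq0n n) nN) /= [X in _ + X = _]big_nat_cond.
by rewrite [X in _ + X = _]big1 ?addn0 // => p /andP[/andP[/F0]].
Qed.

Section LongestElement.
Variable n : nat.
Local Notation u := (perm_nat (w0 n)).
Local Notation v := (perm_nat (w0 n)^-1).

Lemma perm_nat_w0 j : j < n -> u j = n - j.+1.
Proof. by move=> jn; rewrite (perm_natE _ (Ordinal jn)) permE. Qed.

Lemma perm_nat_w0V j : j < n -> v j = n - j.+1.
Proof.
move=> jn; have h : n - j.+1 < n by lia.
have E : u (n - j.+1) = j by rewrite perm_nat_w0 //; lia.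
by rewrite -{1}E perm_natK.
Qed.

Lemma in_shape_w0 k c : in_shape u v k c <-> k + c.+1 < n.
Proof.
have bd p q := @cell_bound n u v (perm_natK _) (perm_natVK _) (@perm_nat_ge _ _) p q.
split=> [[p [q [h1 h2]]]|h].
  have [_ _] := bd p q (leq_ltn_trans (leq0n _) h1) (leq_ltn_trans (leq0n _) h2).
  by have := cross_le u p q; lia.
exists k.+1, c.+1; have E : cross u k.+1 c.+1 = k.+1.
  rewrite /cross big_nat (eq_bigr (fun=> 1)); last first.
    by move=> j /andP[_ jk]; rewrite perm_nat_w0; [have -> : c < n - j.+1 by lia|lia].
  by rewrite -big_nat sum_nat_const_nat subn0 muln1.
have := NE_SW (perm_natK (w0 n)) (perm_natVK (w0 n)) k.+1 c.+1.
by rewrite E; lia.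
Qed.

(** The staircase has a corner in every nonempty row, so all flags that count are forced. *)
Lemma flag_data_w0 la f : flag_data u v la f ->
  (forall j, la j = n - j.+1) /\ (forall j, j.+1 < n -> f j = j.+1).
Proof.
move=> F; have laE j : la j = n - j.+1.
  have H c : c < la j <-> j + c.+1 < n by rewrite (flag_shape F) in_shape_w0.
  apply/eqP; rewrite eqn_leq; apply/andP; split; rewrite leqNgt; apply/negP => h.
    by have /H := h; lia.
  by have : j + (la j).+1 < n by [lia]; move/H; rewrite ltnn.
split=> // j jn; have ck : la j.+1 < la j by rewrite !laE; lia.
have [p [q [ne sw ->]]] := flag_corner F ck.
have := @cell_bound n u v (perm_natK _) (perm_natVK _) (@perm_nat_ge _ _) p q.
by rewrite ne sw laE => /(_ isT); have := cross_le u p q; rewrite ne => h1 []; lia.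
Qed.

Lemma diagram_count_w0 N s t : n <= N ->
  diagram_count n u v s t = shape_count N (fun j => n - j.+1) s t.
Proof.
move=> nN; rewrite /diagram_count /shape_count.
rewrite [RHS](sum_nat_trunc nN); last first.
  move=> p np; apply: big1 => q _; have -> : (q < n - p.+1) = false by lia.
  by [].
rewrite big_nat [RHS]big_nat; apply: eq_bigr => p /andP[_ pn].
rewrite [RHS](sum_nat_trunc nN); last first.
  by move=> q nq; have -> : (q < n - p.+1) = false by lia.
rewrite big_nat [RHS]big_nat; apply: eq_bigr => q /andP[_ qn].
rewrite perm_nat_w0 // perm_nat_w0V // andbA; congr nat_of_bool; congr andb.
by apply/andP/idP; lia.
Qed.
End LongestElement.

(** * Descending induction from the longest element *)

Section MainInduction.
Variable n : nat.
Local Notation mtab_sum := (@tab_sum n {mpoly Zbeta[n]} (@mvar n) beta n).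
Local Open Scope ring_scope.

Lemma pi_op_remove_box (i : 'I_n.-1) k (f rho : nat -> nat) :
  (forall j, (j < k)%N -> (f j <= i)%N) -> (forall j, (k < j)%N -> (i.+1 < f j)%N) ->
  (forall j, rho j.+1 <= rho j)%N -> (rho 0 <= n)%N -> rho n = 0%N ->
  (rho k.+1 < rho k)%N ->
  pi_op i (mtab_sum rho (flag_at k f i.+1)) =
  mtab_sum (remove_box k rho) (flag_at k f i.+2).
Proof.
move=> h1 h2 h3 h4 h5 h6; have ni := ltn_ord i.
have inn : (i.+2 <= n <= n)%N by lia.
have H := @pi_remove_box n {mpoly Zbeta[n]} (@mvar n) beta (@mvar_act n) (@pi_op n)
  (@mvar_neq n) (@mvar_actX n) (@mvar_act_beta n) (@mvar_pi_opE n) i k f h1 h2 n rho inn h3 h4 h5 h6.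
exact: H.
Qed.

Lemma groth_flag_data (w : 'S_n) : no2143 (perm_nat w) -> forall la f,
  flag_data (perm_nat w) (perm_nat w^-1) la f ->
  groth w = mtab_sum la f /\
  forall N s t, (n <= N)%N ->
    diagram_count n (perm_nat w) (perm_nat w^-1) s t = shape_count N la s t.
Proof.
move: w; refine (@len_ind n (fun w => no2143 (perm_nat w) -> forall la f,
  flag_data (perm_nat w) (perm_nat w^-1) la f ->
  groth w = mtab_sum la f /\
  forall N s t, (n <= N)%N ->
    diagram_count n (perm_nat w) (perm_nat w^-1) s t = shape_count N la s t) _).
move=> w IH vex la f F.
have [ww0|ww0] := eqVneq w (w0 n).
  rewrite ww0 in F *; have [laE fE] := flag_data_w0 F.
  split.
    rewrite groth_w0 /groth_top -(@tab_sum_staircase n {mpoly Zbeta[n]} (@mvar n) beta f fE).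
    by apply: eq_tab_sum => // j _; rewrite laE.
  move=> N s t nN; rewrite (diagram_count_w0 _ _ nN); apply: eq_bigr => p _.
  by apply: eq_bigr => q _; rewrite laE.
have [i0 asc0] := ascent_exists ww0.
have i0n : (i0.+1 < n)%N by have := ltn_ord i0; lia.
have uK := perm_natK w; have vK := perm_natVK w; have uge := @perm_nat_ge n w.
have [i [i1n asc H]] := ascent_step uK vK uge vex i0n asc0.
have ip : (i < n.-1)%N by lia.
pose io := Ordinal ip.
have [vex' {}H] := H _ _ (perm_nat_stransp io w) (perm_natV_stransp io w).
have [a [g [F' g1 g2 fg cnt]]] := H la f F.
have lt : (len w < len (stransp io * w)%g)%N by rewrite (@len_ascent n w io).
have [E D] := IH _ lt vex' _ _ F'.
have uK' := perm_natK (stransp io * w)%g; have vK' := perm_natVK (stransp io * w)%g.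
have uge' := @perm_nat_ge n (stransp io * w)%g.
have shE := flag_shape F'.
split; last by move=> N s t nN; apply: cnt => //; exact: D.
have la'n j : (0 < la j + (j == a))%N -> (j + (la j + (j == a)) < n)%N.
  exact: (shape_bound uK' vK' uge' shE).
have -> : groth w = pi_op io (groth (stransp io * w)%g) by apply: groth_ascent.
rewrite E; have := @pi_op_remove_box io a g (fun j => la j + (j == a))%N g1 g2.
rewrite /flag_at => ->.
- rewrite (@eq_tab_sum _ _ _ _ _ _ la _ (fun j => if j == a then i.+2 else g j)) //; last first.
    by move=> j _; rewrite /remove_box addnK.
  (* The box removal yields the flag [i.+2] in row [a]; these flags are now traded for [f]. *)
  apply: esym; apply: tab_sum_flag_change => //.
  apply/eqP; rewrite -leqn0 leqNgt; apply/negP => h.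
  by have := shape_bound uK vK uge (flag_shape F) h; lia.
- move=> j; exact: (shape_antitone shE).
- by rewrite leqNgt; apply/negP => h; have := la'n 0%N; lia.
- by apply/eqP; rewrite -leqn0 leqNgt; apply/negP => h; have := la'n n h; lia.
- have := shape_antitone (flag_shape F) a; rewrite eqxx gtn_eqF //; lia.
Qed.
End MainInduction.

(** * Shapes and flagging sets *)

Lemma cross_exists_shape n (u v : nat -> nat) :
  cancel u v -> cancel v u -> (forall j, n <= j -> u j = j) ->
  exists la : nat -> nat, forall k c, c < la k <-> in_shape u v k c.
Proof.
move=> uK vK uge.
pose P k (c : 'I_n) := [exists p : 'I_n.+1, exists q : 'I_n.+1,
  (k < cross u p q) && (c < cross v q p)].
have bd k c p q : k < cross u p q -> c < cross v q p -> [/\ p <= n, q <= n & c < n].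
  move=> h1 h2; have ne := leq_ltn_trans (leq0n k) h1; have sw := leq_ltn_trans (leq0n c) h2.
  have [h3 h4 _] := cell_bound uK vK uge ne sw.
  by split=> //; apply: leq_trans h2 (leq_trans (cross_le v q p) h4).
have PE k (c : 'I_n) : P k c <-> in_shape u v k c.
  split=> [/existsP[p /existsP[q /andP[h1 h2]]]|[p [q [h1 h2]]]]; first by exists p, q.
  have [pn qn _] := bd _ _ _ _ h1 h2.
  apply/existsP; exists (Ordinal (pn : p < n.+1)).
  by apply/existsP; exists (Ordinal (qn : q < n.+1)); rewrite h1 h2.
exists (fun k => #|[set c | P k c]|) => k c.
have down (c1 d : 'I_n) : d = c1.+1 :> nat -> P k d -> P k c1.
  move=> e /PE[p [q [h1 h2]]]; apply/PE; exists p, q; split=> //.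
  by apply: ltn_trans h2; rewrite e.
have [cn|nc] := ltnP c n.
  by rewrite -(card_initial_segment down (Ordinal cn)); exact: PE.
split=> [h|[p [q [h1 h2]]]]; last by have [_ _] := bd _ _ _ _ h1 h2; lia.
have : #|[set c | P k c]| <= n by rewrite -[X in _ <= X]card_ord max_card.
lia.
Qed.

Section Translation.
Variables (n : nat) (w : 'S_n).
Local Notation u := (perm_nat w).
Local Notation v := (perm_nat w^-1).

(** The condition on $p_i - r_w(p_i,q_i)$ thus prescribes an NE count. *)
Lemma rk_cross (p q : 'I_n) : rk w p q + cross u p.+1 q.+1 = p.+1.
Proof.
have -> : rk w p q = \sum_(0 <= j < p.+1) (u j <= q).
  rewrite /rk -sum1_card big_mkcond big_mkord (big_ord_widen n (fun j => (u j <= q) : nat)) //.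
  rewrite [RHS]big_mkcond; apply: eq_bigr => i _; rewrite inE perm_natE ltnS.
  by case: (i <= p); case: (w i <= q).
rewrite /cross -big_split /= (eq_bigr (fun=> 1)).
  by rewrite sum_nat_const_nat subn0 muln1.
by move=> j _; rewrite ltnNge; case: (u j <= q).
Qed.

Lemma essential_ess p q : p <= n -> q <= n -> essential u v p q ->
  exists p' q' : 'I_n, [/\ p = p'.+1, q = q'.+1 & (p', q') \in ess w].
Proof.
move=> pn qn /and5P[p0 q0 c1 c2 /andP[c3 c4]].
have p1 : p.-1 < n by lia.
have q1 : q.-1 < n by lia.
have pE : p.-1.+1 = p by lia.
have qE : q.-1.+1 = q by lia.
exists (Ordinal p1), (Ordinal q1); rewrite /= pE qE; split=> //.
rewrite inE; apply/andP; split.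
  rewrite inE /= -[w _ : nat](perm_natE w (Ordinal p1)) -(perm_natE w^-1 (Ordinal q1)) /=.
  by rewrite -ltnS qE ltnS c1 -[p.-1 < _]ltnS pE ltnS.
apply/forall_inP => -[a b]; rewrite inE /= -(perm_natE w a) -(perm_natE w^-1 b) => /andP[h1 h2].
apply/andP; split; apply/negP => /andP[/eqP e1 /eqP e2].
  by move: h1; rewrite e2 e1 pE /=; lia.
by move: h2; rewrite e2 e1 qE /=; lia.
Qed.

Lemma diagram_card s t :
  #|[set b in diagram w | (b.2 : nat)%:Z - (b.1 : nat)%:Z == t%:Z - s%:Z]%R| =
  diagram_count n u v s t.
Proof.
rewrite -sum1_card big_mkcond /diagram_count big_mkord.
transitivity (\sum_(p < n) \sum_(q < n) [&& q < w p, p < (w^-1)%g q & q + s == p + t] : nat).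
  rewrite pair_bigA /=; apply: eq_bigr => -[p q] _ /=; rewrite !inE /= andbA.
  have -> : ((q : nat)%:Z - (p : nat)%:Z == t%:Z - s%:Z)%R = (q + s == p + t) by lia.
  by case: ifP.
apply: eq_bigr => p _; rewrite big_mkord; apply: eq_bigr => q _.
by rewrite !perm_natE.
Qed.

Lemma shape_card (la : seq nat) N s t : size la <= N -> (forall j, nth 0 la j <= N) ->
  #|[set b : box la | (bcol b)%:Z - (brow b : nat)%:Z == t%:Z - s%:Z]%R| =
  shape_count N (nth 0 la) s t.
Proof.
move=> sN lN; rewrite -sum1_card big_mkcond /=.
transitivity (\sum_(i < size la) \sum_(j < nth 0 la i) (j + s == i + t) : nat).
  rewrite sig_big_dep /=; apply: eq_bigr => -[i j] _; rewrite inE /bcol /brow /=.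
  have -> : ((j : nat)%:Z - (i : nat)%:Z == t%:Z - s%:Z)%R = (j + s == i + t) by lia.
  by case: ifP.
rewrite /shape_count (sum_nat_trunc sN); last first.
  by move=> p np; apply: big1 => q _; rewrite nth_default.
rewrite big_mkord; apply: eq_bigr => i _.
rewrite (sum_nat_trunc (lN i)); last by move=> q nq; rewrite ltnNge nq.
by rewrite big_mkord; apply: eq_bigr => j _; rewrite ltn_ord.
Qed.

End Translation.

Lemma nth_partition la : is_partition la ->
  (forall j, nth 0 la j.+1 <= nth 0 la j) /\ (forall j, j < size la -> 0 < nth 0 la j).
Proof.
case/andP => so n0; split=> j; last first.
  by move=> js; rewrite lt0n; apply: contraNneq n0 => <-; exact: mem_nth.
have [js|sj] := ltnP j.+1 (size la); last by rewrite nth_default.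
have tr : transitive geq by move=> a b c h1 h2; exact: leq_trans h2 h1.
have := sorted_ltn_nth tr 0 so j j.+1.
by rewrite !inE => /(_ (ltnW js) js (ltnSn j)).
Qed.

Section FlaggingSet.
Variables (n : nat) (w : 'S_n) (la : seq nat) (p q : 'I_(size la) -> 'I_n).
Hypothesis pq : flagging_set w p q.
Local Notation u := (perm_nat w).
Local Notation v := (perm_nat w^-1).

(** The default [n] bounds every flag, which keeps the extension monotone. *)
Definition flag_fun j := if insub j is Some i then (p i).+1 else n.

Lemma flag_funE (i : 'I_(size la)) : flag_fun i = (p i).+1.
Proof. by rewrite /flag_fun valK. Qed.

Lemma flagging_cross (i : 'I_(size la)) : cross u (p i).+1 (q i).+1 = i.+1.
Proof. by have [_ _ _ /(_ i)] := pq; have := rk_cross w (p i) (q i); lia. Qed.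

(** [mu] is not yet identified with [la]. A corner row of [mu] is an index of the flagging set
    because its essential cell occurs there, and the NE count reveals the index. *)
Lemma flagging_flag_data (mu : nat -> nat) :
  (forall k c, c < mu k <-> in_shape u v k c) -> flag_data u v mu flag_fun.
Proof.
move=> muE; have [ess_pq p_mono q_mono _] := pq.
have uK := perm_natK w; have vK := perm_natVK w; have uge := @perm_nat_ge n w.
have corner k : mu k.+1 < mu k -> exists i : 'I_(size la),
    [/\ i = k :> nat, cross u (p i).+1 (q i).+1 = k.+1 & cross v (q i).+1 (p i).+1 = mu k].
  move=> ck; have mu0 : 0 < mu k by lia.
  have /muE[P [Q [h1 h2]]] : (mu k).-1 < mu k by rewrite prednK.
  have ne : cross u P Q = k.+1.
    apply/eqP; rewrite eqn_leq h1 andbT leqNgt; apply/negP => h3.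
    have : mu k <= mu k.+1; last by lia.
    by rewrite -(prednK mu0); apply/muE; exists P, Q.
  have sw : cross v Q P = mu k.
    apply/eqP; rewrite eqn_leq; apply/andP; split; last by rewrite -(prednK mu0).
    by rewrite leqNgt; apply/negP => h3; have /muE : in_shape u v k (mu k);
      [exists P, Q; rewrite ne|rewrite ltnn].
  have es := corner_essential uK vK muE ck ne sw.
  have [Pn Qn _] := cell_bound uK vK uge (leq_ltn_trans (leq0n _) h1) (leq_ltn_trans (leq0n _) h2).
  have [p' [q' [PE QE /ess_pq[i [e1 e2]]]]] := essential_ess Pn Qn es.
  exists i; rewrite -e1 -e2 -PE -QE; split=> //.
  by have := flagging_cross i; rewrite -e1 -e2 -PE -QE ne => -[].
split=> //.
- move=> j; rewrite /flag_fun; case: insubP => [i' j's i'E|nj]; case: insubP => [i js iE|].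
  + by rewrite ltnS; apply: p_mono; rewrite i'E iE.
  + by move=> _; exact: ltn_ord.
  + by have := ltn_ord i; lia.
  + by [].
- move=> k ck; have [i [ik ne sw]] := corner k ck.
  by exists (p i).+1, (q i).+1; split=> //; rewrite -ik flag_funE.
- move=> k mu0 mukE; have [k' kk' [e ck']] := shape_corner uK vK uge muE mu0.
  have [i [ik _ sw]] := corner _ ck'.
  have k's : k' < size la by rewrite -ik.
  (* Within a block the cells of the flagging set share their SW count. By [NE_SW], the next row
     then raises [p] by one minus the drop of [q]. *)
  have SW j (jk : j <= k') (mj : mu j = mu k') : let jo := Ordinal (leq_ltn_trans jk k's) in
      cross v (q jo).+1 (p jo).+1 = mu k'.
    set jo := Ordinal _ => /=; apply/eqP; rewrite eqn_leq; apply/andP; split.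
      case E : (cross v _ _) => [//|c]; rewrite -mj; apply/muE.
      by exists (p jo).+1, (q jo).+1; rewrite flagging_cross E.
    have ji : jo <= i by rewrite ik.
    rewrite -sw; apply: leq_trans (cross_le_p v _ _) (cross_ge_q vK uK _ _).
    + by rewrite ltnS; exact: q_mono.
    + by rewrite ltnS; exact: p_mono.
  have s1 := SW k (ltnW kk') (etrans (esym mukE) (esym e)).
  have s2 := SW k.+1 kk' (esym e).
  move: s1 s2; set jo := Ordinal _; set jo' := Ordinal _ => /= s1 s2.
  have -> : flag_fun k = (p jo).+1 := flag_funE jo.
  have -> : flag_fun k.+1 = (p jo').+1 := flag_funE jo'.
  have := flagging_cross jo; have := flagging_cross jo'.
  have := NE_SW uK vK (p jo).+1 (q jo).+1; have := NE_SW uK vK (p jo').+1 (q jo').+1.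
  have : q jo' <= q jo by apply: q_mono => /=.
  have jE : jo = k :> nat by []. have jE' : jo' = k.+1 :> nat by [].
  by rewrite s1 s2 jE jE'; lia.
Qed.
End FlaggingSet.

Theorem theorem3p2 (n : nat) (w : 'S_n) (la : seq nat)
    (p q : 'I_(size la) -> 'I_n) :
  vexillary w -> is_shape w la -> flagging_set w p q ->
  groth w = flagged_groth n (fun i => (p i).+1).
Proof.
move=> vex [la_part shE] pq; have vex' := vexillary_no2143 vex.
have uK := perm_natK w; have vK := perm_natVK w; have uge := @perm_nat_ge n w.
have [mu muE] := cross_exists_shape uK vK uge.
have [gE D] := groth_flag_data vex' (flagging_flag_data pq muE).
have [la_anti la_pos] := nth_partition la_part.
have mu_bd := shape_bound uK vK uge muE.
(* Large enough to contain both partitions, as their comparison by diagonals requires. *)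
pose N := n + size la + nth 0 la 0.
have la_le j : nth 0 la j <= nth 0 la 0 by elim: j => // j; apply: leq_trans.
have lN j : nth 0 la j <= N by have := la_le j; rewrite /N; lia.
have muN j : mu j <= N by have := mu_bd j; case: (mu j) => // m; rewrite /N; lia.
have cnt s t : shape_count N (nth 0 la) s t = shape_count N mu s t.
  rewrite -shape_card //; last by rewrite /N; lia.
  by rewrite shE diagram_card; apply: D; rewrite /N; lia.
have laE j : nth 0 la j = mu j.
  apply/eqP; rewrite eqn_leq; apply/andP; split.
    apply: (@shape_count_le N _ _ la_anti (shape_antitone muE) _ lN cnt) => k.
    by case: (ltnP k (size la)) => ks; [rewrite /N; lia|rewrite nth_default].
  apply: (@shape_count_le N _ _ (shape_antitone muE) la_anti _ muN) => [k /mu_bd|s t].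
    by rewrite /N; lia.
  by rewrite cnt.
have la_rows : size la <= n.
  case E : (size la) => [//|m]; have := la_pos m; rewrite E laE => /(_ (ltnSn m))/mu_bd; lia.
have la_cols j : nth 0 la j <= n.
  by rewrite laE; case E : (mu j) => [//|m]; have := mu_bd j; rewrite E; lia.
rewrite gE /flagged_groth.
have FE (i : 'I_(size la)) : flag_fun p i = (p i).+1 by exact: flag_funE.
have := @sum_FSVT n {mpoly Zbeta[n]} (@mvar n) beta la la_rows la_cols _ _ FE.
move=> ->; apply: eq_tab_sum => // j _; exact/esym/laE.
Qed.
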